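(* There exists a feasible online policy $\bm\pi_{\mathrm{non}\text{-}\mathrm{deg}}$, which uses as inputs only $T$, $m$, and the constants $\bar r,\bar a,\bar b,\underline b,\lambda_{\min},\lambda,\mu,\delta_B$ of the distribution (defined in the context), such that for every non-degenerate distribution $\mathcal{P}$, $$\mathrm{Regret}_{\mathcal{P}}(\bm\pi_{\mathrm{non}\text{-}\mathrm{deg}})=\mathcal{O}(\log^2T),$$ where the constant in $\mathcal{O}(\cdot)$ does not depend on $T$.
   Context: Online linear programming with replenishment. There are $m$ resources and a horizon $T$. Tuples $(r_t,\bm{a}_t,\bm{b}_t)\in\mathbb{R}\times\mathbb{R}^m\times\mathbb{R}^m_{\geq 0}$, $t=1,\dots,T$, are drawn i.i.d. from an unknown distribution $\mathcal{P}$. Inventory starts at $0$. In period $t$ each resource $j$ is first replenished by $b_{jt}$; then the order $(r_t,\bm{a}_t)$ is revealed and the decision maker chooses $x_t\in\{0,1\}$ (possibly at random) based only on $(r_k,\bm{a}_k,\bm{b}_k,x_k)_{k<t}$ and $(r_t,\bm{a}_t,\bm{b}_t)$. A policy is feasible if for every realization $\sum_{k\le t}a_{jk}x_k\le\sum_{k\le t}b_{jk}$ for all $j,t$. $R^*$ is the maximum of $\sum_t r_tx_t$ over $\bm x\in\{0,1\}^T$ subject to these prefix constraints, and $\mathrm{Regret}_{\mathcal{P}}(\bm{\pi})=\mathbb{E}[R^*-\sum_t r_tx_t]$. Bounded distribution: constants $\bar r,\bar a,\bar b>0$ with $|r|<\bar r$, $\|\bm a\|_2<\bar a$, $\|\bm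 b\|_\infty<\bar b$ a.s., and $\underline b>0$ with $\mathbb{E}[b_j]>\underline b$ for all $j$. Let $\bm B=\mathbb{E}[\bm b]$. For $\bm B'\in\mathbb{R}^m_{\ge0}$ and $\bm p\in\mathbb{R}^m_{\ge0}$ let $f(\bm p;\bm B')=\langle\bm p,\bm B'\rangle+\mathbb{E}_{(r,\bm a,\bm b)\sim\mathcal P}[r-\langle\bm a,\bm p\rangle]^+$. Let $\Omega_b=\times_{j=1}^m(\underline b,\bar b)$ and $\Omega_p=\{\bm p\in\mathbb{R}^m_{\ge0}:\sum_jp_j\le\bar r/\underline b\}$. $\mathcal P$ is non-degenerate if it is bounded and: (1) $\mathbb{E}[\bm a\bm a^\top]$ is positive definite with minimum eigenvalue $\lambda_{\min}>0$; (2) there are $\lambda,\mu>0$ such that for all $\bm p'\in\Omega_p$, $\bm B'\in\Omega_b$ and every $\bm p^*\in\arg\min_{\bm p\ge0}f(\bm p;\bm B')$, with $(\tilde r,\tilde{\bm a},\tilde{\bm b})\sim\mathcal P$: $\lambda|\langle\tilde{\bm a},\bm p'\rangle-\langle\tilde{\bm a},\bm p^*\rangle|\le|\Pr(\tilde r>\langle\tilde{\bm a},\bm p'\rangle\mid\tilde{\bm a})-\Pr(\tilde r>\langle\tilde{\bm a},\bm p^*\rangle\mid\tilde{\bm a})|\le\mu|\langle\tilde{\bm a},\bm p'\rangle-\langle\tilde{\bm a},\bm p^*\rangle|$; (3) for all $\bm B'\in\Omega_b$, every $\bm p^*\in\arg\min_{\bm p\ge0}f(\bm p;\bm B')$ and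 every $j$: $p^*_j=0\iff B'_j>\mathbb{E}[a_j\mathbb{I}(r>\langle\bm a,\bm p^*\rangle)]$ and $p^*_j>0\iff B'_j=\mathbb{E}[a_j\mathbb{I}(r>\langle\bm a,\bm p^*\rangle)]$. For non-degenerate $\mathcal P$ and $\bm B'\in\Omega_b$ the minimizer of $f(\cdot;\bm B')$ over $\bm p\ge0$ is unique; call it $\bm p^*(\bm B')$ and let $I_B(\bm B')=\{j:p^*_j(\bm B')>0\}$. $\delta_B>0$ denotes a constant such that $\times_j(B_j-\delta_B,B_j+\delta_B)\subset\Omega_b$ and $I_B(\bm B')=I_B(\bm B)$ for all $\bm B'$ in this box (such a constant exists). *)

(* Defs.v *)
From HB Require Import structures.
From mathcomp Require Import all_boot all_order all_algebra.
From mathcomp Require Import all_classical all_reals all_analysis.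

Set Implicit Arguments.
Unset Strict Implicit.
Unset Printing Implicit Defensive.

Import Order.TTheory GRing.Theory Num.Theory.
Local Open Scope classical_set_scope.
Local Open Scope ring_scope.

Section OLP.
Variable R : realType.

(* Periods are indexed 0,1,...,T-1 (paper: 1,...,T).                    *)
(* A realization of the input is given by sequences                    *)
(*   rs : nat -> R, as_ bs : nat -> 'I_m -> R,                          *)
(* and us : nat -> R is the policy's internal randomization            *)
(* (i.i.d. uniform on [0,1], independent of the data).                  *)

Definition policy (m : nat) :=
  nat -> (nat -> R) -> (nat -> 'I_m -> R) -> (nat -> 'I_m -> R) -> (nat -> R) -> bool.

(* x_t only depends on (r_k,a_k,b_k,u_k)_{k <= t}: the past orders, the
   current order and replenishment, and internal randomness.  (The past
   decisions x_k, k < t, are themselves functions of these.) *)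
Definition nonanticipative m (pol : policy m) : Prop :=
  forall t (rs rs' : nat -> R) (as_ bs as' bs' : nat -> 'I_m -> R) (us us' : nat -> R),
    (forall k, (k <= t)%N ->
       rs k = rs' k /\ as_ k = as' k /\ bs k = bs' k /\ us k = us' k) ->
    pol t rs as_ bs us = pol t rs' as' bs' us'.

Definition feasible_policy m (T : nat) (pol : policy m) : Prop :=
  forall (rs : nat -> R) (as_ bs : nat -> 'I_m -> R) (us : nat -> R),
    (forall k j, 0 <= bs k j) ->
    forall t j, (t < T)%N ->
      \sum_(k < t.+1) as_ k j * (pol k rs as_ bs us)%:R
        <= \sum_(k < t.+1) bs k j.

Definition offline_feasible m (T : nat) (as_ bs : nat -> 'I_m -> R)
  (x : {ffun 'I_T -> bool}) : bool :=
  [forall t : 'I_T, [forall j : 'I_m,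
     \sum_(k < T | (k <= t)%N) as_ k j * (x k)%:R
       <= \sum_(k < T | (k <= t)%N) bs k j]].

(* R^* : hindsight optimum.  When bs >= 0 the vector x = 0 is feasible
   with value 0, so the baseline 0 of the max does not change the value. *)
Definition Rstar m (T : nat) (rs : nat -> R) (as_ bs : nat -> 'I_m -> R) : R :=
  \big[Num.max/0]_(x : {ffun 'I_T -> bool} | @offline_feasible m T as_ bs x)
     \sum_(k < T) rs k * (x k)%:R.

Context {d : measure_display} {Omega : measurableType d}.

Definition sigma_of (V : set (Omega -> R)) : set (set Omega) :=
  <<s [set A | exists X B, V X /\ measurable B /\ A = X @^-1` B] >>.

Definition mutually_independent (P : probability Omega R) (K : eqType)
  (F : K -> set (set Omega)) : Prop :=
  forall (s : seq K) (A : K -> set Omega), uniq s ->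
    (forall k, k \in s -> F k (A k)) ->
    P (\big[setI/setT]_(k <- s) A k) = (\prod_(k <- s) fine (P (A k)))%:E.

Definition cond_prob_version (P : probability Omega R) (G : set (set Omega))
  (A : set Omega) (Y : Omega -> R) : Prop :=
  (forall B : set R, measurable B -> G (Y @^-1` B)) /\
  (forall S, G S -> (\int[P]_(w in S) (Y w)%:E)%E = P (A `&` S)).

Definition dotp m (u v : 'I_m -> R) : R := \sum_(j < m) u j * v j.

Definition block m (r : nat -> Omega -> R) (a b : nat -> 'I_m -> Omega -> R)
  (t : nat) : set (Omega -> R) :=
  [set X | X = r t \/ (exists j, X = a t j) \/ (exists j, X = b t j)].

Definition data_model m (P : probability Omega R) (r : nat -> Omega -> R)
  (a b : nat -> 'I_m -> Omega -> R) (u : nat -> Omega -> R) : Prop :=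
  (forall t, measurable_fun setT (r t)) /\
  (forall t j, measurable_fun setT (a t j)) /\
  (forall t j, measurable_fun setT (b t j)) /\
  (forall t, measurable_fun setT (u t)) /\
  (* identically distributed (equality of the joint laws on rectangles,
     which generate the Borel sigma-algebra of R x R^m x R^m) *)
  (forall t (B0 : set R) (B1 B2 : 'I_m -> set R),
     measurable B0 -> (forall j, measurable (B1 j)) -> (forall j, measurable (B2 j)) ->
     P [set w | B0 (r t w) /\ forall j, B1 j (a t j w) /\ B2 j (b t j w)] =
     P [set w | B0 (r 0 w) /\ forall j, B1 j (a 0 j w) /\ B2 j (b 0 j w)]) /\
  (forall t (x : R), 0 <= x <= 1 -> P [set w | u t w <= x] = x%:E) /\
  (forall t, P [set w | 0 <= u t w <= 1] = 1%E) /\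
  mutually_independent P
    (fun k : nat + nat => match k with
                          | inl t => sigma_of (block r a b t)
                          | inr t => sigma_of [set u t]
                          end).

(* Assumptions on the distribution P of (r, a, b), stated on a random  *)
(* tuple (r, a, b) on Omega with law P.                                *)

Definition bounded_dist m (P : probability Omega R) (r : Omega -> R)
  (a b : 'I_m -> Omega -> R) (rb ab bb bl : R) : Prop :=
  0 < rb /\ 0 < ab /\ 0 < bb /\ 0 < bl /\
  {ae P, forall w, `|r w| < rb} /\
  {ae P, forall w, Num.sqrt (\sum_(j < m) a j w ^+ 2) < ab} /\
  {ae P, forall w, forall j, 0 <= b j w /\ `|b j w| < bb} /\
  (forall j, (bl%:E < 'E_P[b j])%E).

Definition fobj m (P : probability Omega R) (r : Omega -> R)
  (a : 'I_m -> Omega -> R) (p B' : 'I_m -> R) : \bar R :=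
  ((dotp p B')%:E + 'E_P[(fun w => Num.max (r w - dotp (fun j => a j w) p) 0)%R])%E.

Definition is_minimizer m (P : probability Omega R) (r : Omega -> R)
  (a : 'I_m -> Omega -> R) (B' p : 'I_m -> R) : Prop :=
  (forall j, 0 <= p j) /\
  forall q : 'I_m -> R, (forall j, 0 <= q j) -> (fobj P r a p B' <= fobj P r a q B')%E.

Definition in_Omega_b m (bl bb : R) (B' : 'I_m -> R) : Prop :=
  forall j, bl < B' j < bb.

Definition in_Omega_p m (rb bl : R) (p : 'I_m -> R) : Prop :=
  (forall j, 0 <= p j) /\ \sum_(j < m) p j <= rb / bl.

Definition Bmean m (P : probability Omega R) (b : 'I_m -> Omega -> R) : 'I_m -> R :=
  fun j => fine 'E_P[b j].

Definition non_degenerate m (P : probability Omega R) (r : Omega -> R)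
  (a b : 'I_m -> Omega -> R) (rb ab bb bl lmin lam mu : R) : Prop :=
  bounded_dist P r a b rb ab bb bl /\
  (let M := \matrix_(i < m, j < m) fine 'E_P[(fun w => a i w * a j w)%R] in
   0 < lmin /\ eigenvalue M lmin /\ (forall e, eigenvalue M e -> lmin <= e)) /\
  (0 < lam /\ 0 < mu /\
   forall (p' B' ps : 'I_m -> R), in_Omega_p rb bl p' -> in_Omega_b bl bb B' ->
     is_minimizer P r a B' ps ->
     forall Y' Ys : Omega -> R,
       cond_prob_version P (sigma_of [set X | exists j, X = a j])
         [set w | dotp (fun j => a j w) p' < r w] Y' ->
       cond_prob_version P (sigma_of [set X | exists j, X = a j])
         [set w | dotp (fun j => a j w) ps < r w] Ys ->
       {ae P, forall w,
          lam * `|dotp (fun j => a j w) p' - dotp (fun j => a j w) ps|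
            <= `|Y' w - Ys w| /\
          `|Y' w - Ys w|
            <= mu * `|dotp (fun j => a j w) p' - dotp (fun j => a j w) ps| }) /\
  (forall (B' ps : 'I_m -> R), in_Omega_b bl bb B' -> is_minimizer P r a B' ps ->
     forall j,
       let e := fine 'E_P[(fun w => a j w * (dotp (fun i => a i w) ps < r w)%R%:R)%R] in
       (ps j = 0 <-> e < B' j) /\ (0 < ps j <-> B' j = e)).

(* delta_B: the box of radius delta_B around B = E[b] lies in Omega_b and
   the support I_B(B') of the (unique) minimizer p^*(B') is constant on it. *)
Definition delta_B_ok m (P : probability Omega R) (r : Omega -> R)
  (a b : 'I_m -> Omega -> R) (bl bb dB : R) : Prop :=
  0 < dB /\
  forall B' : 'I_m -> R,
    (forall j, Bmean P b j - dB < B' j < Bmean P b j + dB) ->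
    in_Omega_b bl bb B' /\
    forall p q : 'I_m -> R, is_minimizer P r a B' p ->
      is_minimizer P r a (Bmean P b) q -> forall j, (0 < p j) = (0 < q j).

End OLP.

(* Main.v *)
Require Import Defs.
From HB Require Import structures.
From mathcomp Require Import all_boot all_order all_algebra.
From mathcomp Require Import all_classical all_reals all_analysis.
From mathcomp Require Import ring lra zify.
From mathcomp Require Import measurable_realfun.

Set Implicit Arguments.
Unset Strict Implicit.
Unset Printing Implicit Defensive.

Import Order.TTheory GRing.Theory Num.Theory.
Local Open Scope classical_set_scope.
Local Open Scope ring_scope.

(* For any dual price p* >= 0, linear programming duality bounds the regret
   pathwise by sum_t (r_t - <a_t, p*>) (1{r_t > <a_t, p*>} - x_t) + <p*, L_T>,
   where L_T is the final inventory.  The policy works in O(log T) deterministic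
   epochs, doubling in length while the elapsed time is the scarce quantity and
   halving towards the horizon.  In an epoch of length n it accepts at a fixed
   price of a finite grid that satisfies the optimality conditions of the
   empirical dual program, with the replenishment rate shifted so as to bring
   the inventory to order sqrt (n log T); this rules out stockouts and leaves
   O(log T) of every binding resource at the end.  Nondegeneracy makes the
   dual gradient strongly monotone and Lipschitz, so such a price is within
   O(sqrt (log T / n)) of p*, and an epoch costs O(log T).  The only
   probabilistic input is a Chernoff bound, uniform over the grid and over all
   time intervals, so no conditioning on the past is needed. *)

(** The price of an epoch depends on the past, and the inventory guard couples all periods, so the
    accepted orders are not independent. Randomness therefore enters only through one event, on
    which the whole run is analysed deterministically; off it, with probability O(1/T), the trivial
    regret bound of order T is paid.

    An epoch is cheap at any length because an order treated differently by the prices p and p* has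
    its reward between <a, p> and <a, p*>. The loss per such order and the probability of such an
    order are both linear in the price error, so with error sqrt (log T / n) the mean loss, n times
    the squared error, and the fluctuation, sqrt (n log T) times the error, are both of order log T.

    Shifting the replenishment rate is harmless while the shifted rate stays in the box of radius
    delta_B, where a dual minimizer satisfies the optimality conditions. The same radius bounds the
    positive components of p* away from zero, so a nearby price is positive on every binding
    resource, and complementary slackness then lets the drift pull the stock down as well as up. The
    warm-up makes all errors small enough for this. *)

(** * The policy, its nonanticipativity and its feasibility *)

Section Policy.
Context (R : realType) (m : nat).
Variables (rb ab bb bl lmin lam mu dB : R) (T : nat).

Definition logT : R := 1 + ln T%:R.
Definition sdev (n : nat) : R := Num.sqrt (n%:R * logT).
(* The normalized deviation of a sum of n terms, i.e. sdev n / n. *)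
Definition rate (n : nat) : R := Num.sqrt (logT / n%:R).

(** Deviation threshold in units of [sdev]. The union bound runs over order T^(m+2) events and a
    failure costs order T, so every event needs probability at most T^-(m+3). *)
Definition cbeta : R := 32 * (m%:R + 3).
Definition cdev : R := cbeta * (ab + bb).
(** Rounding the m prices by at most 1/T each moves the expected usage by at most [cgrid / T]. *)
Definition cgrid : R := mu * ab ^+ 2 * m%:R.
(** Two deviations of size [cdev] and the grid error enter the optimality conditions of the chosen
    price; the third [cdev] is the deviation inside the epoch. *)
Definition ckap : R := 3 * cdev + cgrid.
(* A positive lower bound on the binding components of the optimal dual price. *)
Definition ceta : R := lam * lmin * dB / (2 * m%:R * mu ^+ 2 * ab ^+ 4).
(** The price of an epoch violates the true optimality conditions by at most [6 * ckap * rate]: 5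
    from the drift and 1 from estimation. Strong monotonicity turns this into a distance. *)
Definition cdist : R := 6 * ckap * m%:R / (lam * lmin).
(* Epochs have length at least crho ^ 2 * logT; each summand makes one of the
   requirements on rate hold for such lengths. *)
Definition crho : R := cdist / ceta + 5 * ckap / dB + (cdev + ckap) / bl + 1.
(** The offset 2 rounds up and makes every active epoch longer than one period. *)
Definition warmup : nat := (Num.truncn (crho ^+ 2 * logT)).+2.

(** The bound by [s] provides at least as many past observations as the epoch is long; taking half
    of the remaining time keeps consecutive lengths comparable. *)
Definition epoch_len (s : nat) : nat := minn s ((T - s)./2).

(** Recursion on the period rather than on an epoch index. During the warm-up the value exceeds [t],
    which [accept] uses to reject. *)
Fixpoint epoch_start (t : nat) : nat :=
  if t is t'.+1 then
    let s := epoch_start t' in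
    if (s + epoch_len s <= t)%N then (s + epoch_len s)%N else s
  else warmup.

(** Mesh 1/T on a cube containing Omega_p: only order T^m points for the union bound, yet finer than
    [rate n] for every positive n up to T. *)
Definition grid : finType := {ffun 'I_m -> 'I_(Num.truncn (rb / bl * T%:R)).+1}.

Definition price (k : grid) (j : 'I_m) : R := (k j)%:R / T%:R.

Section Decision.
Variables (rs : nat -> R) (as_ bs : nat -> 'I_m -> R) (x : nat -> bool).

Definition inventory (t : nat) (j : 'I_m) : R :=
  \sum_(k < t) (bs k j - as_ k j * (x k)%:R).

Definition usage (p : 'I_m -> R) (s n : nat) (j : 'I_m) : R :=
  \sum_(s <= k < s + n) as_ k j * (dotp (as_ k) p < rs k)%R%:R.

Definition supply (s n : nat) (j : 'I_m) : R := \sum_(s <= k < s + n) bs k j.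

(* Moves the inventory towards 3 * ckap * sdev n by the end of the epoch. *)
Definition drift (s : nat) (j : 'I_m) : R :=
  let n := epoch_len s in
  Num.max ((3 * ckap * sdev n - inventory s j) / n%:R) (- (5 * ckap * rate n)).

(** Complementary slackness: the lower bound is required only at positive prices. [tol] is what the
    rounded true solution needs in order to pass. *)
Definition price_ok (s : nat) (k : grid) : bool :=
  let tol := (cdev + cgrid) * rate (epoch_len s) in
  (\sum_(j < m) price k j <= rb / bl) &&
  [forall j : 'I_m,
     (usage (price k) 0 s j / s%:R <= supply 0 s j / s%:R - drift s j + tol) &&
     ((0 < price k j) ==>
        (supply 0 s j / s%:R - drift s j - tol <= usage (price k) 0 s j / s%:R))].

Definition epoch_price (s : nat) : option grid := [pick k | price_ok s k].

(** The last conjunct makes the policy feasible on every path; on a good path it never overrules the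
    price ([epoch_accept]). *)
Definition accept (t : nat) : bool :=
  let s := epoch_start t in
  [&& (warmup <= epoch_len s)%N, (s <= t)%N,
      (if epoch_price s is Some k then dotp (as_ t) (price k) < rs t else false) &
      [forall j : 'I_m, as_ t j <= inventory t j + bs t j]].

End Decision.

(** Decisions feed back through the inventory, so the decision sequence is built up as a function
    that is still [false] from period [t] on. *)
Fixpoint history rs as_ bs (t : nat) : nat -> bool :=
  if t is t'.+1 then
    fun k => if k == t' then accept rs as_ bs (history rs as_ bs t') t'
             else history rs as_ bs t' k
  else fun=> false.

Definition epoch_policy : policy R m :=
  fun t rs as_ bs _ => history rs as_ bs t.+1 t.

(** Serves twice: with the same data it identifies [history] with the decisions of the policy
    itself, and with data that agree up to [t] it gives nonanticipativity. *)
Lemma accept_congr t rs rs' as_ as' bs bs' x x' :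
  (forall k, (k <= t)%N -> rs k = rs' k /\ as_ k = as' k /\ bs k = bs' k) ->
  (forall k, (k < t)%N -> x k = x' k) ->
  accept rs as_ bs x t = accept rs' as' bs' x' t.
Proof.
move=> hd hx.
have hinv s j : (s <= t)%N -> inventory as_ bs x s j = inventory as' bs' x' s j.
  move=> st; apply: eq_bigr => k _.
  have kt : (k < t)%N by exact: leq_trans (ltn_ord k) st.
  by have [_ [-> ->]] := hd _ (ltnW kt); rewrite hx.
(* If the epoch lies ahead, its price would depend on future data; both sides then reject by the
   test [s <= t]. *)
rewrite /accept; case: (leqP (epoch_start t) t) => [st|_]; last by rewrite !andbF.
congr (_ && (_ && (_ && _))); last first.
  by apply: eq_forallb => j; rewrite hinv//; have [_ [-> ->]] := hd _ (leqnn t).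
set s := epoch_start t.
have -> : epoch_price rs as_ bs x s = epoch_price rs' as' bs' x' s.
  apply: eq_pick => k; rewrite /price_ok; congr (_ && _).
  apply: eq_forallb => j.
  have -> : usage rs as_ (price k) 0 s j = usage rs' as' (price k) 0 s j.
    apply: eq_big_nat => i /andP[_ ilt].
    by have [-> [-> _]] := hd _ (ltnW (leq_trans ilt st)).
  have -> : supply bs 0 s j = supply bs' 0 s j.
    apply: eq_big_nat => i /andP[_ ilt].
    by have [_ [_ ->]] := hd _ (ltnW (leq_trans ilt st)).
  by rewrite /drift hinv.
by case: epoch_price => // k; have [-> [-> _]] := hd _ (leqnn t).
Qed.

Lemma historyE rs as_ bs us t k :
  (k < t)%N -> history rs as_ bs t k = epoch_policy k rs as_ bs us.
Proof.
elim: t => // t ih; rewrite ltnS leq_eqVlt => /predU1P[->|kt].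
  by rewrite /epoch_policy /= !eqxx.
by rewrite [LHS]/= ltn_eqF// ih.
Qed.

Lemma epoch_policyE rs as_ bs us t :
  epoch_policy t rs as_ bs us =
  accept rs as_ bs (fun k => epoch_policy k rs as_ bs us) t.
Proof.
rewrite {1}/epoch_policy /= eqxx; apply: accept_congr => // k kt.
exact: historyE.
Qed.

Lemma epoch_policy_nonanticipative : nonanticipative epoch_policy.
Proof.
move=> t rs rs' as_ bs as' bs' us us'.
elim/ltn_ind: t => t ih hd.
rewrite !epoch_policyE; apply: accept_congr => [k /hd[? [? [? _]]]|k kt] //.
by apply: ih => // i ik; apply: hd; exact: leq_trans ik (ltnW kt).
Qed.

Lemma inventoryS as_ bs x t j :
  inventory as_ bs x t.+1 j = inventory as_ bs x t j + (bs t j - as_ t j * (x t)%:R).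
Proof. by rewrite /inventory big_ord_recr. Qed.

Lemma epoch_policy_inventory_ge0 rs as_ bs us (t : nat) j :
  (forall k j, 0 <= bs k j) ->
  0 <= inventory as_ bs (fun k => epoch_policy k rs as_ bs us) t j.
Proof.
move=> b0; elim: t => [|t ih]; first by rewrite /inventory big_ord0.
rewrite inventoryS epoch_policyE; case h : accept; last first.
  by rewrite mulr0 subr0 addr_ge0.
move: h; rewrite /accept => /and4P[_ _ _ /forallP/(_ j)].
by rewrite mulr1; lra.
Qed.

Lemma epoch_policy_feasible : feasible_policy T epoch_policy.
Proof.
move=> rs as_ bs us b0 t j _.
have := epoch_policy_inventory_ge0 rs as_ us t.+1 j b0.
by rewrite /inventory sumrB subr_ge0.
Qed.

End Policy.

(** * Weak duality for the hindsight optimum *)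

Section Duality.
Context (R : realType) (m T : nat).
Variables (rs : nat -> R) (as_ bs : nat -> 'I_m -> R) (ps : 'I_m -> R).

(** Only the constraint of the last period is kept. Its Lagrangian with multiplier [ps] separates
    over periods, and each term is largest under the threshold rule. *)
Lemma Rstar_le_dual :
  (forall j, 0 <= ps j) -> (forall t j, (t < T)%N -> 0 <= bs t j) ->
  Rstar T rs as_ bs <=
    \sum_(t < T) (rs t - dotp (as_ t) ps) * (dotp (as_ t) ps < rs t)%R%:R +
    \sum_(j < m) ps j * \sum_(t < T) bs t j.
Proof.
move=> ps0 b0; apply: bigmax_le => [|x /forallP feas].
  apply: addr_ge0; apply: sumr_ge0 => i _; last first.
    by apply: mulr_ge0 => //; apply: sumr_ge0 => t _; exact: b0.
  by case: ltP => h; rewrite ?mulr0 ?mulr1//; lra.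
have -> : \sum_(t < T) rs t * (x t)%:R =
    \sum_(t < T) (rs t - dotp (as_ t) ps) * (x t)%:R +
    \sum_(j < m) ps j * \sum_(t < T) as_ t j * (x t)%:R.
  under [X in _ + X]eq_bigr do rewrite mulr_sumr.
  rewrite [X in _ + X]exchange_big /= -big_split /=; apply: eq_bigr => t _.
  under [X in _ = _ + X]eq_bigr do rewrite mulrCA mulrA.
  rewrite -mulr_suml (_ : \sum_(i < m) _ = dotp (as_ t) ps); last by [].
  ring.
apply: lerD; apply: ler_sum => i _.
  by case: (x i); case: ltP => h; rewrite ?mulr0 ?mulr1//; lra.
apply: ler_wpM2l => //.
case: T x feas b0 => [|n] x feas b0; first by rewrite !big_ord0.
have /forallP/(_ i) := feas ord_max.
have hT (F : 'I_n.+1 -> R) : \sum_(k < n.+1 | (k <= @ord_max n)%N) F k = \sum_(k < n.+1) F k.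
  by apply: eq_bigl => k; rewrite /= -ltnS ltn_ord.
by rewrite !hT.
Qed.

Lemma regret_le_dual (x : nat -> bool) :
  (forall j, 0 <= ps j) -> (forall t j, (t < T)%N -> 0 <= bs t j) ->
  Rstar T rs as_ bs - \sum_(t < T) rs t * (x t)%:R <=
    \sum_(t < T) (rs t - dotp (as_ t) ps) *
                 ((dotp (as_ t) ps < rs t)%R%:R - (x t)%:R) +
    \sum_(j < m) ps j * inventory as_ bs x T j.
Proof.
move=> ps0 b0; have := Rstar_le_dual ps0 b0.
suff -> : \sum_(t < T) rs t * (x t)%:R =
    \sum_(t < T) (rs t - dotp (as_ t) ps) * (x t)%:R +
    \sum_(j < m) ps j * \sum_(t < T) as_ t j * (x t)%:R.
  have -> : \sum_(j < m) ps j * inventory as_ bs x T j =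
      \sum_(j < m) ps j * \sum_(t < T) bs t j -
      \sum_(j < m) ps j * \sum_(t < T) as_ t j * (x t)%:R.
    by rewrite -sumrB; apply: eq_bigr => j _; rewrite -mulrBr /inventory -sumrB.
  have -> : \sum_(t < T) (rs t - dotp (as_ t) ps) *
                 ((dotp (as_ t) ps < rs t)%R%:R - (x t)%:R) =
      \sum_(t < T) (rs t - dotp (as_ t) ps) * (dotp (as_ t) ps < rs t)%R%:R -
      \sum_(t < T) (rs t - dotp (as_ t) ps) * (x t)%:R.
    by rewrite -sumrB; apply: eq_bigr => t _; rewrite mulrBr.
  by lra.
under [X in _ + X]eq_bigr do rewrite mulr_sumr.
rewrite [X in _ + X]exchange_big /= -big_split /=; apply: eq_bigr => t _.
under [X in _ = _ + X]eq_bigr do rewrite mulrCA mulrA.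
rewrite -mulr_suml (_ : \sum_(i < m) _ = dotp (as_ t) ps); last by [].
ring.
Qed.

End Duality.

(** * Combinatorics of the epoch schedule *)

Section EpochLength.
Variable T : nat.

(** Lengths within a factor 4 of each other give values of [sdev] within a factor 2, which is all
    the slack the inventory targets have. *)
Lemma epoch_len_next s : (1 < epoch_len T s)%N ->
  (epoch_len T (s + epoch_len T s) <= 2 * epoch_len T s)%N /\ (epoch_len T s <= 4 * epoch_len T (s + epoch_len T s))%N.
Proof. by rewrite /epoch_len; lia. Qed.

Lemma epoch_len_le s : (epoch_len T s <= s)%N. Proof. exact: geq_minl. Qed.

(** The maximum covers [s > T], where truncated subtraction gives length 0. *)
Lemma epoch_len_bound s : (s + 2 * epoch_len T s <= maxn s T)%N.
Proof. by rewrite /epoch_len; lia. Qed.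

End EpochLength.

Section Schedule.
Context (R : realType) (m : nat).
Variables (ab bb bl lmin lam mu dB : R) (T : nat).
Let n0 := warmup m ab bb bl lmin lam mu dB T.
Let est := epoch_start m ab bb bl lmin lam mu dB T.
Let len := epoch_len T.

Lemma epoch_start_mono s t : (s <= t)%N -> (est s <= est t)%N.
Proof.
move=> /subnK <-; elim: (t - s)%N => // k ih; apply: (leq_trans ih).
rewrite addSn /est /=; case: ifP => // _; exact: leq_addr.
Qed.

Lemma epoch_start_warmup t : (t <= n0)%N -> est t = n0.
Proof.
elim: t => // t ih tn; have e : est t = n0 by apply: ih; exact: ltnW.
rewrite /est /= -/est e; case: ifP => // h.
by move: h tn; rewrite /len; clearbody n0; lia.
Qed.

Lemma epoch_start_inside s i : est s = s -> (i < len s)%N -> est (s + i) = s.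
Proof.
move=> es; elim: i => [|i ih] ilt; first by rewrite addn0.
rewrite addnS /est /= -/est ih; last exact: ltnW.
by rewrite -addnS leq_add2l leqNgt ilt.
Qed.

Lemma epoch_start_next s :
  est s = s -> (0 < len s)%N -> est (s + len s) = (s + len s)%N.
Proof.
move=> es; case e : (len s) => [//|k] _.
rewrite addnS /est /= -/est epoch_start_inside ?e//.
by rewrite -/len e addnS leqnn.
Qed.

End Schedule.

(** * Arithmetic of the deviation scales *)

Section Rates.
Context (R : realType) (T : nat).
Hypothesis T2 : (2 <= T)%N.
Local Notation l := (logT R T).

Lemma logT_ge1 : 1 <= l.
Proof. by rewrite /logT lerDl ln_ge0// ler1n (ltnW T2). Qed.

Lemma sdev_le n n' : (n <= n')%N -> sdev R T n <= sdev R T n'.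
Proof.
move=> h; apply: ler_wsqrtr; apply: ler_wpM2r; last by rewrite ler_nat.
exact: le_trans ler01 logT_ge1.
Qed.

Lemma sdev_mulnat c n : sdev R T (c ^ 2 * n) = c%:R * sdev R T n.
Proof.
rewrite /sdev natrM natrX -mulrA sqrtrM ?sqr_ge0//.
by rewrite sqrtr_sqr ger0_norm.
Qed.

Lemma sdevE n : (0 < n)%N -> sdev R T n = n%:R * rate R T n.
Proof.
move=> n0; have n0' : 0 < n%:R :> R by rewrite ltr0n.
rewrite /sdev /rate (_ : n%:R * l = n%:R ^+ 2 * (l / n%:R)); last first.
  by field; rewrite gt_eqF.
by rewrite sqrtrM ?sqr_ge0// sqrtr_sqr ger0_norm// ltW.
Qed.

Lemma sdev_rate n : (0 < n)%N -> sdev R T n * rate R T n = l.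
Proof.
move=> n0; have n0' : 0 < n%:R :> R by rewrite ltr0n.
have l0 : 0 <= l := le_trans ler01 logT_ge1.
rewrite /sdev /rate -sqrtrM; last by apply: mulr_ge0 => //; exact: ltW.
rewrite (_ : n%:R * l * (l / n%:R) = l ^+ 2); last by field; rewrite gt_eqF.
by rewrite sqrtr_sqr ger0_norm.
Qed.

Lemma rate_ge0 n : 0 <= rate R T n. Proof. exact: sqrtr_ge0. Qed.
Lemma sdev_ge0 n : 0 <= sdev R T n. Proof. exact: sqrtr_ge0. Qed.

Lemma rate_le n n' : (0 < n)%N -> (n <= n')%N -> rate R T n' <= rate R T n.
Proof.
move=> n0 h; apply: ler_wsqrtr; apply: ler_wpM2l.
  exact: le_trans ler01 logT_ge1.
by rewrite lef_pV2 ?ler_nat// posrE ltr0n// (leq_trans n0).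
Qed.

Lemma rate_geT n : (0 < n <= T)%N -> T%:R^-1 <= rate R T n.
Proof.
move=> /andP[n0 nT]; have T0 : 0 < T%:R :> R by rewrite ltr0n (ltnW T2).
have n0' : 0 < n%:R :> R by rewrite ltr0n.
apply: (@le_trans _ _ (Num.sqrt (T%:R ^- 2))).
  by rewrite -exprVn sqrtr_sqr ger0_norm// invr_ge0 ltW.
apply: ler_wsqrtr; rewrite ler_pdivlMr// (le_trans _ logT_ge1)//.
rewrite mulrC ler_pdivrMr ?exprn_gt0// mul1r.
rewrite -natrX ler_nat (leq_trans nT)//.
by rewrite -{1}(expn1 T) leq_pexp2l// (ltnW T2).
Qed.

End Rates.

(** * Deterministic regret analysis on a good path *)

Section Pathwise.
Context (R : realType) (m : nat).
Variables (rb ab bb bl lmin lam mu dB : R) (T : nat).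

Definition dist1 (p q : 'I_m -> R) : R := \sum_(j < m) `|p j - q j|.

(** Cauchy-Schwarz, obtained by summing 2 y |x_j| <= y^2 + x_j^2 over j with y the average of the
    |x_j|. *)
Lemma dist1_sqr_le (p q : 'I_m -> R) :
  dist1 p q ^+ 2 <= m%:R * \sum_(j < m) (p j - q j) ^+ 2.
Proof.
set D := dist1 p q; have hy y : 2 * y * D <= m%:R * y ^+ 2 + \sum_(j < m) (p j - q j) ^+ 2.
  rewrite /D /dist1 mulr_sumr.
  have -> : m%:R * y ^+ 2 = \sum_(j < m) y ^+ 2.
    by rewrite sumr_const card_ord mulr_natl.
  rewrite -big_split /=; apply: ler_sum => j _.
  rewrite -[(p j - q j) ^+ 2]real_normK ?num_real//.
  have := sqr_ge0 (y - `|p j - q j|); nra.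
have [m1|m1] := posnP m.
  have -> : D = 0 by rewrite /D /dist1 big1// => j; have := ltn_ord j; rewrite {2}m1.
  by rewrite expr0n /= mulr_ge0// sumr_ge0// => j _; exact: sqr_ge0.
have m0 : 0 < m%:R :> R by rewrite ltr0n.
have := hy (D / m%:R).
have -> : 2 * (D / m%:R) * D = 2 * (D ^+ 2 / m%:R) by ring.
have -> : m%:R * (D / m%:R) ^+ 2 = D ^+ 2 / m%:R by field; rewrite gt_eqF.
move=> h'; rewrite mulrC -ler_pdivrMr//; lra.
Qed.

(* phi is the expected resource usage per period as a function of the price,
   B the mean replenishment and ps an optimal dual price for B. *)
Record dual_facts (phi : ('I_m -> R) -> 'I_m -> R) (B ps : 'I_m -> R) : Prop := {
  df_ps : in_Omega_p rb bl ps ;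
  df_B : forall j, bl <= B j ;
  df_kkt : forall j, phi ps j <= B j /\ (0 < ps j -> phi ps j = B j) ;
  df_eta : forall j, 0 < ps j -> ceta m ab lmin lam mu dB <= ps j ;
  df_mono : forall p, in_Omega_p rb bl p ->
    lam * lmin * \sum_(j < m) (p j - ps j) ^+ 2
      <= - \sum_(j < m) (phi p j - phi ps j) * (p j - ps j) ;
  df_exist : forall g, (forall j, `|g j| < dB) -> exists q,
    [/\ in_Omega_p rb bl q,
        forall j, phi q j <= B j - g j /\ (0 < q j -> phi q j = B j - g j) &
        forall p, in_Omega_p rb bl p ->
          forall j, `|phi p j - phi q j| <= mu * ab ^+ 2 * dist1 p q] }.

(** The bounds hold for all intervals and all grid prices at once, so they may be applied to a price
    selected from the very same path. In [gp_reward] the first term bounds the mean loss, the second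
    its deviation, on the scale of the range of the loss. *)
Record good_path (phi : ('I_m -> R) -> 'I_m -> R) (B ps : 'I_m -> R)
    (rs : nat -> R) (as_ bs : nat -> 'I_m -> R) : Prop := {
  gp_r : forall t, (t < T)%N -> `|rs t| <= rb ;
  gp_a : forall t j, (t < T)%N -> `|as_ t j| <= ab ;
  gp_b : forall t j, (t < T)%N -> 0 <= bs t j <= bb ;
  gp_usage : forall (k : grid m rb bl T) s n j, (s + n <= T)%N ->
    `|usage rs as_ (price k) s n j - n%:R * phi (price k) j|
      <= cbeta R m * ab * sdev R T n ;
  gp_supply : forall s n j, (s + n <= T)%N ->
    `|supply bs s n j - n%:R * B j| <= cbeta R m * bb * sdev R T n ;
  gp_reward : forall (k : grid m rb bl T) s n, (s + n <= T)%N ->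
    in_Omega_p rb bl (price k) ->
    \sum_(s <= t < s + n) (rs t - dotp (as_ t) ps) *
       ((dotp (as_ t) ps < rs t)%R%:R - (dotp (as_ t) (price k) < rs t)%R%:R)
    <= n%:R * (mu * ab ^+ 2 * dist1 (price k) ps ^+ 2)
       + cbeta R m * ab * (dist1 (price k) ps + T%:R^-1) * sdev R T n }.

Section Fixed.
Hypotheses (m0 : (0 < m)%N) (T2 : (2 <= T)%N).
Hypotheses (rb0 : 0 < rb) (ab0 : 0 < ab) (bb0 : 0 < bb) (bl0 : 0 < bl).
Hypotheses (lmin0 : 0 < lmin) (lam0 : 0 < lam) (mu0 : 0 < mu) (dB0 : 0 < dB).

Variables (phi : ('I_m -> R) -> 'I_m -> R) (B ps : 'I_m -> R).
Hypothesis DF : dual_facts phi B ps.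
Variables (rs : nat -> R) (as_ bs : nat -> 'I_m -> R) (us : nat -> R).
Hypothesis GP : good_path phi B ps rs as_ bs.

Local Notation l := (logT R T).
Local Notation sdev := (sdev R T).
Local Notation rate := (rate R T).
Local Notation kap := (ckap m ab bb mu).
Local Notation n0 := (warmup m ab bb bl lmin lam mu dB T).
Local Notation est := (epoch_start m ab bb bl lmin lam mu dB T).
Local Notation len := (epoch_len T).
Local Notation x := (fun k => epoch_policy rb ab bb bl lmin lam mu dB T k rs as_ bs us).
Local Notation L := (inventory as_ bs x).

Lemma cbeta_gt0 : 0 < cbeta R m.
Proof. by rewrite /cbeta mulr_gt0// ltr_wpDl. Qed.

Lemma cdev_gt0 : 0 < cdev m ab bb.
Proof. by rewrite /cdev mulr_gt0 ?cbeta_gt0// addr_gt0. Qed.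

Lemma cgrid_gt0 : 0 < cgrid m ab mu.
Proof. by rewrite /cgrid !mulr_gt0 ?exprn_gt0 ?ltr0n. Qed.

Lemma ckap_gt0 : 0 < kap.
Proof. by rewrite /ckap addr_gt0 ?cgrid_gt0// mulr_gt0 ?cdev_gt0. Qed.

Lemma ceta_gt0 : 0 < ceta m ab lmin lam mu dB.
Proof. by rewrite /ceta divr_gt0 ?mulr_gt0 ?exprn_gt0 ?ltr0n. Qed.

Lemma cdist_gt0 : 0 < cdist m ab bb lmin lam mu.
Proof. by rewrite /cdist divr_gt0 ?mulr_gt0 ?ckap_gt0 ?ltr0n. Qed.

Lemma crho_ge1 : 1 <= crho m ab bb bl lmin lam mu dB.
Proof.
rewrite /crho lerDr; have := (cdev_gt0, ckap_gt0, ceta_gt0, cdist_gt0).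
move=> [[[c0 k0] e0] d0]; rewrite addr_ge0//; first rewrite addr_ge0//.
- by rewrite divr_ge0 ?ltW.
- by apply: divr_ge0; first apply: mulr_ge0; rewrite ?ltW.
- by apply: divr_ge0; first apply: addr_ge0; exact: ltW.
Qed.

Lemma warmup_ge : crho m ab bb bl lmin lam mu dB ^+ 2 * l <= n0%:R.
Proof.
rewrite /warmup; set y := _ * l.
have y0 : 0 <= y.
  by rewrite mulr_ge0 ?sqr_ge0// (le_trans ler01)// logT_ge1.
have /andP[_ /ltW h] := truncn_itv y0.
by apply: le_trans h _; rewrite ler_nat.
Qed.

Lemma warmup_le : n0%:R <= (crho m ab bb bl lmin lam mu dB ^+ 2 + 2) * l.
Proof.
rewrite /warmup; set y := _ ^+ 2.
have l1 := logT_ge1 R T2.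
have y0 : 0 <= y * l by rewrite mulr_ge0 ?sqr_ge0// (le_trans ler01).
have /andP[h _] := truncn_itv y0.
rewrite -addn2 natrD; nra.
Qed.

(** The length of the warm-up gives [crho * rate n <= 1]. Each conclusion keeps one summand of
    [crho], and the summand 1 provides strictness. *)
Lemma rate_small n : (n0 <= n)%N ->
  [/\ cdist m ab bb lmin lam mu * rate n < ceta m ab lmin lam mu dB,
      5 * kap * rate n < dB & (cdev m ab bb + kap) * rate n <= bl].
Proof.
move=> hn; have l1 := logT_ge1 R T2.
have nn0 : (0 < n)%N by apply: leq_trans hn; rewrite /warmup.
have n0' : 0 < n%:R :> R by rewrite ltr0n.
have := (cdev_gt0, ckap_gt0, ceta_gt0, cdist_gt0); move=> [[[c0 k0] e0] d0].
have r0 : 0 < rate n by rewrite /rate sqrtr_gt0 divr_gt0// (lt_le_trans ltr01).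
have h1 : crho m ab bb bl lmin lam mu dB * rate n <= 1.
  have c1 := lt_le_trans ltr01 crho_ge1; have l0 := lt_le_trans ltr01 l1.
  rewrite -(@ler_pXn2r _ 2) ?nnegrE//; last by rewrite mulr_ge0 ?ltW.
  rewrite exprMn /rate sqr_sqrtr; last by rewrite divr_ge0 ?ltW.
  rewrite expr1n mulrA ler_pdivrMr// mul1r.
  by apply: le_trans warmup_ge _; rewrite ler_nat.
pose A := cdist m ab bb lmin lam mu / ceta m ab lmin lam mu dB * rate n.
pose D := 5 * kap / dB * rate n.
pose E := (cdev m ab bb + kap) / bl * rate n.
have eADE : crho m ab bb bl lmin lam mu dB * rate n = A + D + E + rate n.
  by rewrite /crho /A /D /E; ring.
have A0 : 0 < A by apply: mulr_gt0 => //; apply: divr_gt0.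
have D0 : 0 < D by apply: mulr_gt0 => //; apply: divr_gt0 => //; apply: mulr_gt0.
have E0 : 0 < E by apply: mulr_gt0 => //; apply: divr_gt0 => //; apply: addr_gt0.
move: h1; rewrite eADE => h; split.
- have : A < 1 by lra.
  by rewrite /A mulrAC ltr_pdivrMr// mul1r.
- have : D < 1 by lra.
  by rewrite /D mulrAC ltr_pdivrMr// mul1r.
- have : E <= 1 by lra.
  by rewrite /E mulrAC ler_pdivrMr// mul1r.
Qed.

Lemma inventory_add (p : 'I_m -> R) s n j :
  (forall i, (i < n)%N -> x (s + i)%N = (dotp (as_ (s + i)%N) p < rs (s + i)%N)) ->
  L (s + n)%N j = L s j + supply bs s n j - usage rs as_ p s n j.
Proof.
elim: n => [|n ih] h.
  by rewrite addn0 /supply /usage addn0 !big_geq// addr0 subr0.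
rewrite addnS inventoryS ih; last by move=> i hi; apply: h; exact: ltnW.
rewrite /supply /usage addnS !big_nat_recr ?leq_addr//=.
by rewrite h//; lra.
Qed.

(** Where [p j] and [ps j] differ, the larger one is positive, so its slackness condition fixes the
    sign of the usage gap up to [e]. Strong monotonicity then bounds the squared Euclidean distance
    by a multiple of [e * dist1 p ps], and Cauchy-Schwarz cancels one factor of the distance. *)
Lemma kkt_distance (p : 'I_m -> R) e :
  0 <= e -> in_Omega_p rb bl p ->
  (forall j, phi p j <= B j + e) -> (forall j, 0 < p j -> B j - e <= phi p j) ->
  dist1 p ps <= m%:R * e / (lam * lmin).
Proof.
move=> e0 hp h1 h2; set D := dist1 p ps.
have D0 : 0 <= D by apply: sumr_ge0.
have [ps0 _] := df_ps DF; have [p0 _] := hp.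
have hm : lam * lmin * \sum_(j < m) (p j - ps j) ^+ 2 <= e * D.
  apply: le_trans (df_mono DF hp) _; rewrite -sumrN mulr_sumr.
  apply: ler_sum => j _; have [k1 k2] := df_kkt DF j.
  have [hj|hj|hj] := ltgtP (p j) (ps j).
  - have := k2 (le_lt_trans (p0 j) hj); have := h1 j => ? ?.
    by rewrite ltr0_norm ?subr_lt0//; nra.
  - have := h2 j (le_lt_trans (ps0 j) hj) => ?.
    by rewrite gtr0_norm ?subr_gt0//; nra.
  - by rewrite hj subrr mulr0 oppr0 mulr_ge0.
have cs : D ^+ 2 <= m%:R * \sum_(j < m) (p j - ps j) ^+ 2 by exact: dist1_sqr_le.
have ll0 : 0 < lam * lmin by rewrite mulr_gt0.
rewrite ler_pdivlMr//; have [/eqP->|Dn0] := boolP (D == 0).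
  by rewrite mul0r mulr_ge0.
have Dp : 0 < D by rewrite lt_def Dn0.
rewrite -(ler_pM2l Dp); have m1 : 0 < m%:R :> R by rewrite ltr0n.
nra.
Qed.

Lemma dist1_coord (p q : 'I_m -> R) j : `|p j - q j| <= dist1 p q.
Proof. by rewrite /dist1 (bigD1 j)//= lerDl; apply: sumr_ge0. Qed.

(** * One epoch: accuracy of the price, control of the inventory, cost *)

Section Epoch.
Variable s : nat.
Local Notation n := (len s).
Local Notation g := (drift ab bb mu T as_ bs x s).
Hypotheses (hs : est s = s) (hn : (n0 <= n)%N).
Hypothesis hL : forall j, kap * sdev n <= L s j.

Let ckapE : kap = 3 * cdev m ab bb + cgrid m ab mu. Proof. by []. Qed.
Let cdevE : cdev m ab bb = cbeta R m * ab + cbeta R m * bb.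
Proof. by rewrite /cdev mulrDr. Qed.
Let cdistE : cdist m ab bb lmin lam mu = 6 * kap * m%:R / (lam * lmin).
Proof. by []. Qed.
Let c0 : 0 < cdev m ab bb. Proof. exact: cdev_gt0. Qed.
Let g0 : 0 < cgrid m ab mu. Proof. exact: cgrid_gt0. Qed.
Let be0 : 0 < cbeta R m. Proof. exact: cbeta_gt0. Qed.
Let k0 : 0 < kap. Proof. exact: ckap_gt0. Qed.
Opaque cdev cgrid ckap cbeta cdist ceta.

Let n1 : (1 < n)%N. Proof. by apply: leq_trans hn; rewrite /warmup. Qed.
Let ns : (n <= s)%N. Proof. exact: epoch_len_le. Qed.
Let snT : (s + 2 * n <= T)%N.
Proof. by have := epoch_len_bound T s; clear -n1 ns; lia. Qed.
Local Ltac nat_lia := clear -n1 ns snT; lia.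
Let n0' : 0 < n%:R :> R. Proof. by rewrite ltr0n; nat_lia. Qed.
Let r0 : 0 <= rate n. Proof. exact: (rate_ge0 R T n). Qed.
Let siT i : (i <= n)%N -> (s + i <= T)%N. Proof. by nat_lia. Qed.
Let sd0 : 0 <= sdev n. Proof. exact: (sdev_ge0 R T n). Qed.
Let sdE : sdev n = n%:R * rate n. Proof. by apply: sdevE => //; nat_lia. Qed.

Lemma drift_ge1 j : 3 * kap * sdev n - L s j <= n%:R * g j.
Proof.
rewrite -ler_pdivrMl// mulrC /drift.
by rewrite le_max lexx.
Qed.

Lemma drift_ge2 j : - (5 * kap * rate n) <= g j.
Proof. by rewrite /drift le_max lexx orbT. Qed.

Lemma drift_le j : n%:R * g j <= Num.max (3 * kap * sdev n - L s j) (- (5 * kap * sdev n)).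
Proof.
rewrite -ler_pdivlMl// /drift ge_max; apply/andP; split.
  rewrite [leLHS]mulrC; apply: ler_wpM2l; first by rewrite invr_ge0 ltW.
  by rewrite le_max lexx.
rewrite ler_pdivlMl// le_max; apply/orP; right.
by rewrite sdE; lra.
Qed.

(** Below, the truncation in [drift] acts; above, the stock is at least [kap * sdev n], which leaves
    [2 * kap * rate n]. *)
Lemma drift_norm j : `|g j| <= 5 * kap * rate n.
Proof.
rewrite ler_norml drift_ge2 /=; have := drift_le j.
rewrite -ler_pdivlMl// => /le_trans; apply; rewrite ler_pdivrMl// ge_max.
by have := hL j; have := mulr_ge0 (ltW k0) sd0; rewrite sdE => ? ?; apply/andP; split; lra.
Qed.

(** The past is at least as long as the epoch, so its averages are at least as accurate as those of
    [n] samples. *)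
Lemma usage_average (k : grid m rb bl T) j :
  `|usage rs as_ (price k) 0 s j / s%:R - phi (price k) j| <= cbeta R m * ab * rate n.
Proof.
have s0 : 0 < s%:R :> R by rewrite ltr0n; nat_lia.
have := gp_usage GP k (s := 0) (n := s) j; rewrite add0n => /(_ ltac:(nat_lia)) h.
have -> : usage rs as_ (price k) 0 s j / s%:R - phi (price k) j =
  (usage rs as_ (price k) 0 s j - s%:R * phi (price k) j) / s%:R by field; rewrite gt_eqF.
rewrite normrM normfV (gtr0_norm s0) ler_pdivrMr//; apply: (le_trans h).
rewrite sdevE; last by nat_lia.
rewrite -[leRHS]mulrA [rate n * _]mulrC; apply: ler_wpM2l.
  by rewrite mulr_ge0 ?ltW.
apply: ler_wpM2l => //.
by apply: rate_le => //; nat_lia.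
Qed.

Lemma supply_average j : `|supply bs 0 s j / s%:R - B j| <= cbeta R m * bb * rate n.
Proof.
have s0 : 0 < s%:R :> R by rewrite ltr0n; nat_lia.
have := gp_supply GP (s := 0) (n := s) j; rewrite add0n => /(_ ltac:(nat_lia)) h.
have -> : supply bs 0 s j / s%:R - B j =
  (supply bs 0 s j - s%:R * B j) / s%:R by field; rewrite gt_eqF.
rewrite normrM normfV (gtr0_norm s0) ler_pdivrMr//; apply: (le_trans h).
rewrite sdevE; last by nat_lia.
rewrite -[leRHS]mulrA [rate n * _]mulrC; apply: ler_wpM2l.
  by rewrite mulr_ge0 ?ltW.
apply: ler_wpM2l => //.
by apply: rate_le => //; nat_lia.
Qed.

(** The true dual solution for the mean replenishment minus the drift, rounded to the grid, passes
    the test. *)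
Lemma epoch_price_exists : exists k, price_ok ab bb mu rs as_ bs x s (k : grid m rb bl T).
Proof.
have T0 : 0 < T%:R :> R by rewrite ltr0n; nat_lia.
have [_ hdB _] := rate_small hn.
have [|q [[q0 qs] hq1 hq2]] := df_exist DF (g := fun j => g j).
  by move=> j; apply: le_lt_trans hdB; exact: drift_norm.
have qle j : q j <= rb / bl.
  by apply: le_trans qs; rewrite (bigD1 j)//= lerDl; apply: sumr_ge0.
(* Rounding down respects the bound on the sum of prices and never makes a zero price positive, so
   complementary slackness survives. *)
pose k : grid m rb bl T := [ffun j => inord (Num.truncn (q j * T%:R))].
have kE j : (k j : nat) = Num.truncn (q j * T%:R).
  by rewrite ffunE inordK// ltnS; apply: le_truncn; rewrite ler_pM2r.
have kq j : price k j <= q j < price k j + T%:R^-1.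
  have qT : 0 <= q j * T%:R by rewrite mulr_ge0// ltW.
  have := truncn_itv qT; rewrite -kE /price => /andP[h1 h2].
  rewrite ler_pdivrMr// h1 /= -(ltr_pM2r T0) mulrDl mulVf ?gt_eqF//.
  by rewrite mulfVK ?gt_eqF// -natr1 in h2 *.
have kp : in_Omega_p rb bl (price k).
  split=> [j|]; first by rewrite /price divr_ge0.
  by apply: le_trans qs; apply: ler_sum => j _; have /andP[] := kq j.
have hd : dist1 (price k) q <= m%:R * T%:R^-1.
  rewrite /dist1 mulr_natl -[X in _ *+ X]card_ord -sumr_const; apply: ler_sum => j _.
  by have := kq j => /andP[? ?]; rewrite ler_norml; lra.
have hphi j : `|phi (price k) j - phi q j| <= cgrid m ab mu * rate n.
  apply: le_trans (hq2 _ kp j) _.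
  apply: le_trans (_ : mu * ab ^+ 2 * (m%:R * T%:R^-1) <= _).
    by apply: ler_wpM2l => //; rewrite mulr_ge0 ?exprn_ge0 ?ltW.
  rewrite mulrA; apply: ler_wpM2l; first by apply: ltW; exact: g0.
  by apply: rate_geT => //; nat_lia.
exists k; apply/andP; split; first by have [] := kp.
apply/forallP => j; have [hq hq'] := hq1 j.
have := hphi j; have := usage_average k j; have := supply_average j.
rewrite !ler_norml => /andP[u1 u2] /andP[u3 u4] /andP[u5 u6].
have e : (cdev m ab bb + cgrid m ab mu) * rate n =
  cbeta R m * ab * rate n + cbeta R m * bb * rate n + cgrid m ab mu * rate n.
  by rewrite cdevE; ring.
rewrite e; apply/andP; split; first by lra.
apply/implyP => kj; have {}hq' : phi q j = B j - g j.
  by apply: hq'; apply: lt_le_trans kj _; have /andP[] := kq j.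
by lra.
Qed.

Variable k : grid m rb bl T.
Hypothesis hk : price_ok ab bb mu rs as_ bs x s k.
Local Notation p := (price k).

Lemma price_in_Omega_p : in_Omega_p rb bl p.
Proof.
by move: hk => /andP[h _]; split => // j; rewrite /price divr_ge0.
Qed.

(** Replacing the averages by means costs one more [cdev * rate n] on top of the tolerance. *)
Lemma price_kkt j :
  phi p j <= B j - g j + (2 * cdev m ab bb + cgrid m ab mu) * rate n /\
  (0 < p j -> B j - g j - (2 * cdev m ab bb + cgrid m ab mu) * rate n <= phi p j).
Proof.
move: hk => /andP[_ /forallP/(_ j)/andP[h1 /implyP h2]].
have := usage_average k j; have := supply_average j.
rewrite !ler_norml => /andP[u1 u2] /andP[u3 u4].
have e : (2 * cdev m ab bb + cgrid m ab mu) * rate n = cbeta R m * ab * rate n +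
  cbeta R m * bb * rate n + (cdev m ab bb + cgrid m ab mu) * rate n.
  have : cdev m ab bb * rate n = cbeta R m * ab * rate n + cbeta R m * bb * rate n.
    by rewrite cdevE mulrDl.
  by lra.
rewrite e; split=> [|/h2 {}h2]; lra.
Qed.

Lemma price_distance : dist1 p ps <= cdist m ab bb lmin lam mu * rate n.
Proof.
have e : cdist m ab bb lmin lam mu * rate n = m%:R * (6 * kap * rate n) / (lam * lmin).
  by rewrite cdistE; ring.
have h : (2 * cdev m ab bb + cgrid m ab mu) * rate n <= kap * rate n.
  by rewrite ckapE; apply: ler_wpM2r => //; have := c0; lra.
rewrite e; apply: kkt_distance.
- by rewrite !mulr_ge0// ltW.
- exact: price_in_Omega_p.
- by move=> j; have := drift_norm j; rewrite ler_norml => /andP[? ?]; have [? _] := price_kkt j; lra.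
- move=> j pj; have := drift_norm j; rewrite ler_norml => /andP[? ?].
  by have [_ /(_ pj) ?] := price_kkt j; lra.
Qed.

(** After the warm-up the price error is below [ceta]. *)
Lemma price_binding j : 0 < ps j -> 0 < p j.
Proof.
move=> pj; have [h _ _] := rate_small hn.
have := dist1_coord p ps j; have := price_distance; have := df_eta DF pj.
have := ler_norm (ps j - p j); rewrite distrC.
lra.
Qed.

(** The stock predicted by the optimality conditions is linear in [i], hence above the smaller of
    its end values. [kap * sdev n] collects the error of these conditions and the deviation over the
    first [i] periods. *)
Lemma inventory_lower i j : (i <= n)%N ->
  Num.min (L s j) (L s j + n%:R * g j) - kap * sdev n <=
  L s j + supply bs s i j - usage rs as_ p s i j.
Proof.
move=> ni.
have := gp_supply GP (s := s) (n := i) j (siT ni).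
have := gp_usage GP k (s := s) (n := i) j (siT ni).
rewrite !ler_norml => /andP[_ u1] /andP[u2 _].
have [u3 _] := price_kkt j.
have hsd : cdev m ab bb * sdev i <= cdev m ab bb * sdev n.
  by apply: ler_wpM2l; [exact: ltW|exact: sdev_le].
rewrite cdevE mulrDl in hsd.
have i0 : 0 <= i%:R :> R by [].
have iln : i%:R <= n%:R :> R by rewrite ler_nat.
have u4 : i%:R * phi p j <=
    i%:R * (B j - g j) + (2 * cdev m ab bb + cgrid m ab mu) * sdev n.
  apply: le_trans (ler_wpM2l i0 u3) _.
  rewrite mulrDr lerD2l sdE mulrCA; apply: ler_wpM2l; first by have := (c0, g0) => -[? ?]; lra.
  by apply: ler_wpM2r.
have u5 : Num.min (L s j) (L s j + n%:R * g j) <= L s j + i%:R * g j.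
  rewrite ge_min; case: (leP 0 (g j)) => gj; apply/orP; [left|right].
    by rewrite lerDl mulr_ge0.
  by rewrite lerD2l; nra.
have u6 : kap * sdev n = (2 * cdev m ab bb + cgrid m ab mu) * sdev n +
    (cbeta R m * ab * sdev n + cbeta R m * bb * sdev n).
  by rewrite -mulrDl -cdevE ckapE; ring.
rewrite u6; move: hsd u1 u2 u4 u5; rewrite mulrBr; lra.
Qed.

(** On a binding resource the chosen price is positive, so the lower optimality condition applies
    and usage keeps up with supply. *)
Lemma inventory_upper j : 0 < ps j ->
  L s j + supply bs s n j - usage rs as_ p s n j <= L s j + n%:R * g j + kap * sdev n.
Proof.
move=> /price_binding pj.
have := gp_supply GP (s := s) (n := n) j ltac:(nat_lia).
have := gp_usage GP k (s := s) (n := n) j ltac:(nat_lia).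
rewrite !ler_norml => /andP[u1 _] /andP[_ u2].
have [_ /(_ pj) u3] := price_kkt j.
have u4 : n%:R * (B j - g j) - (2 * cdev m ab bb + cgrid m ab mu) * sdev n
    <= n%:R * phi p j.
  apply: le_trans (ler_wpM2l (ltW n0') u3).
  by rewrite sdE; lra.
have u6 : kap * sdev n = (2 * cdev m ab bb + cgrid m ab mu) * sdev n +
    (cbeta R m * ab * sdev n + cbeta R m * bb * sdev n).
  by rewrite -mulrDl -cdevE ckapE; ring.
rewrite u6; move: u1 u2 u4; rewrite mulrBr; lra.
Qed.

Hypothesis hk' : epoch_price rb ab bb bl mu T rs as_ bs x s = Some k.

Lemma min_drift j : kap * sdev n <= Num.min (L s j) (L s j + n%:R * g j).
Proof.
rewrite le_min hL /=; have := drift_ge1 j; have := mulr_ge0 (ltW k0) sd0; lra.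
Qed.

(** The guard never acts: if the price rule was followed so far, accepting leaves the stock that
    [inventory_lower] describes at step [i + 1], which is nonnegative. *)
Lemma epoch_accept i : (i < n)%N -> x (s + i)%N = (dotp (as_ (s + i)%N) p < rs (s + i)%N).
Proof.
elim/ltn_ind: i => i ih ni.
have e : est (s + i) = s by exact: epoch_start_inside.
rewrite epoch_policyE /accept e hn leq_addr hk' /=.
case h : (dotp _ _ < _) => //=; apply/forallP => j.
have hi := @inventory_add p s i j (fun i' hi' => ih i' hi' (ltn_trans hi' ni)).
have := @inventory_lower i.+1 j ni; have := min_drift j.
rewrite /supply /usage addnS !big_nat_recr ?leq_addr//= -/(supply bs s i j).
rewrite -/(usage rs as_ p s i j) h mulr1 /=.
move: hi => /= ->; lra.
Qed.

(** The target is 3 and the error 1, in units of [kap * sdev n], whence 2 and 4. If the drift is at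
    its floor, it removes 5 minus the error 1. *)
Lemma epoch_inventory j : 2 * kap * sdev n <= L (s + n)%N j /\
  (0 < ps j -> L (s + n)%N j <= Num.max (4 * kap * sdev n) (L s j - 4 * kap * sdev n)).
Proof.
rewrite (@inventory_add p s n j) ; last exact: epoch_accept.
split=> [|pj].
  have := drift_ge1 j; have h := @inventory_lower n j (leqnn _).
  have := gp_supply GP (s := s) (n := n) j ltac:(nat_lia).
  have := gp_usage GP k (s := s) (n := n) j ltac:(nat_lia).
  rewrite !ler_norml => /andP[_ u1] /andP[u2 _] d1.
  have [u3 _] := price_kkt j.
  have u4 : n%:R * phi p j <= n%:R * (B j - g j) +
      (2 * cdev m ab bb + cgrid m ab mu) * sdev n.
    apply: le_trans (ler_wpM2l (ltW n0') u3) _.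
    by rewrite sdE; lra.
  have u6 : kap * sdev n = (2 * cdev m ab bb + cgrid m ab mu) * sdev n +
      (cbeta R m * ab * sdev n + cbeta R m * bb * sdev n).
    by rewrite -mulrDl -cdevE ckapE; ring.
  move: u1 u2 u4; rewrite mulrBr; lra.
have := inventory_upper pj; have := drift_le j.
rewrite le_max => h1 h2; rewrite le_max.
by case/orP: h1 => h1; apply/orP; [left|right]; lra.
Qed.

Definition cepoch : R := mu * ab ^+ 2 * cdist m ab bb lmin lam mu ^+ 2
  + cbeta R m * ab * (cdist m ab bb lmin lam mu + 1).

Lemma epoch_cost :
  \sum_(s <= t < s + n) (rs t - dotp (as_ t) ps) *
     ((dotp (as_ t) ps < rs t)%R%:R - (x t)%:R) <= cepoch * l.
Proof.
have -> : \sum_(s <= t < s + n) (rs t - dotp (as_ t) ps) *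
     ((dotp (as_ t) ps < rs t)%R%:R - (x t)%:R) =
   \sum_(s <= t < s + n) (rs t - dotp (as_ t) ps) *
     ((dotp (as_ t) ps < rs t)%R%:R - (dotp (as_ t) p < rs t)%R%:R).
  apply: eq_big_nat => t /andP[st tn].
  by rewrite -(subnKC st) epoch_accept// ltn_subLR.
apply: le_trans (gp_reward GP (s := s) (n := n) ltac:(nat_lia) price_in_Omega_p) _.
have hd := price_distance; have hT : T%:R^-1 <= rate n by apply: rate_geT => //; nat_lia.
have T0 : 0 <= T%:R^-1 :> R by rewrite invr_ge0.
have D0 : 0 <= dist1 p ps by apply: sumr_ge0.
have c3 : 0 < cdist m ab bb lmin lam mu := cdist_gt0.
have lE : sdev n * rate n = l by apply: sdev_rate => //; nat_lia.
have lE2 : n%:R * rate n ^+ 2 = l by rewrite -lE sdE; ring.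
rewrite /cepoch mulrDl; apply: lerD.
  have -> : mu * ab ^+ 2 * cdist m ab bb lmin lam mu ^+ 2 * l =
    n%:R * (mu * ab ^+ 2 * (cdist m ab bb lmin lam mu * rate n) ^+ 2).
    by rewrite -lE2; ring.
  apply: ler_wpM2l; first exact: ltW.
  apply: ler_wpM2l; first by rewrite mulr_ge0 ?exprn_ge0 ?ltW.
  by rewrite ler_pXn2r// nnegrE// mulr_ge0// ltW.
have -> : cbeta R m * ab * (cdist m ab bb lmin lam mu + 1) * l =
  cbeta R m * ab * (cdist m ab bb lmin lam mu * rate n + rate n) * sdev n.
  by rewrite -lE; ring.
apply: ler_wpM2r => //; apply: ler_wpM2l; first by rewrite mulr_ge0 ?ltW.
exact: lerD.
Qed.

End Epoch.

(** * Summing over epochs, with the warm-up and the final stretch *)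

Let k0 : 0 < kap. Proof. exact: ckap_gt0. Qed.

(** Bounds the net value r - <a, ps> of an order, as the components of [ps] sum to at most
    [rb / bl]. *)
Definition cvalue : R := rb + ab * (rb / bl).

Lemma cvalue_ge0 : 0 <= cvalue.
Proof.
rewrite /cvalue; apply: addr_ge0; first exact: ltW.
by apply: mulr_ge0; [exact: ltW|rewrite divr_ge0 ?ltW].
Qed.

Definition cost (s n : nat) : R := \sum_(s <= t < s + n)
  (rs t - dotp (as_ t) ps) * ((dotp (as_ t) ps < rs t)%R%:R - (x t)%:R).

Lemma reject_cost s n : (s + n <= T)%N ->
  (forall t, (s <= t < s + n)%N -> x t = false) -> cost s n <= cvalue * n%:R.
Proof.
move=> snT rej; have -> : cvalue * n%:R = \sum_(s <= t < s + n) cvalue.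
  by rewrite sumr_const_nat addKn mulr_natr.
apply: ler_sum_nat => t tn; have [st tsn] := andP tn.
rewrite (rej t tn) subr0.
have tT : (t < T)%N by exact: leq_trans tsn snT.
have [ps0 psS] := df_ps DF.
have P0 : 0 <= rb / bl by rewrite divr_ge0 ?ltW.
have := gp_r GP tT; rewrite ler_norml => /andP[_ r1].
have : - dotp (as_ t) ps <= ab * (rb / bl).
  apply: le_trans (_ : ab * \sum_(j < m) ps j <= _); last first.
    by apply: ler_wpM2l => //; exact: ltW.
  rewrite /dotp -sumrN mulr_sumr; apply: ler_sum => j _; rewrite -mulNr.
  apply: ler_wpM2r => //; have := gp_a GP j tT; rewrite ler_norml; lra.
rewrite /cvalue => h; have h' := mulr_ge0 (ltW ab0) P0.
by case: (_ < _); rewrite /= ?mulr1n ?mulr0n ?mulr1 ?mulr0; have := rb0; lra.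
Qed.

Lemma reject_inventory s n j : (s + n <= T)%N ->
  (forall t, (s <= t < s + n)%N -> x t = false) ->
  L (s + n)%N j = L s j + supply bs s n j.
Proof.
elim: n => [|n ih] snT rej; first by rewrite /supply addn0 big_geq// addr0.
rewrite addnS inventoryS /supply addnS big_nat_recr ?leq_addr//=.
rewrite rej; last by rewrite leq_addr addnS ltnS leqnn.
rewrite ih; [by rewrite mulr0 subr0 addrA| |].
  by apply: leq_trans snT; rewrite leq_add2l.
by move=> t /andP[st tn]; apply: rej; rewrite st addnS ltnS ltnW.
Qed.

Lemma supply_le s n j : (s + n <= T)%N -> supply bs s n j <= bb * n%:R.
Proof.
move=> snT; have -> : bb * n%:R = \sum_(s <= t < s + n) bb.
  by rewrite sumr_const_nat addKn mulr_natr.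
apply: ler_sum_nat => t /andP[st tn].
by have /andP[] := gp_b GP j (leq_trans tn snT).
Qed.

Lemma reject_warmup t : (t < n0)%N -> x t = false.
Proof.
move=> tn; rewrite [LHS]epoch_policyE /accept (epoch_start_warmup (ltnW tn)).
by rewrite [(_ <= t)%N]leqNgt tn andbF.
Qed.

Lemma reject_late s t : ((T - s)./2 < n0)%N -> (s <= est t)%N -> x t = false.
Proof.
move=> sn st; rewrite [LHS]epoch_policyE /accept leqNgt.
suff -> : (len (est t) < n0)%N by [].
by apply: leq_ltn_trans sn; rewrite /epoch_len geq_min half_leq ?orbT// leq_sub2l.
Qed.

Lemma l_le_warmup : l <= n0%:R.
Proof.
apply: le_trans warmup_ge; have := crho_ge1; have := logT_ge1 R T2.
set c := crho _ _ _ _ _ _ _ _ => l1 c1; have : 1 <= c ^+ 2 by rewrite expr_ge1 ?(le_trans ler01).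
by move=> c2; rewrite ler_peMl// (le_trans ler01).
Qed.

Lemma sdev_le_warmup n : (n <= n0)%N -> sdev n <= n0%:R.
Proof.
move=> nn; apply: le_trans (sdev_le R T2 nn) _.
rewrite -[leRHS]ger0_norm// -sqrtr_sqr; apply: ler_wsqrtr.
by rewrite expr2; apply: ler_wpM2l => //; exact: l_le_warmup.
Qed.

(** The lower bound is demanded only if another active epoch follows, the upper one only for binding
    resources. [bb * n0] accounts for the stock built up in the warm-up. *)
Definition epoch_inv (s : nat) : Prop :=
  [/\ est s = s, (n0 <= len s)%N -> forall j, kap * sdev (len s) <= L s j &
      forall j, 0 < ps j -> L s j <= 8 * kap * sdev (len s) + bb * n0%:R].

Lemma epoch_inv_next s : (n0 <= len s)%N -> epoch_inv s ->
  epoch_inv (s + len s)%N /\ cost s (len s) <= cepoch * l.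
Proof.
move=> hn [es /(_ hn) lo up].
have n1 : (1 < len s)%N by apply: leq_trans hn; rewrite /warmup.
have [k hk] := epoch_price_exists hn lo.
have [k' hk' eqk'] : exists2 k', price_ok ab bb mu rs as_ bs x s k' &
    epoch_price rb ab bb bl mu T rs as_ bs x s = Some k'.
  by rewrite /epoch_price; case: pickP => [k'|/(_ k)]; [exists k'|rewrite hk].
have [h2 h4] := epoch_len_next n1.
(* Since [sdev] changes by at most a factor 2, the stock 2 * kap * sdev is enough to enter the next
   epoch, and 4 * kap * sdev is at most 8 * kap * sdev measured with the next length. *)
have s2 : sdev (len (s + len s)) <= 2 * sdev (len s).
  rewrite -sdev_mulnat; apply: sdev_le => //; apply: (leq_trans h2).
  by rewrite leq_mul2r orbT.
have s4 : sdev (len s) <= 2 * sdev (len (s + len s)).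
  by rewrite -sdev_mulnat; apply: sdev_le.
have m2 := ler_wpM2l (ltW k0) s2; have m4 := ler_wpM2l (ltW k0) s4.
split; last exact: (epoch_cost es hn lo hk' eqk').
split; first by apply: epoch_start_next => //; exact: ltnW.
  move=> _ j; have [+ _] := epoch_inventory es hn lo hk' eqk' j; lra.
move=> j pj; have [_ /(_ pj)] := epoch_inventory es hn lo hk' eqk' j.
have := up j pj; have := mulr_ge0 (ltW bb0) (ler0n R n0).
by rewrite le_max => ? ? /orP[|]; lra.
Qed.

Lemma costD s n n' : cost s (n + n') = cost s n + cost (s + n)%N n'.
Proof. by rewrite /cost addnA (@big_cat_nat _ _ _ (s + n)%N) ?leq_addr. Qed.

(** Bounds the number of epochs still to come without indexing them. In an epoch either [ln s] grows
    by at least 1/2 or [ln (T - s)] falls by at least 1/4, hence the factor 4. At [s = T] the last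
    term is [ln 0 = 0]. *)
Definition potential (s : nat) : R := 4 * (ln T%:R - ln s%:R + ln (T - s)%:R).

Lemma potential_ge0 s : (0 < s <= T)%N -> 0 <= potential s.
Proof.
move=> /andP[s0 sT]; rewrite /potential mulr_ge0// addr_ge0//.
  by rewrite subr_ge0 ler_ln ?posrE ?ltr0n ?(leq_trans s0)// ler_nat.
by case: (T - s)%N => [|k]; [rewrite ln0|rewrite ln_ge0// ler1n].
Qed.

Lemma ln_nat_gap (c : R) (k k' : nat) : (0 < k)%N -> (0 < k')%N -> 0 < c ->
  k%:R <= c * k'%:R -> ln k%:R <= ln k'%:R + (c - 1) :> R.
Proof.
move=> k1 k1' cp h; have k2 : 0 < k'%:R :> R by rewrite ltr0n.
apply: le_trans (_ : ln (c * k'%:R) <= _).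
  by rewrite ler_ln ?posrE ?mulr_gt0// ltr0n.
rewrite lnM ?posrE// addrC lerD2l.
have {1}-> : c = 1 + (c - 1) by lra.
by apply: le_ln1Dx; lra.
Qed.

Lemma potential_next s : (1 < len s)%N -> potential (s + len s) + 1 <= potential s.
Proof.
have h1 := epoch_len_le T s; have h2 := epoch_len_bound T s => n1.
have h3 : (s + 2 * len s <= T)%N by clear -h1 h2 n1; lia.
have a1 : (0 < T - (s + len s))%N by clear -h3 n1; lia.
have a2 : (0 < T - s)%N by clear -h3 n1; lia.
have a3 : (T - (s + len s) <= T - s)%N by clear; lia.
have a4 : (0 < s)%N by clear -h1 n1; lia.
have b1 : ln (T - (s + len s))%:R <= ln (T - s)%:R :> R.
  by rewrite ler_ln ?posrE ?ltr0n// ler_nat.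
have b2 : ln s%:R <= ln (s + len s)%:R :> R.
  by rewrite ler_ln ?posrE ?ltr0n ?addn_gt0 ?a4// ler_nat leq_addr.
rewrite /potential; case: (leqP s ((T - s)./2)) => hs.
  have e : len s = s by rewrite /epoch_len; apply/minn_idPl.
  have : ln s%:R <= ln (s + len s)%:R + (2^-1 - 1) :> R.
    apply: ln_nat_gap => //; first by rewrite addn_gt0 a4.
    by rewrite e natrD; lra.
  by lra.
have e : len s = ((T - s)./2)%N by rewrite /epoch_len; apply/minn_idPr; exact: ltnW.
have : ln (T - (s + len s))%:R <= ln (T - s)%:R + (3 / 4 - 1) :> R.
  apply: ln_nat_gap => //.
  have : (4 * (T - (s + len s)) <= 3 * (T - s))%N by clear -e n1; lia.
  by rewrite -(ler_nat R) !natrM; lra.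
by lra.
Qed.

(** Cost of a final rejected stretch of at most [2 * n0] periods: lost net value, plus the dual
    value of the leftover stock, of which [2 * bb * n0] arrives within the stretch. *)
Definition cfinal : R := cvalue * 2 + (rb / bl) * (8 * kap + 3 * bb).

Lemma cepoch_ge0 : 0 <= cepoch.
Proof.
have c0 := cbeta_gt0; have d0 := cdist_gt0.
rewrite /cepoch; apply: addr_ge0; apply: mulr_ge0.
- by apply: mulr_ge0; rewrite ?exprn_ge0 ?ltW.
- exact: sqr_ge0.
- by apply: mulr_ge0; exact: ltW.
- by apply: addr_ge0 => //; exact: ltW.
Qed.

Lemma cost_to_go s : (n0 <= s <= T)%N -> epoch_inv s ->
  cost s (T - s) + \sum_(j < m) ps j * L T j <=
    cepoch * l * potential s + cfinal * n0%:R.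
Proof.
have [N] := ubnP (T - s); elim: N s => // N ih s hN /andP[ns sT] inv.
have l1 := logT_ge1 R T2; have cl0 : 0 <= cepoch * l.
  by rewrite mulr_ge0 ?cepoch_ge0// (le_trans ler01).
have s0 : (0 < s)%N by apply: leq_trans ns; rewrite /warmup.
have [hn|hn] := leqP n0 (len s).
  have n1 : (1 < len s)%N by apply: leq_trans hn; rewrite /warmup.
  have h1 := epoch_len_le T s; have h2 := epoch_len_bound T s.
  have h3 : (s + 2 * len s <= T)%N by clear -h1 h2 n1; lia.
  have [inv' hc] := epoch_inv_next hn inv.
  have e : (T - s = len s + (T - (s + len s)))%N by clear -h3; lia.
  rewrite e costD.
  have := ih (s + len s)%N ltac:(clear -hN n1 h3; lia) ltac:(clear -ns h3; lia) inv'.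
  have := ler_wpM2l cl0 (potential_next n1); rewrite mulrDr mulr1.
  by move: hc; lra.
have [es _ up] := inv.
(* As [n0 <= s], a length below [n0] can only be due to the remaining time: the horizon is near, and
   all further orders are rejected. *)
have hs2 : ((T - s)./2 < n0)%N by move: hn; rewrite /epoch_len; clear -ns; lia.
have rej t : (s <= t < s + (T - s))%N -> x t = false.
  move=> /andP[st _]; apply: (reject_late hs2).
  by rewrite -{1}es; exact: epoch_start_mono.
have sTT : (s + (T - s) <= T)%N by rewrite subnKC.
have hT : (T - s)%:R <= 2 * n0%:R :> R.
  by rewrite -natrM ler_nat; clear -hs2; lia.
have P0 : 0 <= rb / bl by rewrite divr_ge0 ?ltW.
have v0 := cvalue_ge0.
have hc := reject_cost sTT rej; have := ler_wpM2l v0 hT => hv.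
have [ps0 psS] := df_ps DF.
have n00 : 0 <= n0%:R :> R by [].
have hL : \sum_(j < m) ps j * L T j <= (rb / bl) * ((8 * kap + 3 * bb) * n0%:R).
  apply: le_trans (_ : \sum_(j < m) ps j * ((8 * kap + 3 * bb) * n0%:R) <= _).
    apply: ler_sum => j _; have := ps0 j; rewrite le_eqVlt => /predU1P[<-|pj].
      by rewrite !mul0r.
    apply: ler_wpM2l => //; have := reject_inventory j sTT rej; rewrite subnKC// => ->.
    have := supply_le j sTT; have := up j pj.
    have := ler_wpM2l (ltW k0) (sdev_le_warmup (ltnW hn)).
    have := ler_wpM2l (ltW bb0) hT; lra.
  rewrite -mulr_suml; apply: ler_wpM2r => //.
  by rewrite mulr_ge0// addr_ge0// mulr_ge0// ltW.
have := mulr_ge0 cl0 (potential_ge0 (s := s) ltac:(by rewrite s0)).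
by rewrite /cfinal; lra.
Qed.

Definition cregret : R :=
  8 * cepoch + (cvalue + cfinal) * (crho m ab bb bl lmin lam mu dB ^+ 2 + 2).

Lemma pathwise_regret :
  Rstar T rs as_ bs - \sum_(t < T) rs t * (x t)%:R <= cregret * l ^+ 2.
Proof.
have [ps0 psS] := df_ps DF.
apply: le_trans (regret_le_dual rs as_ x ps0 _) _.
  by move=> t j tT; have /andP[] := gp_b GP j tT.
have -> : \sum_(t < T) (rs t - dotp (as_ t) ps) *
   ((dotp (as_ t) ps < rs t)%R%:R - (x t)%:R) = cost 0 T.
  by rewrite /cost add0n big_mkord.
have l1 := logT_ge1 R T2; have l0 : 0 <= l := le_trans ler01 l1.
have P0 : 0 <= rb / bl by rewrite divr_ge0 ?ltW.
have v0 := cvalue_ge0.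
have ll : l <= l ^+ 2 by rewrite expr2 ler_peMl.
have nl : n0%:R <= (crho m ab bb bl lmin lam mu dB ^+ 2 + 2) * l ^+ 2.
  apply: le_trans warmup_le _; apply: ler_wpM2l => //.
  by rewrite addr_ge0 ?sqr_ge0.
have f0 : 0 <= cfinal.
  apply: addr_ge0; first exact: mulr_ge0.
  by apply: mulr_ge0 => //; apply: addr_ge0; apply: mulr_ge0 => //; exact: ltW.
have main : cost 0 T + \sum_(j < m) ps j * L T j <=
    8 * cepoch * l ^+ 2 + (cvalue + cfinal) * n0%:R.
  (* A horizon shorter than the warm-up is itself O(log T), so rejecting everything is
     affordable. *)
  have [nT|Tn] := leqP n0 T.
    have rej t : (0 <= t < 0 + n0)%N -> x t = false.
      by rewrite add0n => /= tn; exact: reject_warmup.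
    have inv : epoch_inv n0.
      split.
      - exact: epoch_start_warmup.
      (* The warm-up collects at least [n0 * bl] minus the deviation, and the summand of [crho] over
         [bl] makes this at least [kap * sdev n0]. *)
      - move=> hn j; have [_ _ h3] := rate_small (leqnn n0).
        have := @reject_inventory 0 n0 j nT rej; rewrite add0n => ->.
        have := gp_supply GP (s := 0) (n := n0) j nT; rewrite ler_norml => /andP[h4 _].
        have hsd := ler_wpM2l (ltW k0) (sdev_le R T2 (epoch_len_le T n0)).
        have nn0 : (0 < n0)%N by [].
        have nn : 0 <= n0%:R :> R by [].
        have h5 := ler_wpM2l nn h3; have h6 := ler_wpM2l nn (df_B DF j).
        have h7 : (cdev m ab bb + kap) * sdev n0 = n0%:R * ((cdev m ab bb + kap) * rate n0).
          by rewrite sdevE//; ring.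
        have h8 : cbeta R m * bb * sdev n0 <= cdev m ab bb * sdev n0.
          apply: ler_wpM2r; first exact: sdev_ge0.
          rewrite /cdev; apply: ler_wpM2l; [by rewrite ltW ?cbeta_gt0|by rewrite lerDr ltW].
        rewrite {1}/inventory big_ord0 add0r; lra.
      - move=> j _; have := @reject_inventory 0 n0 j nT rej; rewrite add0n => ->.
        rewrite /inventory big_ord0 add0r; have := supply_le (s := 0) j nT.
        by have := mulr_ge0 (ltW k0) (sdev_ge0 R T (len n0)); lra.
    have := cost_to_go (s := n0) ltac:(by rewrite leqnn) inv.
    have := @reject_cost 0 n0 nT rej.
    have := costD 0 n0 (T - n0); rewrite subnKC// add0n => ->.
    have hp : potential n0 <= 8 * l.
      have T0 : (0 < T)%N by exact: leq_trans T2.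
      have a1 : 0 <= ln n0%:R :> R by rewrite ln_ge0// ler1n.
      have a2 : ln (T - n0)%:R <= ln T%:R :> R.
        have := leq_subr n0 T; case: (T - n0)%N => [_|q qT]; last by rewrite ler_ln ?posrE ?ltr0n// ler_nat.
        by rewrite ln0// ln_ge0// ler1n.
      by rewrite /potential /logT; lra.
    have cl0 : 0 <= cepoch * l by rewrite mulr_ge0 ?cepoch_ge0.
    have := ler_wpM2l cl0 hp; rewrite expr2; lra.
  have rej t : (0 <= t < 0 + T)%N -> x t = false.
    by rewrite add0n => /= tT; apply: reject_warmup; exact: ltn_trans Tn.
  have hc := @reject_cost 0 T (leqnn _) rej.
  have TT : T%:R <= n0%:R :> R by rewrite ler_nat ltnW.
  have n00 : 0 <= n0%:R :> R by [].
  have : \sum_(j < m) ps j * L T j <= (rb / bl) * (bb * n0%:R).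
    apply: le_trans (_ : \sum_(j < m) ps j * (bb * n0%:R) <= _).
      apply: ler_sum => j _; apply: ler_wpM2l => //.
      have := @reject_inventory 0 T j (leqnn _) rej; rewrite add0n => ->.
      rewrite {1}/inventory big_ord0 add0r; apply: le_trans (supply_le (s := 0) j (leqnn _)) _.
      by apply: ler_wpM2l => //; exact: ltW.
    by rewrite -mulr_suml; apply: ler_wpM2r => //; rewrite mulr_ge0// ltW.
  have := ler_wpM2l v0 TT; have := mulr_ge0 cepoch_ge0 (sqr_ge0 l).
  have q1 := mulr_ge0 (mulr_ge0 P0 (ltW k0)) n00.
  have q2 := mulr_ge0 (mulr_ge0 P0 (ltW bb0)) n00.
  have q3 := mulr_ge0 v0 n00.
  by rewrite /cfinal; lra.
apply: le_trans main _; have := ler_wpM2l (addr_ge0 v0 f0) nl.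
by rewrite /cregret; lra.
Qed.

End Fixed.
End Pathwise.

(** * Integration against a sub-sigma-algebra *)

Section SubSigmaAlgebra.
Context (R : realType) (d : measure_display) (Omega : measurableType d).
Variables (P : probability Omega R) (C : set (set Omega)).
Hypothesis Cmeas : C `<=` measurable.
Local Notation T' := (g_sigma_algebraType C).
Local Open Scope ereal_scope.

Lemma sub_sigma_measurable (S : set Omega) : <<s C >> S -> measurable S.
Proof.
apply: smallest_sub => //; split=> //.
- by move=> A mA; apply: measurableD.
- by move=> F mF; apply: bigcupT_measurable.
Qed.

Lemma sub_sigma_measurable_fun d' (Y : measurableType d') (f : T' -> Y) :
  measurable_fun [set: T'] f -> measurable_fun [set: Omega] (f : Omega -> Y).
Proof.
move=> mf _ B mB; rewrite setTI; apply: sub_sigma_measurable.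
by have := mf measurableT B mB; rewrite setTI.
Qed.

Import HBNNSimple.

Let simple_weighted (w : Omega -> R) (h : {nnsfun T' >-> R}) :
  measurable_fun [set: Omega] w -> (forall x, 0 <= w x)%R ->
  \int[P]_x (h x * w x)%:E =
  \sum_(y \in range h) y%:E * \int[P]_(x in h @^-1` [set y]) (w x)%:E.
Proof.
move=> mw w0.
have mh r : measurable (h @^-1` [set r] : set Omega).
  by apply: sub_sigma_measurable; exact: (measurable_funPTI h).
transitivity (\int[P]_x (\sum_(y \in range h)
    (y * \1_(h @^-1` [set y]) x)%:E * (w x)%:E)).
  apply: eq_integral => x _.
  under eq_fsbigr do rewrite -EFinM.
  rewrite fsumEFin// (fimfunE h x); congr (_%:E).
  by rewrite [in RHS]fsbig_finite// [in LHS]fsbig_finite//= mulr_suml.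
rewrite ge0_integral_fsum//; last 2 first.
- move=> y; apply: emeasurable_funM; apply/measurable_EFinP => //.
  by apply: measurable_funM => //; exact: measurable_indic.
- move=> y x _; rewrite mule_ge0 ?lee_fin//.
  exact: nnfun_muleindic_ge0.
apply: eq_fsbigr => r; rewrite inE => -[t _ <-].
have r0 : (0 <= h t)%R by [].
under eq_integral do rewrite EFinM -muleA.
rewrite ge0_integralZl//; last 2 first.
- apply: emeasurable_funM; apply/measurable_EFinP => //.
- by move=> x _; rewrite mule_ge0 ?lee_fin.
congr (_ * _); rewrite [RHS]integral_mkcond; apply: eq_integral => x _.
by rewrite muleC epatch_indic.
Qed.

Let approx_weighted (w : Omega -> R) (f : T' -> \bar R)
    (mf : measurable_fun [set: T'] f) (f0 : forall x, 0 <= f x) :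
  measurable_fun [set: Omega] w -> (forall x, 0 <= w x)%R ->
  \int[P]_x (f x * (w x)%:E) =
  limn (fun n => \int[P]_x (nnsfun_approx measurableT mf n x * w x)%:E).
Proof.
move=> mw w0; set h := nnsfun_approx measurableT mf.
have fg x : f x * (w x)%:E = lim ((h n x * w x)%:E @[n --> \oo]).
  apply/esym/cvg_lim => //; under eq_fun do rewrite EFinM.
  by apply: cvgeZr => //; exact: cvg_nnsfun_approx.
under eq_integral do rewrite fg.
apply: monotone_convergence => //.
- move=> n; apply/measurable_EFinP; apply: measurable_funM => //.
  by apply: sub_sigma_measurable_fun; exact: measurable_funPT.
- by move=> n x _; rewrite lee_fin mulr_ge0.
- move=> x _ a b ab; rewrite lee_fin ler_wpM2r//.
  by have /lefP := nd_nnsfun_approx measurableT mf ab; apply.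
Qed.

(** Equality on sets extends to simple functions and, by monotone convergence, to nonnegative
    functions measurable for the small sigma-algebra. It serves both to pull known factors out of
    conditional probabilities and to factor means of independent variables. *)
Lemma eq_weighted_integral (w1 w2 : Omega -> R) (f : T' -> \bar R) :
  measurable_fun [set: Omega] w1 -> measurable_fun [set: Omega] w2 ->
  (forall x, 0 <= w1 x)%R -> (forall x, 0 <= w2 x)%R ->
  (forall S, <<s C >> S -> \int[P]_(x in S) (w1 x)%:E = \int[P]_(x in S) (w2 x)%:E) ->
  measurable_fun [set: T'] f -> (forall x, 0 <= f x) ->
  \int[P]_x (f x * (w1 x)%:E) = \int[P]_x (f x * (w2 x)%:E).
Proof.
move=> mw1 mw2 w10 w20 w12 mf f0.
rewrite !(approx_weighted mf f0)//; congr (limn _); apply/funext => n.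
rewrite !simple_weighted//; apply: eq_fsbigr => r _; congr (_ * _).
by apply: w12; exact: (measurable_funPTI (nnsfun_approx measurableT mf n)).
Qed.

(** Radon-Nikodym for the restriction of [P] to [A], both measures being moved to the small
    sigma-algebra by pushforward along the identity. *)
Lemma conditional_probability_exists (A : set Omega) : measurable A ->
  exists D : T' -> R, [/\ measurable_fun [set: T'] D, forall x, (0 <= D x)%R &
    forall S, <<s C >> S -> \int[P]_(x in S) (D x)%:E = P (A `&` S)].
Proof.
move=> mA.
have mid : measurable_fun [set: Omega] (id : Omega -> T').
  by move=> _ B mB; rewrite setTI preimage_id; exact: sub_sigma_measurable.
pose i : {mfun Omega >-> T'} := HB.pack (id : Omega -> T') (isMeasurableFun.Build _ _ _ _ _ mid).
pose mu : probability T' R := distribution P i.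
pose nu0 : {measure set T' -> \bar R} := pushforward (mrestr P mA) i.
pose nu1 : {measure set T' -> \bar R} := nu0 mid.
have nu1E S : nu1 S = P (S `&` A) by [].
have nufin : fin_num_fun nu1.
  move=> S mS; rewrite nu1E; apply: fin_num_measure; apply: measurableI => //.
  exact: sub_sigma_measurable.
pose nu : {finite_measure set T' -> \bar R} :=
  HB.pack (nu1 : set T' -> \bar R) nu1 (Measure_isFinite.Build _ _ _ nu1 nufin).
have nuE S : nu S = P (S `&` A) by [].
have numu : nu `<< mu.
  apply/null_content_dominatesP => S mS muS0; rewrite nuE; apply/eqP.
  rewrite eq_le measure_ge0 andbT; rewrite -muS0.
  apply: le_measure; rewrite ?inE; last exact: subIsetl.
    by apply: measurableI => //; exact: sub_sigma_measurable.
  exact: sub_sigma_measurable.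
have [f [f0 ffin fint fE]] := @radon_nikodym_sigma_finite _ _ _ mu nu numu.
have mf : measurable_fun [set: T'] f := measurable_int _ fint.
exists (fine \o f); split.
- by apply: measurableT_comp.
- by move=> x; apply: fine_ge0.
- move=> S mS; rewrite setIC -nuE fE// ge0_integral_pushforward//.
    by apply: eq_integral => x _; rewrite /= fineK.
  exact: measurable_funTS.
Qed.

End SubSigmaAlgebra.

(** * Real-valued means of almost surely bounded variables *)

Section Mean.
Context (R : realType) (d : measure_display) (Omega : measurableType d).
Variable P : probability Omega R.
Implicit Types X Y : Omega -> R.

Definition mean X : R := fine 'E_P[X].

(** Unlike integrability, almost sure boundedness is stable under products, so this one side
    condition serves all rules for [mean]. *)
Definition bdd X : Prop :=
  measurable_fun setT X /\ exists M : R, {ae P, forall w, `|X w| <= M}.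

Lemma expectationE X : ('E_P[X] = \int[P]_w (X w)%:E)%E.
Proof. by rewrite unlock. Qed.

Lemma bdd_integrable X : bdd X -> P.-integrable setT (EFin \o X).
Proof.
move=> [mX [M hM]]; apply/integrableP; split; first exact/measurable_EFinP.
apply: (@le_lt_trans _ _ (\int[P]_w (`|M|%:E))%E).
  apply: ae_ge0_le_integral => //.
  - by apply: measurableT_comp => //; exact/measurable_EFinP.
  - case: hM => N [mN PN sN]; exists N; split => // w /= h.
    apply: sN => /= hw; apply: h => _; rewrite lee_fin.
    exact: le_trans hw (ler_norm _).
by rewrite integral_cst//= probability_setT mule1 ltry.
Qed.

Lemma meanE X : bdd X -> (mean X)%:E = (\int[P]_w (X w)%:E)%E.
Proof.
move=> bX; rewrite /mean expectationE fineK//.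
by apply: integrable_fin_num => //; exact: bdd_integrable.
Qed.

Lemma bddP X M : measurable_fun setT X -> {ae P, forall w, `|X w| <= M} -> bdd X.
Proof. by move=> mX h; split => //; exists M. Qed.

Lemma bdd_cst c : bdd (cst c).
Proof. by split => //; exists `|c|; exact: aeW. Qed.

Lemma bddD X Y : bdd X -> bdd Y -> bdd (fun w => X w + Y w).
Proof.
move=> [mX [M hM]] [mY [N hN]]; split; first exact: measurable_funD.
exists (M + N); apply: filterS2 hM hN => w h1 h2.
by apply: le_trans (ler_normD _ _) _; exact: lerD.
Qed.

Lemma bddM X Y : bdd X -> bdd Y -> bdd (fun w => X w * Y w).
Proof.
move=> [mX [M hM]] [mY [N hN]]; split; first exact: measurable_funM.
exists (M * N); apply: filterS2 hM hN => w h1 h2.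
by rewrite normrM; apply: ler_pM.
Qed.

Lemma bddZ c X : bdd X -> bdd (fun w => c * X w).
Proof. by move=> h; apply: bddM => //; exact: bdd_cst. Qed.

Lemma bddN X : bdd X -> bdd (fun w => - X w).
Proof.
move=> [mX [M hM]]; split; first exact: measurableT_comp.
by exists M; apply: filterS hM => w; rewrite normrN.
Qed.

Lemma bddB X Y : bdd X -> bdd Y -> bdd (fun w => X w - Y w).
Proof. by move=> h1 h2; apply: bddD => //; exact: bddN. Qed.

Lemma bdd_norm X : bdd X -> bdd (fun w => `|X w|).
Proof.
move=> [mX [M hM]]; split; first exact: measurableT_comp.
by exists M; apply: filterS hM => w; rewrite normr_id.
Qed.

Lemma bdd_sum (I : Type) (s : seq I) (F : I -> Omega -> R) :
  (forall i, bdd (F i)) -> bdd (fun w => \sum_(i <- s) F i w).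
Proof.
move=> hF; elim: s => [|i s ih].
  by under eq_fun do rewrite big_nil; exact: bdd_cst.
by under eq_fun do rewrite big_cons; exact: bddD.
Qed.

Lemma bdd_prod (I : Type) (s : seq I) (F : I -> Omega -> R) :
  (forall i, bdd (F i)) -> bdd (fun w => \prod_(i <- s) F i w).
Proof.
move=> hF; elim: s => [|i s ih].
  by under eq_fun do rewrite big_nil; exact: bdd_cst.
by under eq_fun do rewrite big_cons; exact: bddM.
Qed.

Lemma bdd_max X Y : bdd X -> bdd Y -> bdd (fun w => Num.max (X w) (Y w)).
Proof.
move=> [mX [M hM]] [mY [N hN]]; split; first exact: measurable_maxr.
exists (Num.max M N); apply: filterS2 hM hN => w h1 h2.
by rewrite le_max; case: (leP (X w) (Y w)) => _; rewrite ?h1 ?h2 ?orbT.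
Qed.

Lemma measurable_bool_natr (A : Omega -> bool) :
  measurable [set w | A w] -> measurable_fun setT (fun w => (A w)%:R : R).
Proof.
move=> mA; rewrite (_ : (fun w => _) = \1_[set w | A w]); first exact: measurable_indic.
by apply/funext => w; rewrite indicE /= mem_setE.
Qed.

Lemma bdd_bool (A : Omega -> bool) :
  measurable [set w | A w] -> bdd (fun w => (A w)%:R).
Proof.
move=> mA; split; first exact: measurable_bool_natr.
by exists 1; apply: aeW => w; case: (A w); rewrite ?normr1 ?normr0.
Qed.

Lemma meanD X Y : bdd X -> bdd Y -> mean (fun w => X w + Y w) = mean X + mean Y.
Proof.
move=> bX bY; apply: EFin_inj; rewrite EFinD !meanE//; last exact: bddD.
under eq_integral do rewrite EFinD.
by rewrite integralD//; exact: bdd_integrable.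
Qed.

Lemma mean_cst c : mean (cst c) = c.
Proof. by rewrite /mean expectation_cst. Qed.

Lemma meanZ c X : bdd X -> mean (fun w => c * X w) = c * mean X.
Proof.
move=> bX; apply: EFin_inj; rewrite EFinM !meanE//; last exact: bddZ.
under eq_integral do rewrite EFinM.
by rewrite integralZl//; exact: bdd_integrable.
Qed.

Lemma meanN X : bdd X -> mean (fun w => - X w) = - mean X.
Proof.
move=> bX; rewrite -mulN1r -meanZ//; congr (mean _).
by apply/funext => w; rewrite mulN1r.
Qed.

Lemma meanB X Y : bdd X -> bdd Y -> mean (fun w => X w - Y w) = mean X - mean Y.
Proof. by move=> bX bY; rewrite meanD// ?meanN//; exact: bddN. Qed.

Lemma mean_sum (I : Type) (s : seq I) (F : I -> Omega -> R) :
  (forall i, bdd (F i)) ->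
  mean (fun w => \sum_(i <- s) F i w) = \sum_(i <- s) mean (F i).
Proof.
move=> hF; elim: s => [|i s ih].
  by under eq_fun do rewrite big_nil; rewrite big_nil mean_cst.
under eq_fun do rewrite big_cons; rewrite big_cons meanD// ?ih//.
exact: bdd_sum.
Qed.

Lemma mean_ae_le X Y : bdd X -> bdd Y -> {ae P, forall w, X w <= Y w} ->
  mean X <= mean Y.
Proof.
move=> bX bY [N [mN PN sN]]; rewrite -lee_fin !meanE//.
have iX := bdd_integrable bX; have iY := bdd_integrable bY.
rewrite (negligible_integral mN measurableT iX PN).
rewrite (negligible_integral mN measurableT iY PN).
apply: le_integral; rewrite ?setTD; first exact: measurableC.
- by apply: (integrableS measurableT) => //; exact: measurableC.
- by apply: (integrableS measurableT) => //; exact: measurableC.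
- move=> w; rewrite inE => /= wN; rewrite lee_fin.
  by apply: contrapT => h; apply: wN; exact: sN.
Qed.

Lemma mean_le X Y : bdd X -> bdd Y -> (forall w, X w <= Y w) -> mean X <= mean Y.
Proof. by move=> bX bY h; apply: mean_ae_le => //; exact: aeW. Qed.

Lemma mean_ge0 X : bdd X -> (forall w, 0 <= X w) -> 0 <= mean X.
Proof.
move=> bX h; rewrite -(mean_cst 0); apply: mean_le => //; exact: bdd_cst.
Qed.

Lemma mean_norm X : bdd X -> `|mean X| <= mean (fun w => `|X w|).
Proof.
move=> bX; have bn := bdd_norm bX; rewrite ler_norml -meanN//; apply/andP; split.
  by apply: mean_le => //; [exact: bddN|move=> w; rewrite lerNl -normrN ler_norm].
by apply: mean_le => // w; exact: ler_norm.
Qed.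

Lemma mean_ae_le_cst X c : bdd X -> {ae P, forall w, X w <= c} -> mean X <= c.
Proof.
by move=> bX h; rewrite -[leRHS]mean_cst; apply: mean_ae_le => //; exact: bdd_cst.
Qed.

End Mean.

Lemma measurable_ltr_set (R : realType) (d : measure_display) (T : measurableType d)
    (f g : T -> R) :
  measurable_fun setT f -> measurable_fun setT g -> measurable [set w | f w < g w].
Proof.
move=> mf mg; have := measurable_fun_ltr mf mg.
by move=> /(_ measurableT [set true] I); rewrite setTI.
Qed.

(** * From conditional acceptance probabilities to integral inequalities *)

Section ConditionalWin.
Context (R : realType) (d : measure_display) (Omega : measurableType d).
Variables (P : probability Omega R) (m : nat).
Variables (r : Omega -> R) (a : 'I_m -> Omega -> R).
Hypotheses (mr : measurable_fun setT r) (ma : forall j, measurable_fun setT (a j)).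

Definition win (p : 'I_m -> R) (w : Omega) : bool := dotp (fun j => a j w) p < r w.

Lemma measurable_dotp d' (T : measurableType d') (f : 'I_m -> T -> R) (p : 'I_m -> R) :
  (forall j, measurable_fun setT (f j)) ->
  measurable_fun setT (fun w => dotp (fun j => f j w) p).
Proof. by move=> mf; apply: measurable_sum => j; exact: measurable_funM. Qed.

Lemma measurable_win p : measurable [set w | win p w].
Proof.
exact: measurable_ltr_set (measurable_dotp p ma) mr.
Qed.

Let C : set (set Omega) := [set A | exists X B,
  [set X | exists j, X = a j] X /\ measurable B /\ A = X @^-1` B].
Local Notation T' := (g_sigma_algebraType C).

Let Cmeas : C `<=` measurable.
Proof.
by move=> A [X [B [[j ->] [mB ->]]]]; rewrite -[X in measurable X]setTI; exact: ma.
Qed.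

Let ma' j : measurable_fun [set: T'] (a j : T' -> R).
Proof.
move=> _ B mB; rewrite setTI; apply: sub_gen_smallest.
by exists (a j), B; split => //; exists j.
Qed.

Variables (p ps : 'I_m -> R) (lam mu : R).
Let h (w : Omega) : R := dotp (fun j => a j w) p - dotp (fun j => a j w) ps.
Let sym (w : Omega) : bool := win p w (+) win ps w.

Hypothesis lam0 : 0 <= lam.
Hypothesis mu0 : 0 <= mu.
Hypothesis regular : forall Y' Ys : Omega -> R,
  cond_prob_version P (sigma_of [set X | exists j, X = a j]) [set w | win p w] Y' ->
  cond_prob_version P (sigma_of [set X | exists j, X = a j]) [set w | win ps w] Ys ->
  {ae P, forall w,
     lam * `|dotp (fun j => a j w) p - dotp (fun j => a j w) ps| <= `|Y' w - Ys w| /\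
     `|Y' w - Ys w| <= mu * `|dotp (fun j => a j w) p - dotp (fun j => a j w) ps| }.

Let mh' : measurable_fun [set: T'] (h : T' -> R).
Proof. by apply: measurable_funB; exact: measurable_dotp. Qed.

Let mh : measurable_fun [set: Omega] h.
Proof. by apply: measurable_funB; exact: measurable_dotp. Qed.

Lemma measurable_sym : measurable [set w | sym w].
Proof.
rewrite (_ : [set w | sym w] = ([set w | win p w] `\` [set w | win ps w]) `|`
   ([set w | win ps w] `\` [set w | win p w])).
  by apply: measurableU; apply: measurableD; exact: measurable_win.
apply/seteqP; split => w; rewrite /sym /=.
  by case: (win p w); case: (win ps w) => //= _; [left|right].
by case=> -[]; case: (win p w); case: (win ps w).
Qed.

Let mpos : measurable ([set w | 0 < h w] : set T').
Proof.
exact: measurable_ltr_set (measurable_cst (0 : R)) mh'.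
Qed.

Let mneg : measurable ([set w | h w < 0] : set T').
Proof.
exact: measurable_ltr_set mh' (measurable_cst (0 : R)).
Qed.

Let sub S : <<s C >> S -> measurable S. Proof. exact: sub_sigma_measurable. Qed.

Let win_pos w : 0 < h w -> win p w -> win ps w.
Proof. by rewrite /h /win; lra. Qed.
Let win_neg w : h w < 0 -> win ps w -> win p w.
Proof. by rewrite /h /win; lra. Qed.
Let sym_h w : sym w -> h w != 0.
Proof.
by rewrite /sym /win; apply: contraTneq => /subr0_eq ->; rewrite addbb.
Qed.

(** Given [a], the events [win p] and [win ps] are nested, in a direction set by the sign of [h], so
    the conditional probability of [sym] is the absolute difference of theirs. As [regular] accepts
    arbitrary versions, the version for [win p] is built from those for [win ps] and [sym], which
    makes the identity hold at every point with [h != 0]. *)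
Lemma win_versions : exists D : T' -> R,
  [/\ measurable_fun [set: T'] D, forall w, 0 <= D w,
      forall S, <<s C >> S -> (\int[P]_(x in S) (D x)%:E)%E = P ([set w | sym w] `&` S) &
      {ae P, forall w, lam * `|h w| <= D w * (h w != 0)%:R /\
                       D w * (h w != 0)%:R <= mu * `|h w| }].
Proof.
have [Ys [mYs Ys0 YsE]] := conditional_probability_exists P Cmeas (measurable_win ps).
have [D [mD D0 DE]] := conditional_probability_exists P Cmeas measurable_sym.
exists D; split => //.
pose gp (w : T') : R := (0 < h w)%R%:R; pose gn (w : T') : R := (h w < 0)%R%:R.
have mgp : measurable_fun [set: T'] gp by exact: measurable_bool_natr.
have mgn : measurable_fun [set: T'] gn by exact: measurable_bool_natr.
(* For [h > 0] the event [win p] lies inside [win ps], hence the minus sign. *)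
pose Y' (w : T') : R := Ys w - D w * gp w + D w * gn w.
have mY' : measurable_fun [set: T'] Y'.
  by apply: measurable_funD; [apply: measurable_funB => //|]; exact: measurable_funM.
have fm := sub_sigma_measurable_fun Cmeas.
have hD S : <<s C >> S -> P.-integrable S (fun w => (D w)%:E).
  move=> mS; apply/integrableP; split.
    by apply/measurable_EFinP; apply: measurable_funTS; exact: fm.
  under eq_integral do rewrite gee0_abs ?lee_fin//.
  rewrite DE//; apply: le_lt_trans (probability_le1 P _) (ltry _).
  by apply: measurableI; [exact: measurable_sym|exact: sub].
have hYs S : <<s C >> S -> P.-integrable S (fun w => (Ys w)%:E).
  move=> mS; apply/integrableP; split.
    by apply/measurable_EFinP; apply: measurable_funTS; exact: fm.
  under eq_integral do rewrite gee0_abs ?lee_fin//.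
  rewrite YsE//; apply: le_lt_trans (probability_le1 P _) (ltry _).
  by apply: measurableI; [exact: measurable_win|exact: sub].
have Dg (S G : set Omega) (g : Omega -> R) : <<s C >> S -> <<s C >> (S `&` G) ->
    measurable G -> (forall w, g w = (w \in G)%:R) ->
    P.-integrable S (fun w => (D w * g w)%:E) /\
    (\int[P]_(x in S) (D x * g x)%:E)%E = P ([set w | sym w] `&` (S `&` G)).
  move=> mS mSG mG gE.
  have mg : measurable_fun setT g.
    rewrite (_ : g = \1_G); first exact: measurable_indic.
    by apply/funext => w; rewrite indicE gE.
  split.
    apply: (le_integrable (sub mS) _ _ (hD S mS)).
      apply/measurable_EFinP/measurable_funTS; apply: measurable_funM => //; exact: fm.
    move=> w _ /=; rewrite lee_fin !ger0_norm// ?mulr_ge0// ?gE ?ler0n//.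
    by apply: ler_piMr => //; case: (_ \in _).
  rewrite -DE// integral_mkcondr; apply: eq_integral => w _.
  by rewrite /patch gE; case: (_ \in _); rewrite ?mulr1 ?mulr0.
have := regular (Y' := Y') (Ys := Ys).
have -> : cond_prob_version P (sigma_of [set X | exists j, X = a j]) [set w | win p w] Y'
    <-> True.
  split=> // _; split=> [B mB|S mS].
    by have := mY' measurableT B mB; rewrite setTI.
  have mSp : <<s C >> (S `&` [set w | 0 < h w]).
    exact: (@measurableI _ T' _ _ mS mpos).
  have mSn : <<s C >> (S `&` [set w | h w < 0]).
    exact: (@measurableI _ T' _ _ mS mneg).
  have [|ip ep] := Dg S [set w | 0 < h w] gp mS mSp (sub mpos).
    by move=> w; rewrite mem_setE.
  have [|iN eN] := Dg S [set w | h w < 0] gn mS mSn (sub mneg).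
    by move=> w; rewrite mem_setE.
  under eq_integral do rewrite EFinD EFinB.
  have mS0 := sub mS.
  have iB : P.-integrable S (fun w => (Ys w)%:E - (D w * gp w)%:E)%E.
    by apply: integrableB => //; exact: hYs.
  rewrite (integralD mS0 iB iN) (integralB mS0 (hYs _ mS) ip).
  rewrite ep eN YsE//.
  have mS' := sub mS; have mSp' := sub mSp; have mSn' := sub mSn.
  have mw1 := measurable_win p; have mw2 := measurable_win ps; have msym := measurable_sym.
  (* Both sides are the probability of the union of the two events within [S]; the additive form
     avoids subtracting extended reals. *)
  have e : (P ([set w | win p w] `&` S) + P ([set w | sym w] `&` (S `&` [set w | (0 < h w)%R])) =
     P ([set w | win ps w] `&` S) + P ([set w | sym w] `&` (S `&` [set w | (h w < 0)%R])))%E.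
    rewrite -!measureU//; try (by apply: measurableI); last 2 first.
    - apply/seteqP; split => w //= -[[w2 _]] [sy [_ hn]]; exfalso.
      by have := win_neg hn w2; move: sy; rewrite /sym w2 => + wp; rewrite wp.
    - apply/seteqP; split => w //= -[[w2 _]] [sy [_ hn]]; exfalso.
      by have := win_pos hn w2; move: sy; rewrite /sym w2 => + wp; rewrite wp.
    congr (P _); apply/seteqP; split=> w /=; rewrite /sym.
      case=> [[w1 Sw]|[+ [Sw hw]]].
        case w2 : (win ps w); first by left.
        right; rewrite w1; split => //; split => //.
        have := @sym_h w; rewrite /sym w1 w2 => /(_ isT).
        by rewrite neq_lt => /orP[//|hp]; move: (win_pos hp w1); rewrite w2.
      case w2 : (win ps w); first by left.
      by rewrite addbF => /(win_pos hw); rewrite w2.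
    case=> [[w1 Sw]|[+ [Sw hw]]].
      case w2 : (win p w); first by left.
      right; rewrite w1; split => //; split => //.
      have := @sym_h w; rewrite /sym w1 w2 => /(_ isT).
      by rewrite neq_lt => /orP[hp|//]; move: (win_neg hp w1); rewrite w2.
    case w2 : (win p w); first by left.
    by rewrite addFb => /(win_neg hw); rewrite w2.
  move: e.
  set x1 := P _; set x2 := P _; set x3 := P _; set x4 := P _.
  have f1 : x1 \is a fin_num by apply: fin_num_measure; exact: measurableI.
  have f2 : x2 \is a fin_num by apply: fin_num_measure; exact: measurableI.
  have f3 : x3 \is a fin_num by apply: fin_num_measure; exact: measurableI.
  have f4 : x4 \is a fin_num by apply: fin_num_measure; exact: measurableI.
  rewrite -(fineK f1) -(fineK f2) -(fineK f3) -(fineK f4).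
  by rewrite -EFinB -!EFinD => -[e]; congr (_%:E); lra.
move=> /(_ I); case.
  split=> [B mB|S mS]; last exact: YsE.
  by have := mYs measurableT B mB; rewrite setTI.
move=> N [mN PN sN]; exists N; split => // w /= hw; apply: sN => /= hw'; apply: hw.
move: hw'; have -> : `|Y' w - Ys w| = D w * (h w != 0)%:R; last by [].
rewrite /Y' /gp /gn -/(h w); case: (ltgtP (h w) 0) => hw /=.
- by rewrite mulr0 subr0 mulr1 addrAC subrr add0r ger0_norm.
- by rewrite mulr0 addr0 mulr1 addrAC subrr add0r normrN ger0_norm.
- by rewrite !mulr0 subr0 addr0 subrr normr0.
Qed.

(** The factor [|h|] depends on [a] only, so the indicator of [sym] may be replaced by [D], which
    dominates [lam * |h|]. *)
Lemma win_strong_monotone :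
  (\int[P]_w (lam * h w ^+ 2)%:E <= \int[P]_w (`|h w| * (sym w)%:R)%:E)%E.
Proof.
have [D [mD D0 DE Dae]] := win_versions.
have mDO : measurable_fun setT (D : Omega -> R) := sub_sigma_measurable_fun Cmeas mD.
have mn : measurable_fun [set: T'] (fun w : T' => (`|h w|)%:E).
  by apply/measurable_EFinP; apply: measurableT_comp.
have -> : (\int[P]_w (`|h w| * (sym w)%:R)%:E = \int[P]_w (`|h w| * D w)%:E)%E.
  under eq_integral do rewrite EFinM; under [RHS]eq_integral do rewrite EFinM.
  symmetry; apply: (eq_weighted_integral Cmeas) => //.
    exact/measurable_bool_natr/measurable_sym.
  move=> S mS; rewrite DE//; have mS' := sub mS.
  have msy := measurable_sym; rewrite -integral_indic//.
  by apply: eq_integral => w _; rewrite indicE mem_setE.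
apply: ae_ge0_le_integral => //.
- by move=> w _; rewrite lee_fin mulr_ge0// sqr_ge0.
- apply/measurable_EFinP; apply: measurable_funM => //; exact: measurable_funX.
- by move=> w _; rewrite lee_fin mulr_ge0.
- by apply/measurable_EFinP; apply: measurable_funM => //; apply: measurableT_comp.
apply: filterS Dae => w [h1 _] _; rewrite lee_fin -real_normK ?num_real//.
rewrite expr2 mulrA mulrC; apply: ler_wpM2l => //; apply: le_trans h1 _.
by apply: ler_piMr => //; case: (_ != _).
Qed.

Lemma win_lipschitz :
  (\int[P]_w ((sym w)%:R)%:E <= \int[P]_w (mu * `|h w|)%:E)%E.
Proof.
have [D [mD D0 DE Dae]] := win_versions.
have mDO : measurable_fun setT (D : Omega -> R) := sub_sigma_measurable_fun Cmeas mD.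
have mh0 : measurable ([set w | h w != 0] : set T').
  rewrite (_ : [set w | h w != 0] = [set w | 0 < h w] `|` [set w | h w < 0]).
    exact: (@measurableU _ T' _ _ mpos mneg).
  apply/seteqP; split => w /=; rewrite neq_lt.
    by move=> /orP[hw|hw]; [right|left].
  by case=> ->; rewrite ?orbT.
have mn : measurable_fun [set: T'] (fun w : T' => ((h w != 0)%:R : R)%:E).
  by apply/measurable_EFinP; exact: measurable_bool_natr.
have -> : (\int[P]_w ((sym w)%:R)%:E = \int[P]_w ((h w != 0)%:R * D w)%:E)%E.
  (* [sym] forces [h != 0]; inserting this indicator first is needed because the upper bound on [D]
     holds only with that factor. *)
  transitivity (\int[P]_w ((h w != 0)%:R * (sym w)%:R)%:E)%E.
    apply: eq_integral => w _; congr (_%:E).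
    by case sy : (sym w); rewrite ?mulr0// (sym_h sy) mulr1.
  under eq_integral do rewrite EFinM; under [RHS]eq_integral do rewrite EFinM.
  symmetry; apply: (eq_weighted_integral Cmeas) => //.
    exact/measurable_bool_natr/measurable_sym.
  move=> S mS; rewrite DE//; have mS' := sub mS.
  have msy := measurable_sym; rewrite -integral_indic//.
  by apply: eq_integral => w _; rewrite indicE mem_setE.
apply: ae_ge0_le_integral => //.
- by move=> w _; rewrite lee_fin mulr_ge0.
- apply/measurable_EFinP; apply: measurable_funM => //.
  exact: (sub_sigma_measurable_fun Cmeas (measurable_bool_natr mh0)).
- by move=> w _; rewrite lee_fin mulr_ge0.
- by apply/measurable_EFinP; apply: measurable_funM => //; apply: measurableT_comp.
by apply: filterS Dae => w [_ h2] _; rewrite lee_fin mulrC.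
Qed.

End ConditionalWin.

(** * Compactness and the Rayleigh quotient *)

Section QuadraticForm.
Import numFieldNormedType.Exports.
Context (R : realType).

Lemma continuous_bigsum (T : topologicalType) (I : Type) (s : seq I) (F : I -> T -> R) :
  (forall i, continuous (F i)) -> continuous (fun x => \sum_(i <- s) F i x).
Proof.
move=> cF x; elim: s => [|i s ih].
  by under eq_fun do rewrite big_nil; exact: cvg_cst.
under eq_fun do rewrite big_cons.
by apply: cvgD => //; exact: cF.
Qed.

Lemma box_minimum (m : nat) (f : 'rV[R]_m -> R) (c : R) :
  0 <= c -> continuous f ->
  exists2 v : 'rV[R]_m, (forall i, 0 <= v ord0 i <= c) &
    forall w : 'rV[R]_m, (forall i, 0 <= w ord0 i <= c) -> f v <= f w.
Proof.
move=> c0 cf; pose A := [set v : 'rV[R]_m | forall i, (`[0, c]%classic : set R) (v ord0 i)].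
have cA : compact A 
  by apply: (@rV_compact _ _ (fun=> `[0, c]%classic)) => i; exact: segment_compact.
have A0 : A !=set0 by exists 0 => i; rewrite /= mxE in_itv /= lexx.
have [v vA hv] := EVT_min_rV A0 cA (continuous_subspaceT cf).
exists v; first by move: vA; rewrite inE => vA i; have := vA i; rewrite /= in_itv.
by move=> w hw; apply: hv; rewrite inE => i /=; rewrite in_itv; exact: hw.
Qed.

Variable m : nat.
Implicit Types (M : 'M[R]_m) (v w : 'rV[R]_m).

Definition qform M v w : R := (v *m M *m w^T) ord0 ord0.

Definition sqnorm v : R := \sum_i v ord0 i ^+ 2.

Lemma qformE M v w : qform M v w = \sum_j (\sum_i v ord0 i * M i j) * w ord0 j.
Proof. by rewrite /qform mxE; apply: eq_bigr => j _; rewrite !mxE. Qed.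

Lemma qformDZ M v w t : M^T = M ->
  qform M (v + t *: w) (v + t *: w) =
  qform M v v + 2 * t * qform M v w + t ^+ 2 * qform M w w.
Proof.
move=> sM; have qs : qform M w v = qform M v w.
  have e : (w *m M *m v^T)^T = v *m M *m w^T by rewrite !trmx_mul trmxK sM mulmxA.
  by rewrite /qform -e [RHS]mxE.
rewrite /qform raddfD /= linearZ /= !mulmxDl !mulmxDr -!scalemxAl -!scalemxAr.
have aE (A B : 'M[R]_1) : (A + B) ord0 ord0 = A ord0 ord0 + B ord0 ord0 by rewrite mxE.
have zE c (A : 'M[R]_1) : (c *: A) ord0 ord0 = c * A ord0 ord0 by rewrite mxE.
by rewrite !(aE, zE) -!/(qform _ _ _) qs; ring.
Qed.

Lemma sqnormE v : sqnorm v = qform 1%:M v v.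
Proof. by rewrite /qform mulmx1 mxE; apply: eq_bigr => i _; rewrite mxE expr2. Qed.

Lemma sqnorm_eq0 v : sqnorm v = 0 -> v = 0.
Proof.
move=> /psumr_eq0P h; apply/matrixP => i j; rewrite mxE ord1.
by have := h (fun i _ => sqr_ge0 _) j isT; move/eqP; rewrite sqrf_eq0 => /eqP.
Qed.

Lemma qformZ M t v : qform M (t *: v) (t *: v) = t ^+ 2 * qform M v v.
Proof.
rewrite /qform linearZ /= -!scalemxAl -!scalemxAr scalerA mxE.
by rewrite expr2.
Qed.

Lemma continuous_qform M : continuous (fun v : 'rV[R]_m => qform M v v).
Proof.
under eq_fun do rewrite qformE.
refine (@continuous_bigsum _ _ _
  (fun j (v : 'rV[R]_m) => (\sum_i v ord0 i * M i j) * v ord0 j) _) => j v.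
apply: continuousM; last exact: coord_continuous.
refine (@continuous_bigsum _ _ _ (fun i (v : 'rV[R]_m) => v ord0 i * M i j) _ v) => i {}v.
by apply: continuousM; [exact: coord_continuous|exact: cst_continuous].
Qed.

Lemma continuous_sqnorm : continuous sqnorm.
Proof.
rewrite (_ : sqnorm = fun v => qform 1%:M v v); first exact: continuous_qform.
by apply/funext => v; exact: sqnormE.
Qed.

Lemma sphere_compact : compact [set v | sqnorm v = 1].
Proof.
pose B := [set v : 'rV[R]_m | forall i, (`[-1, 1]%classic : set R) (v ord0 i)].
have cB : compact B.
  by apply: (@rV_compact R m (fun=> (`[-1, 1]%classic : set R))) => i; exact: segment_compact.
have cl : closed [set v | sqnorm v = 1].
  rewrite (_ : [set v | _] = sqnorm @^-1` [set 1]) //.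
  apply: closed_comp; last exact: closed_eq.
  by move=> v _; exact: continuous_sqnorm.
apply: (subclosed_compact cl cB) => v /= v1 i; rewrite /= in_itv /= -ler_norml.
rewrite -(@ler_pXn2r _ 2)// ?nnegrE// expr1n real_normK ?num_real// -v1.
by rewrite /sqnorm (bigD1 i)//= lerDl sumr_ge0// => j _; exact: sqr_ge0.
Qed.

(* The minimum of the Rayleigh quotient on the unit sphere is an eigenvalue. *)
Lemma qform_ge_min_eigenvalue M (e0 : R) : M^T = M ->
  (forall e, eigenvalue M e -> e0 <= e) ->
  forall v, e0 * sqnorm v <= qform M v v.
Proof.
move=> sM he v; have [v0|v0] := eqVneq (sqnorm v) 0.
  by rewrite v0 mulr0 (sqnorm_eq0 v0) /qform mul0mx mul0mx mxE.
have sn0 w : 0 <= sqnorm w by apply: sumr_ge0 => i _; exact: sqr_ge0.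
have normalize w : sqnorm w != 0 -> sqnorm ((Num.sqrt (sqnorm w))^-1 *: w) = 1.
  move=> w0; rewrite sqnormE qformZ -sqnormE exprVn sqr_sqrtr// mulVf//.
have [|c] := EVT_min_rV _ sphere_compact (continuous_subspaceT (@continuous_qform M)).
  by exists ((Num.sqrt (sqnorm v))^-1 *: v); exact: normalize.
rewrite inE /= => c1 hc; set k := qform M c c in hc.
have hk w : k * sqnorm w <= qform M w w.
  have [w0|w0] := eqVneq (sqnorm w) 0.
    by rewrite w0 mulr0 (sqnorm_eq0 w0) /qform mul0mx mul0mx mxE.
  have wp : 0 < sqnorm w by rewrite lt_def w0 sn0.
  have := hc ((Num.sqrt (sqnorm w))^-1 *: w); rewrite inE => /(_ (normalize _ w0)).
  by rewrite qformZ exprVn sqr_sqrtr// mulrC ler_pdivlMr.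
(* First-order condition at the minimizer: a quadratic in [t] that is nonnegative and vanishes at 0
   has no linear term. *)
have crit w : qform M c w = k * qform 1%:M c w.
  set L := qform M c w - k * qform 1%:M c w.
  set K := qform M w w - k * sqnorm w.
  have K0 : 0 <= K by rewrite subr_ge0.
  have quad t : 0 <= 2 * t * L + t ^+ 2 * K.
    have := hk (c + t *: w); rewrite sqnormE !qformDZ ?trmx1// -!sqnormE c1 -/k.
    by rewrite /L /K; lra.
  suff : L = 0 by move/subr0_eq.
  have K1 : 0 < K + 1 by lra.
  (* The denominator [K + 1] instead of [K] avoids a separate case [K = 0]. *)
  have := quad (- L / (K + 1)).
  have -> : 2 * (- L / (K + 1)) * L + (- L / (K + 1)) ^+ 2 * K =
    - (L ^+ 2 * ((K + 2) / (K + 1) ^+ 2)) by field; rewrite gt_eqF.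
  rewrite oppr_ge0 => h; apply/eqP; rewrite -sqrf_eq0 eq_le sqr_ge0 andbT.
  move: h; rewrite pmulr_lle0// divr_gt0 ?exprn_gt0//; lra.
apply: le_trans (hk v); apply: ler_wpM2r => //; apply: he.
apply/eigenvalueP; exists c; last first.
  by apply/eqP => c0; move: c1; rewrite c0 sqnormE /qform mul0mx mul0mx mxE => /eqP; rewrite eq_sym oner_eq0.
apply/matrixP => i j; rewrite ord1.
have := crit (delta_mx ord0 j); rewrite /qform mulmx1 trmx_delta -!colE !mxE.
by [].
Qed.

End QuadraticForm.

(** * Analytic consequences of nondegeneracy *)

Section Distribution.
Import numFieldNormedType.Exports.
Context (R : realType) (d : measure_display) (Omega : measurableType d).
Variables (P : probability Omega R) (m : nat).
Variables (r : Omega -> R) (a b : 'I_m -> Omega -> R).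
Variables (rb ab bb bl lmin lam mu dB : R).
Hypotheses (mr : measurable_fun setT r) (ma : forall j, measurable_fun setT (a j)).
Hypothesis ND : non_degenerate P r a b rb ab bb bl lmin lam mu.
Hypothesis DBok : delta_B_ok P r a b bl bb dB.

Local Notation av w := (fun j => a j w).
Local Notation B := (Bmean P b).

Lemma nondeg_pos : [/\ 0 < rb, 0 < ab, 0 < bb & 0 < bl] /\ [/\ 0 < lmin, 0 < lam & 0 < mu].
Proof. by case: ND => [[? [? [? [? _]]]] [[? _] [[? [? _]] _]]]. Qed.

Lemma delta_pos : 0 < dB. Proof. by case: DBok. Qed.

(** The eigenvalue [lmin] has a nonzero eigenvector, which dimension 0 excludes. *)
Lemma nondeg_dim : (0 < m)%N.
Proof.
case: ND => [_ [[_ [+ _]] _]]; set M := (\matrix_(_, _) _) => /eigenvalueP[v _].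
rewrite lt0n; apply: contraNneq => m0; apply/eqP/matrixP => i j.
by have := ltn_ord j; rewrite {2}m0.
Qed.

Lemma ae_r : {ae P, forall w, `|r w| <= rb}.
Proof.
by case: ND => [[_ [_ [_ [_ [h _]]]]] _]; apply: filterS h => w /ltW.
Qed.

Lemma ae_sqr_a : {ae P, forall w, \sum_j a j w ^+ 2 <= ab ^+ 2}.
Proof.
have [[_ ab0 _ _] _] := nondeg_pos.
case: ND => [[_ [_ [_ [_ [_ [h _]]]]]] _]; apply: filterS h => w /ltW h.
have s0 : 0 <= \sum_j a j w ^+ 2 by apply: sumr_ge0 => j _; exact: sqr_ge0.
by rewrite -(sqr_sqrtr s0) ler_pXn2r// nnegrE// ltW.
Qed.

Lemma ae_a : {ae P, forall w, forall j, `|a j w| <= ab}.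
Proof.
have [[_ ab0 _ _] _] := nondeg_pos.
apply: filterS ae_sqr_a => w h j.
rewrite -(@ler_pXn2r _ 2) ?nnegrE//; last exact: ltW.
rewrite real_normK ?num_real//.
apply: le_trans h; rewrite (bigD1 j)//= lerDl sumr_ge0// => i _; exact: sqr_ge0.
Qed.

Lemma ae_b : {ae P, forall w, forall j, 0 <= b j w <= bb}.
Proof.
case: ND => [[_ [_ [_ [_ [_ [_ [h _]]]]]]] _]; apply: filterS h => w h j.
have [-> h2] := h j; rewrite /=; apply: le_trans (ler_norm _) (ltW h2).
Qed.

Lemma dotp_norm_le (u D : 'I_m -> R) : (forall j, `|u j| <= ab) ->
  `|dotp u D| <= ab * \sum_j `|D j|.
Proof.
move=> hu; apply: le_trans (ler_norm_sum _ _ _) _.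
rewrite mulr_sumr; apply: ler_sum => j _; rewrite normrM.
exact: ler_wpM2r.
Qed.

Lemma dotpB (u p q : 'I_m -> R) : dotp u p - dotp u q = dotp u (fun j => p j - q j).
Proof. by rewrite /dotp -sumrB; apply: eq_bigr => j _; rewrite mulrBr. Qed.

Lemma bdd_r : bdd P r. Proof. by apply: (bddP mr); exact: ae_r. Qed.

Lemma bdd_a j : bdd P (a j).
Proof. by apply: (bddP (ma j) (M := ab)); apply: filterS ae_a => w. Qed.

Lemma bdd_dotp p : bdd P (fun w => dotp (av w) p).
Proof.
by apply: bdd_sum => j; apply: bddM; [exact: bdd_a|exact: bdd_cst].
Qed.

Lemma bdd_win p : bdd P (fun w => (win r a p w)%:R).
Proof. by apply: bdd_bool; exact: measurable_win. Qed.

Definition usage_mean (p : 'I_m -> R) (j : 'I_m) : R :=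
  mean P (fun w => a j w * (win r a p w)%:R).

Lemma bdd_usage p j : bdd P (fun w => a j w * (win r a p w)%:R).
Proof. by apply: bddM; [exact: bdd_a|exact: bdd_win]. Qed.

Definition dual_fun (B' p : 'I_m -> R) : R :=
  dotp p B' + mean P (fun w => Num.max (r w - dotp (av w) p) 0).

Lemma bdd_surplus p : bdd P (fun w => Num.max (r w - dotp (av w) p) 0).
Proof.
apply: bdd_max; last exact: bdd_cst.
by apply: bddB; [exact: bdd_r|exact: bdd_dotp].
Qed.

Lemma fobjE B' p : fobj P r a p B' = (dual_fun B' p)%:E.
Proof. by rewrite /fobj /dual_fun EFinD meanE ?expectationE//; exact: bdd_surplus. Qed.

Lemma dual_fun_lipschitz B' p q : in_Omega_b bl bb B' ->
  `|dual_fun B' p - dual_fun B' q| <= (bb + ab) * dist1 p q.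
Proof.
have [[_ ab0 _ bl0] _] := nondeg_pos.
move=> hB; have -> : dual_fun B' p - dual_fun B' q = (dotp p B' - dotp q B') +
    (mean P (fun w => Num.max (r w - dotp (av w) p) 0) -
     mean P (fun w => Num.max (r w - dotp (av w) q) 0)) by rewrite /dual_fun; ring.
apply: le_trans (ler_normD _ _) _; rewrite mulrDl; apply: lerD.
  rewrite /dotp -sumrB; apply: le_trans (ler_norm_sum _ _ _) _.
  rewrite mulr_sumr; apply: ler_sum => j _; rewrite -mulrBl normrM mulrC.
  apply: ler_wpM2r => //; have /andP[h1 h2] := hB j.
  by rewrite gtr0_norm ?(lt_trans bl0)// ltW.
have bs := bdd_surplus.
rewrite -meanB//; apply: le_trans (mean_norm (bddB (bs p) (bs q))) _.
apply: mean_ae_le_cst; first by apply: bdd_norm; exact: bddB.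
apply: filterS ae_a => w ha.
apply: le_trans (_ : `|dotp (av w) p - dotp (av w) q| <= _); last first.
  by rewrite dotpB; exact: dotp_norm_le.
set x := r w - _; set y := r w - _.
have -> : dotp (av w) p - dotp (av w) q = y - x by rewrite /x /y; lra.
case: (leP x 0) => hx; case: (leP y 0) => hy; rewrite ?subrr ?normr0 ?subr0 ?sub0r//.
- by rewrite normrN gtr0_norm// ger0_norm; lra.
- by rewrite gtr0_norm// ler0_norm; lra.
- by rewrite distrC.
Qed.

Lemma dual_fun0 B' : dual_fun B' (fun=> 0) <= rb.
Proof.
have [[rb0 _ _ _] _] := nondeg_pos.
have d0 u : dotp u (fun=> 0) = 0 :> R by rewrite /dotp big1// => j _; rewrite mulr0.
have d0' : dotp (fun=> 0) B' = 0 by rewrite /dotp big1// => j _; rewrite mul0r.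
rewrite /dual_fun d0' add0r; apply: mean_ae_le_cst; first exact: bdd_surplus.
apply: filterS ae_r => w; rewrite d0 subr0 ler_norml ge_max => /andP[_ ->].
by rewrite ltW.
Qed.

Lemma dual_fun_ge B' p : in_Omega_b bl bb B' -> (forall j, 0 <= p j) ->
  bl * \sum_j p j <= dual_fun B' p.
Proof.
move=> hB p0; rewrite /dual_fun -[leLHS]addr0; apply: lerD.
  rewrite mulr_sumr; apply: ler_sum => j _; rewrite mulrC; apply: ler_wpM2l => //.
  by have /andP[/ltW] := hB j.
by apply: mean_ge0; [exact: bdd_surplus|move=> w; rewrite le_max lexx orbT].
Qed.

(** Otherwise the replenishment term alone would exceed [rb], whereas the zero price has value at
    most [rb]. *)
Lemma minimizer_Omega_p B' ps : in_Omega_b bl bb B' -> is_minimizer P r a B' ps ->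
  in_Omega_p rb bl ps.
Proof.
have [[_ _ _ bl0] _] := nondeg_pos.
move=> hB [ps0 hmin]; split => //; have := hmin (fun=> 0) (fun=> lexx 0).
rewrite !fobjE lee_fin => h; rewrite ler_pdivlMr// mulrC.
exact: le_trans (dual_fun_ge hB ps0) (le_trans h (dual_fun0 B')).
Qed.

(** Compactness on a cube of side [rb / bl]; any price whose components sum to more is beaten by the
    zero price. *)
Lemma minimizer_exists B' : in_Omega_b bl bb B' ->
  exists ps, is_minimizer P r a B' ps.
Proof.
have [[rb0 _ _ bl0] _] := nondeg_pos.
move=> hB; pose f (v : 'rV[R]_m) := dual_fun B' (fun j => v ord0 j).
have cf : continuous f.
  move=> v; apply/(@cvgrPdist_lt _ _ _ _ (nbhs_filter v)) => e e0.
  pose g (t : 'rV[R]_m) := \sum_j (bb + ab) * `|v ord0 j - t ord0 j|.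
  have cg : continuous g.
    refine (@continuous_bigsum _ _ _ _
      (fun j (t : 'rV[R]_m) => (bb + ab) * `|v ord0 j - t ord0 j|) _) => j t.
    apply: (@continuousM _ _ (fun=> bb + ab) (fun t : 'rV[R]_m => `|v ord0 j - t ord0 j|)).
      exact: cst_continuous.
    apply: (@continuous_comp _ _ _ (fun t : 'rV[R]_m => v ord0 j - t ord0 j) Num.norm).
      by apply: continuousB; [exact: cst_continuous|exact: coord_continuous].
    exact: norm_continuous.
  have gv : g v = 0 by rewrite /g big1// => j _; rewrite subrr normr0 mulr0.
  have := @cvgr_lt _ _ _ (nbhs_filter v) _ _ (cg v) e; rewrite gv => /(_ e0).
  apply: (@filterS _ _ (nbhs_filter v)) => t ht; apply: le_lt_trans ht.
  rewrite /f; apply: le_trans (dual_fun_lipschitz _ _ hB) _.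
  by rewrite /g /dist1 mulr_sumr.
have c0 : 0 <= rb / bl by rewrite divr_ge0 ?ltW.
have [v hv hmin] := box_minimum c0 cf.
exists (fun j => v ord0 j); split=> [j|q q0]; first by have /andP[] := hv j.
rewrite !fobjE lee_fin; have [hq|hq] := leP (\sum_j q j) (rb / bl).
  have := hmin (\row_j q j); rewrite /f.
  have -> : (fun j => (\row_j q j) ord0 j) = q by apply/funext => j; rewrite mxE.
  apply => j; rewrite mxE q0 /=; apply: le_trans hq.
  by rewrite (bigD1 j)//= lerDl sumr_ge0.
have h0 : dual_fun B' (fun j => v ord0 j) <= dual_fun B' (fun=> 0).
  have := hmin 0; rewrite /f.
  have -> : (fun j => (0 : 'rV[R]_m) ord0 j) = fun=> 0 by apply/funext => j; rewrite mxE.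
  by apply => j; rewrite mxE lexx c0.
apply: le_trans h0 (le_trans (dual_fun0 B') (le_trans _ (dual_fun_ge hB q0))).
by rewrite ltW// mulrC -ltr_pdivrMr.
Qed.

Lemma Bmean_box g : (forall j, `|g j| < dB) ->
  forall j, B j - dB < B j - g j < B j + dB.
Proof. by move=> h j; have := h j; rewrite ltr_norml; lra. Qed.

Lemma Omega_b_box g : (forall j, `|g j| < dB) -> in_Omega_b bl bb (fun j => B j - g j).
Proof. by move=> h; case: DBok => _ /(_ _ (Bmean_box h))[]. Qed.

Lemma minimizer_kkt B' ps : in_Omega_b bl bb B' -> is_minimizer P r a B' ps ->
  forall j, usage_mean ps j <= B' j /\ (0 < ps j -> usage_mean ps j = B' j).
Proof.
move=> hB hps j; case: ND => [_ [_ [_ /(_ _ _ hB hps j) /= [h1 h2]]]].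
have [ps0 _] := hps; split=> [|/h2.1]; last by move=> ->.
have := ps0 j; rewrite le_eqVlt => /predU1P[/esym/h1.1/ltW//|/h2.1 ->].
exact: lexx.
Qed.

Section Pair.
Variables (B' ps p : 'I_m -> R).
Hypotheses (hB : in_Omega_b bl bb B') (hps : is_minimizer P r a B' ps).
Hypothesis hp : in_Omega_p rb bl p.

Let sym w := win r a p w (+) win r a ps w.
Let h w := dotp (av w) p - dotp (av w) ps.

Let bdd_h : bdd P h. Proof. by apply: bddB; exact: bdd_dotp. Qed.
Let bdd_sym : bdd P (fun w => (sym w)%:R).
Proof. by apply: bdd_bool; exact: measurable_sym. Qed.

Let regular := let: conj _ (conj _ (conj (conj _ (conj _ H)) _)) := ND in
  H p B' ps hp hB hps.

Lemma mean_switch : mean P (fun w => (sym w)%:R) <= mu * ab * dist1 p ps.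
Proof.
have [[_ ab0 _ _] [_ lam0 mu0]] := nondeg_pos.
have := win_lipschitz mr ma (ltW mu0) regular.
rewrite -(meanE bdd_sym) -meanE ?lee_fin; last by apply: bddZ; exact: bdd_norm.
move=> /le_trans; apply; rewrite meanZ; last exact: bdd_norm.
rewrite -mulrA; apply: ler_wpM2l; first exact: ltW.
apply: mean_ae_le_cst; first exact: bdd_norm.
apply: filterS ae_a => w ha; rewrite dotpB; exact: dotp_norm_le.
Qed.

Lemma usage_mean_lipschitz j :
  `|usage_mean p j - usage_mean ps j| <= mu * ab ^+ 2 * dist1 p ps.
Proof.
have [[_ ab0 _ _] _] := nondeg_pos.
have bd := bddB (bdd_usage p j) (bdd_usage ps j).
rewrite /usage_mean -meanB//; [|exact: bdd_usage|exact: bdd_usage].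
apply: le_trans (mean_norm bd) _.
apply: (@le_trans _ _ (mean P (fun w => ab * (sym w)%:R))).
  apply: mean_ae_le; [exact: bdd_norm|exact: bddZ|].
  apply: filterS ae_a => w /(_ j) ha; rewrite -mulrBr normrM.
  apply: ler_pM => //; rewrite /sym.
  by case: (win r a p w); case: (win r a ps w);
    rewrite /= ?subrr ?subr0 ?sub0r ?normrN ?normr0 ?normr1.
rewrite meanZ//; apply: le_trans (ler_wpM2l (ltW ab0) mean_switch) _.
by rewrite le_eqVlt; apply/orP; left; apply/eqP; ring.
Qed.

(** Pointwise: a higher bid price can only turn acceptance into rejection, so [h] and the change of
    decision have opposite signs. *)
Lemma mean_sym_h : mean P (fun w => `|h w| * (sym w)%:R) =
  - \sum_j (usage_mean p j - usage_mean ps j) * (p j - ps j).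
Proof.
have -> : \sum_j (usage_mean p j - usage_mean ps j) * (p j - ps j) =
   mean P (fun w => \sum_j (p j - ps j) *
     (a j w * (win r a p w)%:R - a j w * (win r a ps w)%:R)).
  have bd j := bddB (bdd_usage p j) (bdd_usage ps j).
  rewrite mean_sum; last by move=> j; exact: bddZ.
  by apply: eq_bigr => j _; rewrite meanZ// meanB// 1?mulrC//; exact: bdd_usage.
rewrite -meanN; last first.
  by apply: bdd_sum => j; apply: bddZ; apply: bddB; exact: bdd_usage.
congr (mean P _); apply/funext => w.
have -> : \sum_j (p j - ps j) * (a j w * (win r a p w)%:R - a j w * (win r a ps w)%:R) =
    h w * ((win r a p w)%:R - (win r a ps w)%:R).
  by rewrite /h dotpB /dotp mulr_suml; apply: eq_bigr => j _; ring.
rewrite /sym /h /win.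
by case: ltP => h1; case: ltP => h2; rewrite /= ?mulr1n ?mulr0n; case: ger0P => h3; lra.
Qed.

Lemma mean_sqr_h : lmin * \sum_j (p j - ps j) ^+ 2 <= mean P (fun w => h w ^+ 2).
Proof.
case: ND => [_ [[_ [_ he]] _]].
set M := (\matrix_(i < m, j < m) _) in he.
have sM : M^T = M.
  apply/matrixP => i j; rewrite !mxE; congr (fine _); congr (expectation P _).
  by apply/funext => w; rewrite mulrC.
have := qform_ge_min_eigenvalue sM he (\row_j (p j - ps j)).
rewrite /sqnorm qformE.
under eq_bigr do rewrite mxE.
move=> /le_trans; apply.
have -> : (fun w => h w ^+ 2) = (fun w => \sum_j \sum_i
    ((p i - ps i) * (p j - ps j)) * (a i w * a j w)).
  apply/funext => w; rewrite /h dotpB /dotp expr2 mulr_sumr; apply: eq_bigr => j _.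
  by rewrite mulr_suml; apply: eq_bigr => i _; ring.
have bdaa i j : bdd P (fun w => a i w * a j w) by apply: bddM; exact: bdd_a.
rewrite mean_sum; last by move=> j; apply: bdd_sum => i; exact: bddZ.
rewrite le_eqVlt; apply/orP; left; apply/eqP; apply: eq_bigr => j _.
rewrite mean_sum; last by move=> i; exact: bddZ.
rewrite mulr_suml; apply: eq_bigr => i _; rewrite meanZ// !mxE /mean; ring.
Qed.

(** [lam] bounds the mean of [|h|] on [sym] below by that of [h ^ 2], and [lmin] bounds the latter
    below by the squared distance. *)
Lemma usage_mean_monotone : lam * lmin * \sum_j (p j - ps j) ^+ 2 <=
  - \sum_j (usage_mean p j - usage_mean ps j) * (p j - ps j).
Proof.
have [_ [_ lam0 mu0]] := nondeg_pos.
rewrite -mean_sym_h -mulrA.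
apply: le_trans (ler_wpM2l (ltW lam0) mean_sqr_h) _.
have b2 : bdd P (fun w => h w ^+ 2) by apply: bddM.
have bn : bdd P (fun w => `|h w| * (sym w)%:R) by apply: bddM => //; exact: bdd_norm.
rewrite -meanZ// -lee_fin !meanE//; last exact: bddZ.
exact: (win_strong_monotone mr ma (ltW lam0) regular).
Qed.

(** One factor [ab * dist1 p ps] bounds the loss when the decisions differ, the other comes from the
    probability that they do. *)
Lemma mean_reward_loss :
  mean P (fun w => (r w - dotp (av w) ps) * ((win r a ps w)%:R - (win r a p w)%:R)) <=
    mu * ab ^+ 2 * dist1 p ps ^+ 2.
Proof.
have [[_ ab0 _ _] _] := nondeg_pos.
have D0 : 0 <= dist1 p ps by apply: sumr_ge0.
apply: (@le_trans _ _ (mean P (fun w => (ab * dist1 p ps) * (sym w)%:R))).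
  apply: mean_ae_le; [|exact: bddZ|].
    by apply: bddM; apply: bddB; [exact: bdd_r|exact: bdd_dotp|exact: bdd_win|exact: bdd_win].
  apply: filterS ae_a => w ha.
  have := dotp_norm_le (fun j => p j - ps j) ha; rewrite -dotpB -/(dist1 p ps).
  rewrite /sym /win ler_norml => /andP[e1 e2].
  by case: ltP => h1; case: ltP => h2; rewrite /= ?mulr1n ?mulr0n; lra.
rewrite meanZ//; apply: le_trans (ler_wpM2l _ mean_switch) _.
  by rewrite mulr_ge0// ltW.
by rewrite le_eqVlt; apply/orP; left; apply/eqP; ring.
Qed.

End Pair.

(** Raise the replenishment of [j] alone by [dB / 2]. The support is unchanged, so the usage of [j]
    must rise by [dB / 2], and the Lipschitz bound forces the minimizer to move a definite distance.
    Strong monotonicity bounds the square of that distance by a multiple of the drop in the price of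
    [j], which is at most [ps j]. *)
Lemma binding_price_ge ps j : is_minimizer P r a B ps -> 0 < ps j ->
  ceta m ab lmin lam mu dB <= ps j.
Proof.
move=> hps pj; have dB0 := delta_pos; have m0 := nondeg_dim.
have [[_ ab0 _ bl0] [lmin0 lam0 mu0]] := nondeg_pos.
have hB : in_Omega_b bl bb B.
  have := @Omega_b_box (fun=> 0); under eq_fun do rewrite subr0; apply.
  by move=> i; rewrite normr0.
pose g (i : 'I_m) : R := if i == j then - (dB / 2) else 0.
have hg i : `|g i| < dB.
  rewrite /g; case: ifP => _; rewrite ?normrN ?normr0//.
  by rewrite gtr0_norm; lra.
have hB2 := Omega_b_box hg.
have [q hq] := minimizer_exists hB2.
have supp i : (0 < q i) = (0 < ps i).
  by case: DBok => _ /(_ _ (Bmean_box hg))[_]; apply.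
have hqO := minimizer_Omega_p hB2 hq.
have [ps0 _] := hps; have [q0 _] := hqO.
have kq := minimizer_kkt hB2 hq; have kp := minimizer_kkt hB hps.
have mono := usage_mean_monotone hB hps hqO.
(* Other resources contribute nothing: on the common support both usages equal the same
   replenishment, and off it both prices vanish. *)
have e0 : \sum_i (usage_mean q i - usage_mean ps i) * (q i - ps i) =
  dB / 2 * (q j - ps j).
  rewrite (bigD1 j)//= big1 ?addr0=> [|i ij].
    rewrite (kq j).2 ?supp// (kp j).2// /g eqxx; ring.
  have := ps0 i; rewrite le_eqVlt => /predU1P[e|pi]; last first.
    by rewrite (kq i).2 ?supp// (kp i).2// /g (negPf ij) subr0 subrr mul0r.
  have : ~~ (0 < q i) by rewrite supp -e ltxx.
  rewrite -leNgt => qi; have -> : q i = 0 by apply: le_anti; rewrite qi q0.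
  by rewrite -e subrr mulr0.
rewrite e0 in mono.
have lip := usage_mean_lipschitz hB hps hqO j.
rewrite (kq j).2 ?supp// (kp j).2// /g eqxx in lip.
have {}lip : dB / 2 <= mu * ab ^+ 2 * dist1 q ps.
  apply: le_trans lip; apply: le_trans (ler_norm _); lra.
set S := \sum_i (q i - ps i) ^+ 2 in mono.
set D := dist1 q ps in lip.
have cs : D ^+ 2 <= m%:R * S by exact: dist1_sqr_le.
have m1 : 0 < m%:R :> R by rewrite ltr0n.
have K0 : 0 < mu * ab ^+ 2 by rewrite mulr_gt0 ?exprn_gt0.
have e1 : (dB / 2) ^+ 2 <= (mu * ab ^+ 2) ^+ 2 * (m%:R * S).
  apply: le_trans (_ : (mu * ab ^+ 2 * D) ^+ 2 <= _).
    by rewrite ler_pXn2r ?nnegrE//; [lra|apply: mulr_ge0; [exact: ltW|exact: sumr_ge0]].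
  by rewrite exprMn; apply: ler_wpM2l => //; rewrite sqr_ge0.
have e2 : lam * lmin * S <= dB / 2 * ps j.
  apply: le_trans mono _; have := q0 j; nra.
rewrite /ceta ler_pdivrMr; last by rewrite !mulr_gt0 ?exprn_gt0.
have ll : 0 < lam * lmin by rewrite mulr_gt0.
have e3 := ler_wpM2l (ltW ll) e1.
have mK : 0 <= (mu * ab ^+ 2) ^+ 2 * m%:R by rewrite mulr_ge0 ?sqr_ge0 ?ltW.
have e4 := ler_wpM2l mK e2.
have e5 : lam * lmin * (dB / 2) ^+ 2 <= (mu * ab ^+ 2) ^+ 2 * m%:R * (dB / 2 * ps j).
  apply: le_trans e3 (le_trans _ e4).
  by rewrite le_eqVlt; apply/orP; left; apply/eqP; ring.
have d20 : 0 < dB / 4 by lra.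
rewrite -(ler_pM2r d20).
have -> : lam * lmin * dB * (dB / 4) = lam * lmin * (dB / 2) ^+ 2 by field.
apply: le_trans e5 _.
by rewrite le_eqVlt; apply/orP; left; apply/eqP; field.
Qed.

Lemma Bmean_Omega_b : in_Omega_b bl bb B.
Proof.
have := @Omega_b_box (fun=> 0); under eq_fun do rewrite subr0; apply.
by move=> i; rewrite normr0; exact: delta_pos.
Qed.

Lemma minimizer_dual_facts ps : is_minimizer P r a B ps ->
  dual_facts rb ab bl lmin lam mu dB usage_mean B ps.
Proof.
move=> hps; have hB := Bmean_Omega_b; split.
- exact: minimizer_Omega_p hps.
- by move=> j; have /andP[/ltW] := hB j.
- exact: minimizer_kkt.
- by move=> j; exact: binding_price_ge.
- by move=> p hp; exact: usage_mean_monotone hB hps hp.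
- move=> g hg; have hB' := Omega_b_box hg.
  have [q hq] := minimizer_exists hB'; exists q; split.
  + exact: minimizer_Omega_p hB' hq.
  + exact: minimizer_kkt.
  + by move=> p hp j; exact: usage_mean_lipschitz hB' hq hp j.
Qed.

End Distribution.

(** * Means of products of independent variables *)

Section Independence.
Context (R : realType) (d : measure_display) (Omega : measurableType d).
Variables (P : probability Omega R) (K : eqType) (C : K -> set (set Omega)).
Hypothesis Cmeas : forall k, C k `<=` measurable.
Hypothesis indep : forall (s : seq K) (A : K -> set Omega), uniq s ->
  (forall k, k \in s -> <<s C k >> (A k)) ->
  P (\big[setI/setT]_(k <- s) A k) = (\prod_(k <- s) fine (P (A k)))%:E.
Variable f : K -> Omega -> R.
Hypothesis mf : forall k, measurable_fun [set: g_sigma_algebraType (C k)] (f k).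
Hypothesis f0 : forall k w, 0 <= f k w.
Hypothesis bf : forall k, bdd P (f k).

Let bdd_indic (A : set Omega) : measurable A -> bdd P (\1_A : Omega -> R).
Proof.
move=> mA; split; first exact: measurable_indic.
by exists 1; apply: aeW => w; rewrite indicE; case: (_ \in _); rewrite ?normr1 ?normr0.
Qed.

(** Sets are traded for functions one at a time. By induction, the product of the other factors and
    a constant have equal integrals over every set of the sigma-algebra of [k];
    [eq_weighted_integral] extends this from sets to [f k]. *)
Let mean_mixed (s1 s2 : seq K) (A : K -> set Omega) : uniq (s1 ++ s2) ->
  (forall k, k \in s2 -> <<s C k >> (A k)) ->
  mean P (fun w => \prod_(k <- s1) f k w * \1_(\big[setI/setT]_(k <- s2) A k) w) =
  \prod_(k <- s1) mean P (f k) * \prod_(k <- s2) fine (P (A k)).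
Proof.
have mI (s : seq K) (A' : K -> set Omega) : (forall k, k \in s -> <<s C k >> (A' k)) ->
    measurable (\big[setI/setT]_(k <- s) A' k).
  elim: s => [|k s ih] h; first by rewrite big_nil.
  rewrite big_cons; apply: measurableI.
    by apply: (sub_sigma_measurable (@Cmeas k)); apply: h; rewrite mem_head.
  by apply: ih => i i_s; apply: h; rewrite inE i_s orbT.
elim: s1 s2 A => [|k s1 ih] s2 A us hA.
  under eq_fun do rewrite big_nil mul1r.
  have mA := mI _ _ hA.
  apply: EFin_inj; rewrite big_nil mul1r meanE; last exact: bdd_indic.
  rewrite integral_indic// setIT; apply: indep => //.
have [ks us'] : (k \notin s1 ++ s2) /\ uniq (s1 ++ s2) by move: us; rewrite /= => /andP[].
have mA := mI _ _ hA.
pose W w := \prod_(i <- s1) f i w * \1_(\big[setI/setT]_(i <- s2) A i) w.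
pose c := \prod_(i <- s1) mean P (f i) * \prod_(i <- s2) fine (P (A i)).
have W0 w : 0 <= W w.
  by apply: mulr_ge0; [apply: prodr_ge0 => i _|rewrite indicE].
have bW : bdd P W by apply: bddM; [exact: bdd_prod|exact: bdd_indic].
have c0 : 0 <= c.
  apply: mulr_ge0; apply: prodr_ge0 => i _; first exact: mean_ge0.
  by apply: fine_ge0; exact: measure_ge0.
have -> : (fun w => \prod_(i <- k :: s1) f i w * \1_(\big[setI/setT]_(i <- s2) A i) w) =
   (fun w => f k w * W w) by apply/funext => w; rewrite big_cons mulrA.
rewrite big_cons -mulrA -/c mulrC -meanZ//.
apply: EFin_inj; rewrite !meanE; [|exact: bddZ|exact: bddM].
under eq_integral do rewrite EFinM.
under [RHS]eq_integral do rewrite mulrC EFinM.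
apply: (eq_weighted_integral (@Cmeas k) (w1 := W) (w2 := fun=> c)) => //.
- by case: bW.
- move=> S mS; have mS' := sub_sigma_measurable (@Cmeas k) mS.
  have hu : uniq (s1 ++ k :: s2).
    by rewrite -[k :: s2]cat1s uniq_catCA; exact: us.
  pose A' i := if i == k then S else A i.
  have eA : \big[setI/setT]_(i <- k :: s2) A' i = S `&` \big[setI/setT]_(i <- s2) A i.
    rewrite big_cons /A' eqxx; congr (_ `&` _); apply: eq_big_seq => i i2.
    case: eqP => // ik; move: ks; rewrite -ik mem_cat i2 orbT.
    by [].
  have hA' i : i \in k :: s2 -> <<s C i >> (A' i).
    rewrite inE /A'; case: eqP => [->//|_ /=]; exact: hA.
  have := ih (k :: s2) A' hu hA'; rewrite eA big_cons (_ : A' k = S); last by rewrite /A' eqxx.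
  have -> : \prod_(i <- s2) fine (P (A' i)) = \prod_(i <- s2) fine (P (A i)).
    apply: eq_big_seq => i i2; rewrite /A'; case: eqP => // ik.
    by move: ks; rewrite -ik mem_cat i2 orbT.
  rewrite mulrCA -/c => e.
  have -> : (\int[P]_(x in S) c%:E = (fine (P S) * c)%:E)%E.
    by rewrite integral_cst// [RHS]EFinM fineK ?fin_num_measure// muleC.
  rewrite -e meanE; last by apply: bddM; [exact: bdd_prod|apply: bdd_indic; exact: measurableI].
  rewrite integral_mkcond; apply: eq_integral => w _; rewrite /patch /W !indicE in_setI.
  by case: (w \in S); rewrite //= mulr0.
- by apply/measurable_EFinP; exact: mf.
- by move=> w; rewrite lee_fin.
Qed.

Lemma mean_prod_independent (s : seq K) : uniq s ->
  mean P (fun w => \prod_(k <- s) f k w) = \prod_(k <- s) mean P (f k).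
Proof.
move=> us; have := @mean_mixed s [::] (fun=> setT); rewrite cats0 => /(_ us) h.
rewrite !big_nil mulr1 in h; rewrite -h//; congr (mean P _); apply/funext => w.
by rewrite indicT mulr1.
Qed.

End Independence.

(** * The measurable space of a single observation *)

Section Observations.
Context (R : realType) (m : nat).

Definition obs : Type := (R * ('I_m -> R) * ('I_m -> R))%type.
HB.instance Definition _ := gen_eqMixin obs.
HB.instance Definition _ := gen_choiceMixin obs.
HB.instance Definition _ := isPointed.Build obs (0, fun=> 0, fun=> 0).

(** The sets on which [data_model] equates the laws. They are stable under intersection, so the laws
    agree on the sigma-algebra they generate. *)
Definition rectangles : set (set obs) := [set S | exists B0 B1 B2,
  [/\ measurable B0, forall j, measurable (B1 j), forall j, measurable (B2 j) &
      S = [set v | (B0 : set R) v.1.1 /\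
                   forall j, (B1 j : set R) (v.1.2 j) /\ (B2 j : set R) (v.2 j)]]].

Definition obsM := g_sigma_algebraType rectangles.

Lemma measurable_obs_r : measurable_fun setT (fun v : obsM => v.1.1).
Proof.
move=> _ B mB; rewrite setTI; apply: sub_gen_smallest.
exists B, (fun=> setT), (fun=> setT); split => //.
by apply/seteqP; split => v //= [].
Qed.

Lemma measurable_obs_a j : measurable_fun setT (fun v : obsM => v.1.2 j).
Proof.
move=> _ B mB; rewrite setTI; apply: sub_gen_smallest.
exists setT, (fun i => if i == j then B else setT), (fun=> setT); split => //.
  by move=> i; case: ifP.
apply/seteqP; split => v /=.
  by move=> Bv; split => // i; split => //; case: eqP => // ->.
by move=> [_ /(_ j)[]]; rewrite eqxx.
Qed.

Lemma measurable_obs_b j : measurable_fun setT (fun v : obsM => v.2 j).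
Proof.
move=> _ B mB; rewrite setTI; apply: sub_gen_smallest.
exists setT, (fun=> setT), (fun i => if i == j then B else setT); split => //.
  by move=> i; case: ifP.
apply/seteqP; split => v /=.
  by move=> Bv; split => // i; split => //; case: eqP => // ->.
by move=> [_ /(_ j)[_]]; rewrite eqxx.
Qed.

Lemma measurable_fun_obs d (T : measurableType d) (f : T -> obsM) :
  measurable_fun setT (fun w => (f w).1.1) ->
  (forall j, measurable_fun setT (fun w => (f w).1.2 j)) ->
  (forall j, measurable_fun setT (fun w => (f w).2 j)) ->
  measurable_fun setT f.
Proof.
move=> m0 m1 m2 _ B mB; rewrite setTI; move: B mB.
apply: smallest_sub; first split.
- by rewrite /= preimage_set0.
- by move=> A mA; rewrite /= setTD preimage_setC; exact: measurableC.
- by move=> F mF; rewrite /= preimage_bigcup; exact: bigcupT_measurable.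
move=> _ [B0 [B1 [B2 [mB0 mB1 mB2 ->]]]] /=.
have -> : f @^-1` [set v | B0 v.1.1 /\ (forall j, B1 j (v.1.2 j) /\ B2 j (v.2 j))] =
  ((fun w => (f w).1.1) @^-1` B0) `&` \bigcap_j
   (((fun w => (f w).1.2 j) @^-1` B1 j) `&` ((fun w => (f w).2 j) @^-1` B2 j)).
  apply/seteqP; split => w /=.
    by move=> [h0 h]; split => // j _; have [] := h j.
  by move=> [h0 h]; split => // j; have [] := h j I.
apply: measurableI; first by rewrite -[X in measurable X]setTI; exact: m0.
apply: fin_bigcap_measurable => // j _; apply: measurableI.
  by rewrite -[X in measurable X]setTI; exact: m1.
by rewrite -[X in measurable X]setTI; exact: m2.
Qed.

End Observations.

(** * Chernoff bound for sums of observations *)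

Section Exponential.
Context (R : realType).

(** Square 1 - x/2 <= exp (-x/2) and multiply out; what remains is x^2 (1 - x) (5 - 2 x) / 4 >=
    0. *)
Lemma expR_le_quadratic (x : R) : x <= 1 -> expR x <= 1 + x + 2 * x ^+ 2.
Proof.
move=> x1; have h : 1 - x / 2 <= expR (- (x / 2)) by exact: expR_ge1Dx.
have h0 : 0 < 1 - x / 2 by lra.
have e0 := expR_gt0 (x / 2).
have h1 : expR (x / 2) * (1 - x / 2) <= 1.
  have e : expR (x / 2) * expR (- (x / 2)) = 1 by rewrite -expRD subrr expR0.
  by rewrite -[leRHS]e; apply: ler_wpM2l => //; exact: ltW.
have h2 : expR x * (1 - x / 2) ^+ 2 <= 1.
  have -> : expR x = expR (x / 2) ^+ 2.
    by rewrite expr2 -expRD; congr expR; lra.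
  by rewrite -exprMn; apply: exprn_ile1 => //; rewrite mulr_ge0// ltW.
have p0 : 0 < (1 - x / 2) ^+ 2 by rewrite exprn_gt0.
rewrite -(ler_pM2r p0); apply: le_trans h2 _.
have := mulr_ge0 (sqr_ge0 x) (mulr_ge0 (_ : 0 <= 1 - x) (_ : 0 <= 5 - 2 * x)).
by move=> /(_ ltac:(lra) ltac:(lra)); nra.
Qed.

(** In the mean of a centred variable the linear term vanishes, which gives a sub-Gaussian moment
    bound directly. *)
Lemma expR_le_id_plus (x : R) : expR x <= x + expR (2 * x ^+ 2).
Proof.
have [x1|x1] := leP x 1.
  apply: le_trans (expR_le_quadratic x1) _.
  have := expR_ge1Dx (2 * x ^+ 2); lra.
have : expR x <= expR (2 * x ^+ 2) by rewrite ler_expR; nra.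
lra.
Qed.

End Exponential.

Section Model.
Context (R : realType) (d : measure_display) (Omega : measurableType d).
Variables (P : probability Omega R) (m : nat).
Variables (r : nat -> Omega -> R) (a b : nat -> 'I_m -> Omega -> R).
Variable u : nat -> Omega -> R.
Hypothesis DM : data_model P r a b u.
Local Notation obsM := (obsM R m).

Definition obs_at (t : nat) (w : Omega) : obsM :=
  (r t w, (fun j => a t j w), (fun j => b t j w)).

Let C (t : nat) : set (set Omega) := [set A | exists X B,
  block r a b t X /\ measurable B /\ A = X @^-1` B].

Let mr t : measurable_fun setT (r t). Proof. by case: DM. Qed.
Let ma t j : measurable_fun setT (a t j). Proof. by case: DM => _ []. Qed.
Let mb t j : measurable_fun setT (b t j). Proof. by case: DM => _ [_ []]. Qed.

Let Cmeas t : C t `<=` measurable.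
Proof.
move=> A [X [B [hX [mB ->]]]]; rewrite -[X in measurable X]setTI.
by case: hX => [->|[[j ->]|[j ->]]]; [exact: mr|exact: ma|exact: mb].
Qed.

Let Cfun t X : block r a b t X ->
  measurable_fun [set: g_sigma_algebraType (C t)] (X : _ -> R).
Proof.
by move=> hX _ B mB; rewrite setTI; apply: sub_gen_smallest; exists X, B.
Qed.

Lemma measurable_obs_at t : measurable_fun setT (obs_at t).
Proof. by apply: measurable_fun_obs => [|j|j]; [exact: mr|exact: ma|exact: mb]. Qed.

Let measurable_obs_at_block t :
  measurable_fun [set: g_sigma_algebraType (C t)] (obs_at t : _ -> obsM).
Proof.
apply: measurable_fun_obs => [|j|j]; apply: Cfun; first by left.
  by right; left; exists j.
by right; right; exists j.
Qed.

Lemma obs_at_law t (S : set obsM) : measurable S ->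
  P (obs_at t @^-1` S) = P (obs_at 0 @^-1` S).
Proof.
move=> mS.
pose v k : {mfun Omega >-> obsM} :=
  HB.pack (obs_at k) (isMeasurableFun.Build _ _ _ _ _ (measurable_obs_at k)).
apply: (@g_sigma_algebra_measure_unique _ R obsM (@rectangles R m) _ (fun=> setT)
  _ _ (distribution P (v t)) (distribution P (v 0)) _ _ _ S mS).
- by move=> A GA; exact: sub_gen_smallest.
- by move=> _; exists setT, (fun=> setT), (fun=> setT); split => //; apply/seteqP; split.
- by rewrite bigcup_const//; exists 0.
- move=> _ _ [A0 [A1 [A2 [mA0 mA1 mA2 ->]]]] [B0 [B1 [B2 [mB0 mB1 mB2 ->]]]].
  exists (A0 `&` B0), (fun j => A1 j `&` B1 j), (fun j => A2 j `&` B2 j); split.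
  + exact: measurableI.
  + by move=> j; exact: measurableI.
  + by move=> j; exact: measurableI.
  + apply/seteqP; split => w /=.
      move=> [[h0 h] [k0 k]]; split => // j.
      by have [? ?] := h j; have [? ?] := k j.
    move=> [[h0 k0] h]; split; split => // j; by have [[? ?] [? ?]] := h j.
- move=> _ [B0 [B1 [B2 [mB0 mB1 mB2 ->]]]].
  case: DM => _ [_ [_ [_ [law _]]]].
  exact: law.
- by move=> k; rewrite -ge0_fin_numE// fin_num_measure.
Qed.

Lemma obs_at_integral t (h : obsM -> R) : measurable_fun setT h ->
  (forall v, 0 <= h v) ->
  (\int[P]_w (h (obs_at t w))%:E = \int[P]_w (h (obs_at 0 w))%:E)%E.
Proof.
move=> mh h0.
have e k : (\int[P]_w (h (obs_at k w))%:E = \int[pushforward P (obs_at k)]_v (h v)%:E)%E.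
  rewrite ge0_integral_pushforward//; first exact: measurable_obs_at.
    exact/measurable_EFinP.
  by move=> v _; rewrite lee_fin.
pose v k : {mfun Omega >-> obsM} :=
  HB.pack (obs_at k) (isMeasurableFun.Build _ _ _ _ _ (measurable_obs_at k)).
rewrite !e.
apply: (@eq_measure_integral _ _ _ _ (distribution P (v 0)) (distribution P (v t))).
by move=> A mA _; exact: obs_at_law.
Qed.

Lemma obs_at_ae_le t (h : obsM -> R) c : measurable_fun setT h ->
  {ae P, forall w, h (obs_at 0 w) <= c} -> {ae P, forall w, h (obs_at t w) <= c}.
Proof.
move=> mh [N [mN PN sN]].
have mS : measurable [set v | c < h v].
  exact: measurable_ltr_set (measurable_cst c) mh.
have mSt k : measurable (obs_at k @^-1` [set v | c < h v]).
  by rewrite -[X in measurable X]setTI; exact: measurable_obs_at.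
exists (obs_at t @^-1` [set v | c < h v]); split => //.
  rewrite obs_at_law//; apply/eqP; rewrite eq_le measure_ge0 andbT -PN.
  apply: le_measure; rewrite ?inE// => w /= hw; apply: sN => /=.
  by rewrite leNgt hw.
by move=> w /=; rewrite ltNge => /negP.
Qed.

Lemma obs_at_bdd t (h : obsM -> R) M : measurable_fun setT h ->
  {ae P, forall w, `|h (obs_at 0 w)| <= M} -> bdd P (fun w => h (obs_at t w)).
Proof.
move=> mh hM; split.
  by apply: (measurableT_comp mh); exact: measurable_obs_at.
exists M; apply: (@obs_at_ae_le t (fun v => `|h v|)) => //.
exact: measurableT_comp.
Qed.

Lemma exp_moment_le t (h : obsM -> R) M theta : measurable_fun setT h -> 0 <= theta ->
  {ae P, forall w, `|h (obs_at 0 w)| <= M} ->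
  mean P (fun w => h (obs_at 0 w)) <= 0 ->
  bdd P (fun w => expR (theta * h (obs_at t w))) /\
  mean P (fun w => expR (theta * h (obs_at t w))) <= expR (2 * theta ^+ 2 * M ^+ 2).
Proof.
move=> mh th0 hM hm.
have mexp : measurable_fun setT (fun v : obsM => expR (theta * h v)).
  apply: measurableT_comp => //; apply: measurable_funM => //.
have bexp k : bdd P (fun w => expR (theta * h (obs_at k w))).
  apply: (@obs_at_bdd k (fun v => expR (theta * h v)) (expR (theta * M))) => //.
  apply: filterS hM => w hw; rewrite ger0_norm ?expR_ge0// ler_expR.
  by apply: ler_wpM2l => //; exact: le_trans (ler_norm _) hw.
split => //; have bh := obs_at_bdd 0 mh hM.
have -> : mean P (fun w => expR (theta * h (obs_at t w))) =
   mean P (fun w => expR (theta * h (obs_at 0 w))).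
  apply: EFin_inj; rewrite !meanE//.
  by apply: (@obs_at_integral t (fun v => expR (theta * h v))) => // v; exact: expR_ge0.
set c := expR _.
apply: (@le_trans _ _ (mean P (fun w => theta * h (obs_at 0 w) + c))).
  apply: mean_ae_le => //; first by apply: bddD; [exact: bddZ|exact: bdd_cst].
  apply: filterS hM => w hw; apply: le_trans (expR_le_id_plus _) _.
  rewrite lerD2l ler_expR exprMn mulrA; apply: ler_wpM2l.
    by rewrite mulr_ge0// sqr_ge0.
  rewrite -real_normK ?num_real// ler_pXn2r// nnegrE//; exact: le_trans hw.
rewrite meanD; [|exact: bddZ|exact: bdd_cst].
rewrite meanZ// mean_cst; have := mulr_ge0_le0 th0 hm; lra.
Qed.

Lemma exp_moment_sum_le (s : seq nat) (h : obsM -> R) M theta :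
  uniq s -> measurable_fun setT h -> 0 <= theta ->
  {ae P, forall w, `|h (obs_at 0 w)| <= M} ->
  mean P (fun w => h (obs_at 0 w)) <= 0 ->
  mean P (fun w => expR (theta * \sum_(t <- s) h (obs_at t w))) <=
    expR (2 * theta ^+ 2 * M ^+ 2) ^+ size s.
Proof.
move=> us mh th0 hM hm.
have -> : (fun w => expR (theta * \sum_(t <- s) h (obs_at t w))) =
   (fun w => \prod_(t <- s) expR (theta * h (obs_at t w))).
  by apply/funext => w; rewrite mulr_sumr expR_sum.
have mexp : measurable_fun setT (fun v : obsM => expR (theta * h v)).
  apply: measurableT_comp => //; apply: measurable_funM => //.
have hb t : bdd P (fun w => expR (theta * h (obs_at t w))).
  by have [] := exp_moment_le t mh th0 hM hm.
have -> : mean P (fun w => \prod_(t <- s) expR (theta * h (obs_at t w))) =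
    \prod_(t <- s) mean P (fun w => expR (theta * h (obs_at t w))).
  apply: (@mean_prod_independent _ _ _ P _ C Cmeas _
    (fun t w => expR (theta * h (obs_at t w)))) => //.
  - move=> s' A us' hA; case: DM => _ [_ [_ [_ [_ [_ [_ ind]]]]]].
    pose A' (k : nat + nat) := if k is inl t then A t else setT.
    have := ind [seq inl t | t <- s'] A'.
    rewrite map_inj_uniq ?us'; last by move=> x y [].
    move=> /(_ isT); rewrite !big_map; apply.
    by move=> k /mapP[t ts ->]; exact: hA.
  - by move=> t; apply: (measurableT_comp mexp); exact: measurable_obs_at_block.
apply: (@le_trans _ _ (\prod_(t <- s) expR (2 * theta ^+ 2 * M ^+ 2))).
  apply: ler_prod => t _; apply/andP; split.
    by apply: mean_ge0 => // w; exact: expR_ge0.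
  by have [] := exp_moment_le t mh th0 hM hm.
by rewrite big_const_seq count_predT iter_mulr_1.
Qed.

Variable T : nat.
Hypothesis T2 : (2 <= T)%N.

Lemma deviation_probability (h : obsM -> R) M k s n :
  measurable_fun setT h -> 0 < M -> 0 <= k ->
  {ae P, forall w, `|h (obs_at 0 w)| <= M} ->
  mean P (fun w => h (obs_at 0 w)) <= 0 ->
  let A w := k * M * sdev R T n < \sum_(s <= t < s + n) h (obs_at t w) in
  measurable [set w | A w] /\
  mean P (fun w => (A w)%:R) <= expR (- (k ^+ 2 * logT R T / 8)).
Proof.
move=> mh M0 k0 hM hm A.
have bS : bdd P (fun w => \sum_(s <= t < s + n) h (obs_at t w)).
  by apply: bdd_sum => t; exact: obs_at_bdd hM.
have mA : measurable [set w | A w].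
  by apply: measurable_ltr_set; [exact: measurable_cst|case: bS].
split => //.
have [n0|n0] := posnP n.
  have -> : (fun w => (A w)%:R) = cst (0 : R).
    apply/funext => w; rewrite /A n0 addn0 big_geq// ltNge.
    by rewrite (_ : 0 <= _) // mulr_ge0 ?sdev_ge0// mulr_ge0// ltW.
  by rewrite mean_cst expR_ge0.
have N0 : 0 < n%:R :> R by rewrite ltr0n.
(* Minimizes the exponent - theta k M sdev + 2 n theta^2 M^2, with minimum - k^2 logT / 8. *)
pose theta := k * sdev R T n / (4 * n%:R * M).
have sd0 := sdev_ge0 R T n.
have th0 : 0 <= theta by rewrite divr_ge0 ?mulr_ge0// ltW.
have l1 := logT_ge1 R T2.
have sd2 : sdev R T n ^+ 2 = n%:R * logT R T.
  by rewrite sqr_sqrtr// mulr_ge0// (le_trans ler01).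
have hs := exp_moment_sum_le (iota_uniq s n) mh th0 hM hm; rewrite size_iota in hs.
have bE : bdd P (fun w => expR (theta * \sum_(t <- iota s n) h (obs_at t w))).
  have -> : (fun w => expR (theta * \sum_(t <- iota s n) h (obs_at t w))) =
    (fun w => \prod_(t <- iota s n) expR (theta * h (obs_at t w))).
    by apply/funext => w; rewrite mulr_sumr expR_sum.
  by apply: bdd_prod => t; have [] := exp_moment_le t mh th0 hM hm.
apply: (@le_trans _ _ (mean P (fun w => expR (- (theta * (k * M * sdev R T n))) *
   expR (theta * \sum_(t <- iota s n) h (obs_at t w))))).
  apply: mean_le; [exact: bdd_bool|exact: bddZ|] => w.
  rewrite -expRD /A /index_iota addKn; case: ltP => hw /=; last exact: expR_ge0.
  rewrite -[leLHS](expR0 R) ler_expR addrC -mulrBr mulr_ge0//; lra.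
rewrite meanZ//; apply: le_trans (ler_wpM2l (expR_ge0 _) hs) _.
rewrite -expRM_natl -expRD ler_expR.
rewrite le_eqVlt; apply/orP; left; apply/eqP.
have -> : theta * (k * M * sdev R T n) = k ^+ 2 * (sdev R T n) ^+ 2 / (4 * n%:R).
  by rewrite /theta; field; rewrite !gt_eqF.
have -> : 2 * theta ^+ 2 * M ^+ 2 = k ^+ 2 * (sdev R T n) ^+ 2 / (8 * n%:R ^+ 2).
  by rewrite /theta; field; rewrite !gt_eqF.
by rewrite sd2; field; rewrite gt_eqF.
Qed.

End Model.

(** * Measurability of the decisions *)

Section MeasurablePolicy.
Context (R : realType) (d : measure_display) (Omega : measurableType d).
Implicit Types A : Omega -> bool.

Definition mbool A : Prop := measurable [set w | A w].

Lemma mbool_cst (c : bool) : mbool (fun=> c).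
Proof.
rewrite /mbool; case: c; first by rewrite (_ : [set w | _] = setT)//; apply/seteqP; split.
by rewrite (_ : [set w | _] = set0)//; apply/seteqP; split.
Qed.

Lemma mbool_and A A' : mbool A -> mbool A' -> mbool (fun w => A w && A' w).
Proof.
move=> mA mA'; rewrite /mbool (_ : [set w | _] = [set w | A w] `&` [set w | A' w]).
  exact: measurableI.
by apply/seteqP; split => w /=; [move=> /andP[]|move=> [-> ->]].
Qed.

Lemma mbool_not A : mbool A -> mbool (fun w => ~~ A w).
Proof.
move=> mA; rewrite /mbool (_ : [set w | _] = ~` [set w | A w]); first exact: measurableC.
by apply/seteqP; split => w /= /negP.
Qed.

Lemma mbool_forall (I : finType) (F : I -> Omega -> bool) :
  (forall i, mbool (F i)) -> mbool (fun w => [forall i, F i w]).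
Proof.
move=> mF; rewrite /mbool (_ : [set w | _] = \bigcap_i [set w | F i w]).
  by apply: fin_bigcap_measurable => // i _; exact: mF.
apply/seteqP; split => w /=; first by move=> /forallP h i _; exact: h.
by move=> h; apply/forallP => i; exact: h.
Qed.

Lemma mbool_exists (I : finType) (F : I -> Omega -> bool) :
  (forall i, mbool (F i)) -> mbool (fun w => [exists i, F i w]).
Proof.
move=> mF; have -> : (fun w => [exists i, F i w]) = (fun w => ~~ [forall i, ~~ F i w]).
  by apply/funext => w; rewrite negb_forall; apply: eq_existsb => i; rewrite negbK.
by apply: mbool_not; apply: mbool_forall => i; exact: mbool_not.
Qed.

Lemma mbool_lt (f g : Omega -> R) : measurable_fun setT f -> measurable_fun setT g ->
  mbool (fun w => f w < g w).
Proof. exact: measurable_ltr_set. Qed.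

Lemma mbool_le (f g : Omega -> R) : measurable_fun setT f -> measurable_fun setT g ->
  mbool (fun w => f w <= g w).
Proof.
move=> mf mg; have -> : (fun w => f w <= g w) = (fun w => ~~ (g w < f w)).
  by apply/funext => w; rewrite leNgt.
by apply: mbool_not; exact: mbool_lt.
Qed.

Lemma mbool_eq (A A' : Omega -> bool) : mbool A -> mbool A' -> mbool (fun w => A w == A' w).
Proof.
move=> mA mA'; have -> : (fun w => A w == A' w) =
    (fun w => ~~ (~~ (A w && A' w) && ~~ (~~ A w && ~~ A' w))).
  by apply/funext => w; case: (A w); case: (A' w).
by apply: mbool_not; apply: mbool_and; apply: mbool_not; apply: mbool_and => //;
  exact: mbool_not.
Qed.

(** The pick depends on [w] only through the truth table of [F w], and there are finitely many
    tables. *)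
Lemma mbool_pick (I : finType) (F : Omega -> I -> bool) (k : I) :
  (forall i, mbool (fun w => F w i)) -> mbool (fun w => [pick i | F w i] == Some k).
Proof.
move=> mF.
have -> : (fun w => [pick i | F w i] == Some k) = (fun w =>
   [exists c : {ffun I -> bool}, ([pick i | c i] == Some k) && [forall i, F w i == c i]]).
  apply/funext => w; apply/idP/existsP => [h|[c /andP[h /forallP e]]].
    exists [ffun i => F w i]; rewrite -(eq_pick (P := F w)) => [|i]; last by rewrite ffunE.
    by rewrite h; apply/forallP => i; rewrite ffunE.
  by rewrite (eq_pick (Q := fun i => c i)) => // i; exact/eqP.
apply: mbool_exists => c; apply: mbool_and; first exact: mbool_cst.
by apply: mbool_forall => i; apply: mbool_eq => //; exact: mbool_cst.
Qed.

Variables (m : nat) (rb ab bb bl lmin lam mu dB : R) (T : nat).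
Variables (r : nat -> Omega -> R) (a b : nat -> 'I_m -> Omega -> R).
Variable u : nat -> Omega -> R.
Hypotheses (mr : forall t, measurable_fun setT (r t))
  (ma : forall t j, measurable_fun setT (a t j))
  (mb : forall t j, measurable_fun setT (b t j)).

Local Notation rw w := (fun k => r k w).
Local Notation aw w := (fun k j => a k j w).
Local Notation bw w := (fun k j => b k j w).

Lemma measurable_sum_nat (s t : nat) (F : nat -> Omega -> R) :
  (forall k, (k < t)%N -> measurable_fun setT (F k)) ->
  measurable_fun setT (fun w => \sum_(s <= k < t) F k w).
Proof.
move=> mF; have -> : (fun w => \sum_(s <= k < t) F k w) =
   (fun w => \sum_(s <= k < t) (if (k < t)%N then F k w else 0)).
  by apply/funext => w; apply: eq_big_nat => k /andP[_ ->].
by apply: measurable_sum => k; case kt : (k < t)%N => //; exact: mF.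
Qed.

Lemma measurable_inventory (x : nat -> Omega -> bool) s t j : (s <= t)%N ->
  (forall k, (k < t)%N -> mbool (x k)) ->
  measurable_fun setT (fun w => inventory (aw w) (bw w) (fun k => x k w) s j).
Proof.
move=> st mx; rewrite /inventory.
under eq_fun do rewrite -(big_mkord xpredT (fun k => b k j _ - a k j _ * (x k _)%:R)).
apply: measurable_sum_nat => k ks; apply: measurable_funB => //.
apply: measurable_funM => //; apply: measurable_bool_natr.
by apply: mx; exact: leq_trans ks st.
Qed.

Lemma mbool_win p t : mbool (fun w => dotp (aw w t) p < rw w t).
Proof. by apply: mbool_lt => //; exact: (measurable_dotp p (ma t)). Qed.

Lemma measurable_usage p s n j :
  measurable_fun setT (fun w => usage (rw w) (aw w) p s n j).
Proof.
apply: measurable_sum_nat => k _; apply: measurable_funM => //.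
by apply: measurable_bool_natr; exact: mbool_win.
Qed.

Lemma measurable_supply s n j : measurable_fun setT (fun w => supply (bw w) s n j).
Proof. by apply: measurable_sum_nat => k _. Qed.

Lemma mbool_accept (x : nat -> Omega -> bool) t : (forall k, (k < t)%N -> mbool (x k)) ->
  mbool (fun w => accept rb ab bb bl lmin lam mu dB T (rw w) (aw w) (bw w)
    (fun k => x k w) t).
Proof.
move=> mx; rewrite /accept; set s := epoch_start _ _ _ _ _ _ _ _ _ t.
apply: mbool_and; first exact: mbool_cst.
have [st|_] := leqP s t; last exact: mbool_cst.
rewrite /=; apply: mbool_and; last first.
  apply: mbool_forall => j; apply: mbool_le => //.
  by apply: measurable_funD => //; exact: (measurable_inventory (t := t)).
pose ep w := epoch_price rb ab bb bl mu T (rw w) (aw w) (bw w) (fun k => x k w) s.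
have -> : (fun w => if epoch_price rb ab bb bl mu T (rw w) (aw w) (bw w) (fun k => x k w) s
     is Some k then dotp (aw w t) (price k) < rw w t else false) =
  (fun w => [exists k, (ep w == Some k) && (dotp (aw w t) (price k) < rw w t)]).
  apply/funext => w; rewrite -/(ep w); case: (ep w) => [k|].
    apply/idP/existsP => [h|[k' /andP[/eqP[->]]//]].
    by exists k; rewrite eqxx.
  by apply/esym/negbTE; rewrite negb_exists; apply/forallP.
apply: mbool_exists => k; apply: mbool_and; last exact: mbool_win.
apply: mbool_pick => i; apply: mbool_and; first exact: mbool_cst.
have mdr j : measurable_fun setT (fun w => drift ab bb mu T (aw w) (bw w) (fun k => x k w) s j).
  apply: measurable_maxr => //; apply: measurable_funM => //; apply: measurable_funB => //.
  exact: (measurable_inventory (t := t)).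
have mu' j : measurable_fun setT (fun w => usage (rw w) (aw w) (price i) 0 s j / s%:R).
  by apply: measurable_funM => //; exact: measurable_usage.
have ms' j : measurable_fun setT (fun w => supply (bw w) 0 s j / s%:R - drift ab bb mu T (aw w) (bw w) (fun k => x k w) s j).
  by apply: measurable_funB => //; apply: measurable_funM => //; exact: measurable_supply.
apply: mbool_forall => j; apply: mbool_and.
  by apply: mbool_le => //; exact: measurable_funD.
case: (0 < price i j) => /=; last exact: mbool_cst.
by apply: mbool_le => //; exact: measurable_funB.
Qed.

Lemma mbool_epoch_policy t : mbool (fun w =>
  epoch_policy rb ab bb bl lmin lam mu dB T t (rw w) (aw w) (bw w) (fun k => u k w)).
Proof.
elim/ltn_ind: t => t ih.
under [X in mbool X]eq_fun do rewrite epoch_policyE.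
exact: (@mbool_accept (fun k w =>
  epoch_policy rb ab bb bl lmin lam mu dB T k (rw w) (aw w) (bw w) (fun k => u k w))).
Qed.

End MeasurablePolicy.

(** * Bounding an expectation by an almost sure majorant *)

Section UpperExpectation.
Context (R : realType) (d : measure_display) (Omega : measurableType d).
Variable P : probability Omega R.

(* W need not be measurable: its integral is then bounded through the supremum
   over simple functions below the positive part. *)
Lemma expectation_le_mean (W G : Omega -> R) : bdd P G -> (forall w, 0 <= G w) ->
  {ae P, forall w, W w <= G w} -> ('E_P[W] <= (mean P G)%:E)%E.
Proof.
move=> bG G0 [N [mN PN sN]]; rewrite expectationE.
(* [g] is infinite on the null set [N], so it dominates everywhere and the suprema over simple
   functions can be compared. *)
pose f w := (W w)%:E; pose g w := ((G w)%:E + ((fun=> +oo) \_ N) w)%E.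
have h0 w : (0 <= ((fun=> +oo) \_ N) w :> \bar R)%E by rewrite /patch; case: ifP.
have g0 w : (0 <= g w)%E by rewrite adde_ge0// lee_fin.
have mG : measurable_fun setT (fun w => (G w)%:E) by apply/measurable_EFinP; case: bG.
have mg : measurable_fun setT g.
  apply: emeasurable_funD => //; apply/(measurable_restrictT _ mN).1.
  exact: measurable_cst.
have fg w : (f^\+ w <= g w)%E.
  rewrite /g /patch; case: ifPn => [_|]; first by rewrite addey// leey.
  rewrite notin_setE => wN; rewrite adde0 funeposE /f ge_max lee_fin lee_fin G0 andbT.
  by apply: contrapT => h; apply: wN; apply: sN.
have -> : (mean P G)%:E = (\int[P]_w g w)%E.
  rewrite meanE//; apply: ae_eq_integral => //.
  exists N; split => // w /= h; apply: contrapT => wN; apply: h => _.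
  by rewrite /g /patch memNset// adde0.
apply: (@le_trans _ _ (\int[P]_w (f^\+ w))%E).
  rewrite [leLHS]integralE.
  have : (0 <= \int[P]_x (f^\- x))%E by exact: integral_ge0.
  rewrite -/f; set y := (\int[P]_x (f^\- x))%E; move=> y0.
  by rewrite -[leRHS]sube0; apply: leeB.
rewrite !ge0_integralTE//; apply: ereal_sup_le => _ [h hf <-].
by exists h => // w; apply: le_trans (hf w) (fg w).
Qed.

End UpperExpectation.

(** * The union bound and the expected regret *)

Section RegretBound.
Context (R : realType) (d : measure_display) (Omega : measurableType d).
Variables (P : probability Omega R) (m : nat).
Variables (r : nat -> Omega -> R) (a b : nat -> 'I_m -> Omega -> R).
Variable u : nat -> Omega -> R.
Variables (rb ab bb bl lmin lam mu dB : R) (T : nat).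
Hypothesis DM : data_model P r a b u.
Hypothesis ND : non_degenerate P (r 0) (a 0) (b 0) rb ab bb bl lmin lam mu.
Hypothesis DBok : delta_B_ok P (r 0) (a 0) (b 0) bl bb dB.
Hypothesis T2 : (2 <= T)%N.
Variable ps : 'I_m -> R.
Hypothesis hps : is_minimizer P (r 0) (a 0) (Bmean P (b 0)) ps.

Let mr t : measurable_fun setT (r t). Proof. by case: DM. Qed.
Let ma t j : measurable_fun setT (a t j). Proof. by case: DM => _ []. Qed.
Let mb t j : measurable_fun setT (b t j). Proof. by case: DM => _ [_ []]. Qed.

Local Notation obsM := (obsM R m).
Local Notation obs := (obs_at r a b).
Local Notation l := (logT R T).
Local Notation index := ('I_T.+1 * 'I_T.+1 * (grid m rb bl T) * 'I_m * 'I_3 * bool)%type.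

Definition reward_gap (p : 'I_m -> R) (v : obsM) : R :=
  (v.1.1 - dotp v.1.2 ps) *
  ((dotp v.1.2 ps < v.1.1)%R%:R - (dotp v.1.2 p < v.1.1)%R%:R).

(** Usage, replenishment and reward loss form one family, so that a single union bound covers
    them. *)
Definition monitored (p : 'I_m -> R) (j : 'I_m) (c : nat) (v : obsM) : R :=
  match c with
  | 0 => v.1.2 j * (dotp v.1.2 p < v.1.1)%R%:R
  | 1 => v.2 j
  | _ => reward_gap p v
  end.

(* The term 1/T keeps the last bound positive when p = ps. *)
Definition monitored_bound (p : 'I_m -> R) (c : nat) : R :=
  match c with
  | 0 => ab
  | 1 => bb
  | _ => ab * (dist1 p ps + T%:R^-1)
  end.

Lemma monitored_bound_gt0 p c : 0 < monitored_bound p c.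
Proof.
have [[_ ab0 bb0 _] _] := nondeg_pos ND.
case: c => [|[|c]] //=; rewrite mulr_gt0//.
rewrite ltr_wpDl ?invr_gt0 ?ltr0n ?(ltnW T2)//.
by apply: sumr_ge0.
Qed.

Let measurable_obs_win p : measurable_fun setT
  (fun v : obsM => (dotp v.1.2 p < v.1.1)%R%:R : R).
Proof.
apply: measurable_bool_natr; apply: measurable_ltr_set; last exact: measurable_obs_r.
by apply: measurable_dotp => j; exact: measurable_obs_a.
Qed.

Lemma measurable_monitored p j c : measurable_fun setT (monitored p j c).
Proof.
case: c => [|[|c]] /=.
- by apply: measurable_funM; [exact: measurable_obs_a|exact: measurable_obs_win].
- exact: measurable_obs_b.
- apply: measurable_funM; apply: measurable_funB => //; try exact: measurable_obs_win.
    exact: measurable_obs_r.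
  by apply: measurable_dotp => i; exact: measurable_obs_a.
Qed.

Lemma monitored_le p j c :
  {ae P, forall w, `|monitored p j c (obs 0 w)| <= monitored_bound p c}.
Proof.
have [[_ ab0 bb0 _] _] := nondeg_pos ND.
case: c => [|[|c]] /=.
- apply: filterS (ae_a ND) => w /(_ j) h; rewrite normrM -[leRHS]mulr1.
  apply: ler_pM => //; case: (_ < _); by rewrite ?normr1 ?normr0.
- by apply: filterS (ae_b ND) => w /(_ j)/andP[h1 h2]; rewrite ger0_norm.
- apply: filterS (ae_a ND) => w h.
  have := dotp_norm_le (fun i => p i - ps i) h; rewrite -dotpB -/(dist1 p ps).
  have T0 : 0 <= T%:R^-1 :> R by rewrite invr_ge0.
  have := mulr_ge0 (ltW ab0) T0; rewrite mulrDr /reward_gap /=.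
  move=> hT; rewrite ler_norml => /andP[e1 e2]; rewrite ler_norml.
  by case: ltP => h1; case: ltP => h2; rewrite /= ?mulr1n ?mulr0n; apply/andP; split; lra.
Qed.

Lemma bdd_monitored p j c : bdd P (fun w => monitored p j c (obs 0 w)).
Proof. exact: (obs_at_bdd DM 0 (measurable_monitored p j c) (monitored_le p j c)). Qed.

Definition monitored_mean p j c : R := mean P (fun w => monitored p j c (obs 0 w)).

(** The sign [neg] gives both tails. Centring at most doubles the range, which the halved [cbeta]
    compensates. *)
Definition bad (i : index) (w : Omega) : bool :=
  let: (s, n, k, j, c, neg) := i in
  cbeta R m / 2 * (2 * monitored_bound (price k) c) * sdev R T n <
  \sum_(s <= t < s + n)
    (-1) ^+ neg * (monitored (price k) j c (obs t w) - monitored_mean (price k) j c).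

Lemma bad_probability i : measurable [set w | bad i w] /\
  mean P (fun w => (bad i w)%:R) <= expR (- (m%:R + 3) * l).
Proof.
case: i => [[[[[s n] k] j] c] neg] /=.
set p := price k; set mm := monitored_mean p j c; set M := monitored_bound p c.
have M0 : 0 < M := monitored_bound_gt0 p c.
pose h v := (-1) ^+ neg * (monitored p j c v - mm).
have mh : measurable_fun setT h.
  apply: measurable_funM => //; apply: measurable_funB => //; exact: measurable_monitored.
have bm := bdd_monitored p j c.
have hmm : `|mm| <= M.
  apply: le_trans (mean_norm bm) _; apply: mean_ae_le_cst; first exact: bdd_norm.
  exact: monitored_le.
have hM : {ae P, forall w, `|h (obs 0 w)| <= 2 * M}.
  apply: filterS (monitored_le p j c) => w hw.
  rewrite /h normrM normrX normrN1 expr1n mul1r; apply: le_trans (ler_normB _ _) _.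
  have -> : 2 * M = M + M by ring.
  exact: lerD.
have hm : mean P (fun w => h (obs 0 w)) <= 0.
  rewrite /h meanZ; last by apply: bddB => //; exact: bdd_cst.
  by rewrite meanB//; [rewrite mean_cst subrr mulr0|exact: bdd_cst].
have cb0 : 0 <= cbeta R m / 2 by rewrite /cbeta; have := ler0n R m; lra.
have M20 : 0 < 2 * M by rewrite mulr_gt0.
have [h1 h2] := deviation_probability DM T2 s n mh M20 cb0 hM hm.
split; first exact: h1.
(* The exponent is (cbeta / 2)^2 / 8 = 32 (m + 3)^2 times [logT], more than the required m + 3. *)
apply: le_trans h2 _; rewrite ler_expR mulNr lerN2 /cbeta.
have := ler0n R m; have := logT_ge1 R T2; nra.
Qed.

Local Notation phi := (usage_mean P (r 0) (a 0)).
Local Notation B := (Bmean P (b 0)).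

Let monitored_sum s n (k : grid m rb bl T) j (c : 'I_3) w : (forall i, ~~ bad i w) -> (s + n <= T)%N ->
  `|\sum_(s <= t < s + n) monitored (price k) j c (obs t w) -
    n%:R * monitored_mean (price k) j c| <=
  cbeta R m * monitored_bound (price k) c * sdev R T n.
Proof.
move=> hb snT; have sT : (s < T.+1)%N by rewrite ltnS; exact: leq_trans (leq_addr _ _) snT.
have nT : (n < T.+1)%N by rewrite ltnS; exact: leq_trans (leq_addl _ _) snT.
have := hb (Ordinal sT, Ordinal nT, k, j, c, false).
have := hb (Ordinal sT, Ordinal nT, k, j, c, true).
rewrite /bad /= expr0 expr1 -!leNgt.
under eq_bigr do rewrite mulN1r.
rewrite sumrN; under [X in _ -> X <= _ -> _]eq_bigr do rewrite mul1r.
rewrite sumrB big_const_nat addKn iter_addr_0 -(mulr_natl _ n) => h1 h2.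
have e : cbeta R m / 2 * (2 * monitored_bound (price k) c) =
  cbeta R m * monitored_bound (price k) c by field.
by rewrite e in h1 h2; rewrite ler_norml; apply/andP; split; lra.
Qed.

Lemma good_path_not_bad w : (forall i, ~~ bad i w) ->
  (forall t, `|r t w| <= rb) -> (forall t j, `|a t j w| <= ab) ->
  (forall t j, 0 <= b t j w <= bb) ->
  good_path rb ab bb bl mu T phi B ps
    (fun k => r k w) (fun k j => a k j w) (fun k j => b k j w).
Proof.
have m0 := nondeg_dim ND; have hB := Bmean_Omega_b DBok.
move=> hb hr ha hbb; split => //.
- by move=> k s n j; exact: (@monitored_sum s n k j (@Ordinal 3 0 isT) w hb).
- by move=> s n j; exact: (@monitored_sum s n [ffun=> ord0] j (@Ordinal 3 1 isT) w hb).
- move=> k s n snT hp.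
  have := @monitored_sum s n k (Ordinal m0) (@Ordinal 3 2 isT) w hb snT.
  rewrite ler_norml /= mulrA => /andP[_ h].
  have := ler_wpM2l (ler0n R n) (mean_reward_loss (mr 0) (ma 0) ND hB hps hp) => loss.
  rewrite lerBlDl in h; apply: le_trans h _; rewrite lerD2r; exact: loss.
Qed.

Lemma card_grid_le : #|{: grid m rb bl T}|%:R <= ((rb / bl + 1) * T%:R) ^+ m :> R.
Proof.
have [[rb0 _ _ bl0] _] := nondeg_pos ND.
have q0 : 0 <= rb / bl * T%:R by rewrite mulr_ge0// divr_ge0 ?ltW.
rewrite card_ffun !card_ord natrX; case: (m) => [|m']; first by rewrite !expr0.
rewrite ler_pXn2r ?nnegrE//; last by rewrite mulr_ge0// addr_ge0// divr_ge0 ?ltW.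
have /andP[h _] := truncn_itv q0; rewrite -natr1 mulrDl mul1r.
by apply: lerD => //; rewrite ler1n (ltnW T2).
Qed.

Definition cbad : R := 48 * rb * m%:R * (rb / bl + 1) ^+ m.

(** The powers of T cancel: T from the trivial regret, T^2 intervals and T^m prices against
    T^-(m+3). In [cbad], 48 is 2 * 4 * 3 * 2: the trivial regret, (T + 1)^2 <= 4 T^2, three
    statistics, two signs. *)
Lemma bad_total : 2 * T%:R * rb * \sum_(i : index) mean P (fun w => (bad i w)%:R) <= cbad.
Proof.
have [[rb0 _ _ bl0] _] := nondeg_pos ND.
have T0 : 0 < T%:R :> R by rewrite ltr0n (ltnW T2).
have l1 := logT_ge1 R T2.
have q1 : 0 <= rb / bl + 1 by rewrite addr_ge0// divr_ge0 ?ltW.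
have pr : expR (- (m%:R + 3) * l) <= T%:R ^- (m + 3) :> R.
  rewrite -natrD mulNr -mulrN expRM_natl -exprVn.
  apply: lerXn2r; rewrite ?nnegrE ?expR_ge0 ?invr_ge0//.
  rewrite expRN lef_pV2 ?posrE ?expR_gt0// /logT expRD lnK ?posrE//.
  by apply: ler_peMl => //; apply: le_trans (expR_ge1Dx _); lra.
have hsum : \sum_(i : index) mean P (fun w => (bad i w)%:R) <=
    #|{: index}|%:R * T%:R ^- (m + 3).
  rewrite mulr_natl -[X in _ *+ X]sum1_card -sumrMnr; apply: ler_sum => i _.
  rewrite mulr1n; apply: le_trans pr; exact: (bad_probability i).2.
have hcard : #|{: index}|%:R <= 24 * m%:R * T%:R ^+ 2 * ((rb / bl + 1) * T%:R) ^+ m :> R.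
  rewrite !card_prod !card_ord card_bool !natrM.
  have hT1 : T.+1%:R <= 2 * T%:R :> R.
    by rewrite -natrM ler_nat; clear -T2; lia.
  have t1 : T.+1%:R * T.+1%:R <= 4 * T%:R ^+ 2 :> R.
    have -> : 4 * T%:R ^+ 2 = (2 * T%:R) * (2 * T%:R) :> R by ring.
    by apply: ler_pM.
  have -> : 24 * m%:R * T%:R ^+ 2 * ((rb / bl + 1) * T%:R) ^+ m =
    (4 * T%:R ^+ 2) * ((rb / bl + 1) * T%:R) ^+ m * m%:R * 3 * 2 :> R by ring.
  do 3![apply: ler_wpM2r => //].
  by apply: ler_pM => //; exact: card_grid_le.
apply: le_trans (ler_wpM2l _ hsum) _; first by rewrite !mulr_ge0 ?ltW.
have TV : 0 <= T%:R ^- (m + 3) :> R by rewrite invr_ge0 exprn_ge0// ltW.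
have := ler_wpM2r TV hcard => h1.
apply: le_trans (ler_wpM2l _ h1) _; first by rewrite !mulr_ge0 ?ltW.
rewrite le_eqVlt; apply/orP; left; apply/eqP.
rewrite /cbad exprMn exprD; set y := (rb / bl + 1) ^+ m.
by field; rewrite expf_neq0 gt_eqF.
Qed.

Lemma Rstar_le_horizon (rs : nat -> R) (as_ bs : nat -> 'I_m -> R) : 0 < rb ->
  (forall t, `|rs t| <= rb) -> Rstar T rs as_ bs <= T%:R * rb.
Proof.
move=> rb0 hr; apply: bigmax_le => [|x _]; first by rewrite mulr_ge0// ltW.
rewrite mulr_natl -[X in _ *+ X]card_ord -sumr_const; apply: ler_sum => t _.
have := hr t; rewrite ler_norml => /andP[_ h].
by case: (x t); rewrite ?mulr1 ?mulr0// ltW.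
Qed.

Local Notation x t w := (epoch_policy rb ab bb bl lmin lam mu dB T t
  (fun k => r k w) (fun k j => a k j w) (fun k j => b k j w) (fun k => u k w)).

Lemma expected_regret_le :
  ('E_P[(fun w => Rstar T (fun k => r k w) (fun k j => a k j w) (fun k j => b k j w)
          - \sum_(t < T) r t w * (x t w)%:R)%R]
   <= ((`|cregret m rb ab bb bl lmin lam mu dB| + cbad) * l ^+ 2)%:E)%E.
Proof.
have [[rb0 ab0 bb0 bl0] [lmin0 lam0 mu0]] := nondeg_pos ND.
have dB0 := delta_pos DBok; have m0 := nondeg_dim ND.
have l1 := logT_ge1 R T2.
have C0 : 0 <= 2 * T%:R * rb by rewrite !mulr_ge0// ltW.
pose S w := \sum_(i : index) (bad i w)%:R : R.
have bS : bdd P S by apply: bdd_sum => i; apply: bdd_bool; exact: (bad_probability i).1.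
have S0 w : 0 <= S w by apply: sumr_ge0 => i _.
have K0 : 0 <= `|cregret m rb ab bb bl lmin lam mu dB| * l ^+ 2.
  by rewrite mulr_ge0// sqr_ge0.
(* The regret never exceeds 2 T rb, and [S], the number of bad events, dominates the indicator that
   one occurs. *)
pose G w := `|cregret m rb ab bb bl lmin lam mu dB| * l ^+ 2 + 2 * T%:R * rb * S w.
have bG : bdd P G by apply: bddD; [exact: bdd_cst|exact: bddZ].
have ae1 : {ae P, forall w, forall t, `|r t w| <= rb}.
  apply/ae_foralln => t; apply: (obs_at_ae_le DM t (h := fun v => `|v.1.1|)).
    by apply: measurableT_comp => //; exact: measurable_obs_r.
  by apply: filterS (ae_r ND).
have ae2 : {ae P, forall w, forall t j, `|a t j w| <= ab}.
  apply/ae_foralln => t; apply: filter_forall => j.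
  apply: (obs_at_ae_le DM t (h := fun v => `|v.1.2 j|)).
    by apply: measurableT_comp => //; exact: measurable_obs_a.
  by apply: filterS (ae_a ND) => w /(_ j).
have ae3 : {ae P, forall w, forall t j, 0 <= b t j w <= bb}.
  apply/ae_foralln => t; apply: filter_forall => j.
  have h1 : {ae P, forall w, b t j w <= bb}.
    apply: (obs_at_ae_le DM t (h := fun v => v.2 j)); first exact: measurable_obs_b.
    by apply: filterS (ae_b ND) => w /(_ j)/andP[].
  have h2 : {ae P, forall w, - b t j w <= 0}.
    apply: (obs_at_ae_le DM t (h := fun v => - v.2 j)).
      by apply: measurableT_comp => //; exact: measurable_obs_b.
    by apply: filterS (ae_b ND) => w /(_ j)/andP[h _]; rewrite oppr_le0.
  by apply: filterS2 h1 h2 => w -> ; rewrite oppr_le0 => ->.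
apply: le_trans (expectation_le_mean (G := G) bG _ _) _.
- by move=> w; rewrite addr_ge0// mulr_ge0.
- apply: filterS3 ae1 ae2 ae3 => w h1 h2 h3.
  have [hb|] := boolP [forall i, ~~ bad i w].
    have gp := good_path_not_bad (fun i => forallP hb i) h1 h2 h3.
    have DF := minimizer_dual_facts (mr 0) (ma 0) ND DBok hps.
    apply: le_trans (pathwise_regret m0 T2 rb0 ab0 bb0 bl0 lmin0 lam0 mu0 dB0 DF
      (fun k => u k w) gp) _.
    rewrite /G -[leLHS]addr0; apply: lerD; last by rewrite mulr_ge0.
    by apply: ler_wpM2r; [exact: sqr_ge0|exact: ler_norm].
  rewrite negb_forall => /existsP[i]; rewrite negbK => bi.
  have S1 : 1 <= S w.
    by rewrite /S (bigD1 i)//= bi lerDl sumr_ge0.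
  apply: (@le_trans _ _ (2 * T%:R * rb)); last first.
    rewrite /G -[leLHS]add0r; apply: lerD => //.
    by rewrite -[leLHS]mulr1; apply: ler_wpM2l.
  have := Rstar_le_horizon (fun k j => a k j w) (fun k j => b k j w) rb0 h1.
  have : - \sum_(t < T) r t w * (x t w)%:R <= T%:R * rb.
    rewrite -sumrN mulr_natl -[X in _ *+ X]card_ord -sumr_const.
    apply: ler_sum => t _; have := h1 t; rewrite ler_norml => /andP[h _].
    by case: (epoch_policy _ _ _ _ _ _ _ _ _ _ _ _ _ _); rewrite ?mulr1 ?mulr0 ?oppr0; lra.
  lra.
rewrite lee_fin meanD; [|exact: bdd_cst|exact: bddZ].
rewrite mean_cst meanZ// mean_sum; last first.
  by move=> i; apply: bdd_bool; exact: (bad_probability i).1.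
rewrite [leRHS]mulrDl; apply: lerD => //; apply: le_trans bad_total _.
have cb0 : 0 <= cbad.
  apply: mulr_ge0; last by rewrite exprn_ge0// addr_ge0// divr_ge0 ?ltW.
  by apply: mulr_ge0 => //; apply: mulr_ge0 => //; exact: ltW.
rewrite -[leLHS]mulr1; apply: ler_wpM2l => //.
by rewrite expr_ge1// (le_trans ler01).
Qed.

End RegretBound.

(* pol m rb ab bb bl lmin lam mu dB T : the policy for m resources, horizon T,
   built only from the constants r_bar, a_bar, b_bar, b_underbar, lambda_min,
   lambda, mu, delta_B. *)
Theorem theorem4 (R : realType) :
  exists pol : forall m : nat, R -> R -> R -> R -> R -> R -> R -> R -> nat -> policy R m,
    (forall m rb ab bb bl lmin lam mu dB T,
        nonanticipative (pol m rb ab bb bl lmin lam mu dB T) /\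
        feasible_policy T (pol m rb ab bb bl lmin lam mu dB T)) /\
    (forall (m : nat) (rb ab bb bl lmin lam mu dB : R),
      exists C : R,
      forall (d : measure_display) (Omega : measurableType d) (P : probability Omega R)
             (r : nat -> Omega -> R) (a b : nat -> 'I_m -> Omega -> R)
             (u : nat -> Omega -> R),
        data_model P r a b u ->
        non_degenerate P (r 0%N) (a 0%N) (b 0%N) rb ab bb bl lmin lam mu ->
        delta_B_ok P (r 0%N) (a 0%N) (b 0%N) bl bb dB ->
        forall T : nat, (2 <= T)%N ->
          let x := fun (t : nat) (w : Omega) =>
            pol m rb ab bb bl lmin lam mu dB T t
              (fun k => r k w) (fun k j => a k j w) (fun k j => b k j w) (fun k => u k w) in
          (forall t, (t < T)%N -> measurable [set w | x t w]) /\
          ('E_P[(fun w => Rstar T (fun k => r k w) (fun k j => a k j w) (fun k j => b k j w)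
                   - \sum_(t < T) r t w * (x t w)%:R)%R]
             <= (C * ln T%:R ^+ 2)%:E)%E).
Proof.
exists (fun m rb ab bb bl lmin lam mu dB T => epoch_policy rb ab bb bl lmin lam mu dB T).
split=> [m rb ab bb bl lmin lam mu dB T|m rb ab bb bl lmin lam mu dB].
  by split; [exact: epoch_policy_nonanticipative|exact: epoch_policy_feasible].
pose K := `|cregret m rb ab bb bl lmin lam mu dB| + cbad m rb bl.
(* For T at least 2, 1 + ln T <= (1 + 1 / ln 2) ln T, which replaces [logT] by [ln T]. *)
exists (`|K| * (1 + (ln 2)^-1) ^+ 2) => d Omega P r a b u DM ND DBok T T2 /=.
have mr t : measurable_fun setT (r t) by case: DM.
have ma t j : measurable_fun setT (a t j) by case: DM => _ [].
have mb t j : measurable_fun setT (b t j) by case: DM => _ [_ []].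
split=> [t _|]; first exact: mbool_epoch_policy.
have [ps hps] := minimizer_exists (mr 0) (ma 0) ND (Bmean_Omega_b DBok).
apply: le_trans (expected_regret_le DM ND DBok T2 hps) _.
rewrite lee_fin -/K; apply: le_trans (_ : `|K| * logT R T ^+ 2 <= _).
  by apply: ler_wpM2r; [exact: sqr_ge0|exact: ler_norm].
rewrite -mulrA; apply: ler_wpM2l => //; rewrite -exprMn.
have l2 : 0 < ln 2 :> R by apply: ln_gt0; lra.
have lT : ln 2 <= ln T%:R :> R.
  by rewrite ler_ln ?posrE ?ltr0n ?(ltnW T2)// (ler_nat R 2 T).
apply: lerXn2r; rewrite ?nnegrE.
- by rewrite (le_trans ler01)// logT_ge1.
- by rewrite mulr_ge0// ?addr_ge0// ?invr_ge0 ?ltW// (lt_le_trans l2).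
- rewrite /logT mulrDl mul1r addrC lerD2l mulrC ler_pdivlMr// mul1r.
  exact: lT.
Qed.
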